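(* Let $N,N_1,N_2\in\{1,2,\ldots\}$ with $N_1+N_2=N$. Let $\mathbf{l}\in\mathcal{L}^N$ and $L\in\mathcal{L}$. Suppose $\mathbf{l}=(\mathbf{l}^{(1)},\mathbf{l}^{(2)})\in\mathcal{L}^{N_1}\times\mathcal{L}^{N_2}$. Then a basis of $V^{\mathbf{l},L}$ is given by $$b^{\mathbf{l},L}_{(L_1,i_1,L_2,i_2,j)}=\Big[\sum_{k_1\in\mathcal{M}_{L_1},\,k_2\in\mathcal{M}_{L_2}}c^{(L_1,L_2),L}_{(k_1,k_2),k,j}\,[b^{\mathbf{l}^{(1)},L_1}_{i_1}]_{k_1}\,[b^{\mathbf{l}^{(2)},L_2}_{i_2}]_{k_2}\Big]_{k\in\mathcal{M}_L},$$ for $L_1,L_2\in\mathcal{L}$, $i_1\in\{1,\ldots,\dim(V^{\mathbf{l}^{(1)},L_1})\}$, $i_2\in\{1,\ldots,\dim(V^{\mathbf{l}^{(2)},L_2})\}$, $j\in\{1,\ldots,\dim(V^{(L_1,L_2),L})\}$, where $\{b^{\mathbf{l}^{(1)},L_1}_{i_1}\}_{i_1=1,\ldots,\dim(V^{\mathbf{l}^{(1)},L_1})}$ and $\{b^{\mathbf{l}^{(2)},L_2}_{i_2}\}_{i_2=1,\ldots,\dim(V^{\mathbf{l}^{(2)},L_2})}$ are bases of $V^{\mathbf{l}^{(1)},L_1}$ and $V^{\mathbf{l}^{(2)},L_2}$, respectively, and $\{c^{(L_1,L_2),L}_{(k_1,k_2),k,j}\}_{j=1,\ldots,\dim(V^{(L_1,L_2),L})}$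 is a basis of $\ker(M^{(L_1,L_2),L})$. Moreover, $$\dim(V^{\mathbf{l},L})=\sum_{L_1,L_2\in\mathcal{L}}\dim(V^{(L_1,L_2),L})\,\dim(V^{\mathbf{l}^{(1)},L_1})\,\dim(V^{\mathbf{l}^{(2)},L_2}).$$
   Context: Setting. $G$ is a compact connected linear Lie group with Lie algebra $\mathfrak{g}$; $X_1,\ldots,X_{N_{\rm dim}}$ is a set of generators of $\mathfrak{g}$. $\mathbb{F}$ is a vector space over a field $\mathbb{K}$ (typically $\mathbb{R}$ or $\mathbb{C}$). $G$ acts on a domain $\Omega$, and diagonally on $\Omega^n$ for every $n$: $g\cdot(r_1,\ldots,r_n)=(g\cdot r_1,\ldots,g\cdot r_n)$. $\mathcal{L}$ is a (typically countable and totally ordered) index set; for $l\in\mathcal{L}$, $\mathcal{M}_l$ is a finite totally ordered set and $V^l=\mathrm{Span}\{\phi^l_m:m\in\mathcal{M}_l\}$, where the functions $\phi^l_m:\Omega\to\mathbb{F}$ are orthonormal for a given scalar product ($\langle\phi^l_m,\phi^{l'}_{m'}\rangle=\delta_{ll'}\delta_{mm'}$) and $V^l$ is stable under $G$, with continuous matrix representation $\rho^l$ of $G$: $\phi^l_m(g\cdot r)=\sum_{m'\in\mathcal{M}_l}\rho^l_{m,m'}(g)\phi^l_{m'}(r)$. The $\rho^l$, $l\in\mathcal{L}$, with corresponding spaces $V^l$, are assumed to be a complete set of mutually inequivalent irreducible representations of $G$. For $\mathbf{l}\in\mathcal{L}^n$: $\mathcal{M}_{\mathbf{l}}=\prod_i\mathcal{M}_{l_i}$,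 and $V^{\mathbf{l}}=\bigotimes_{i=1}^nV^{l_i}$, with basis the products $\phi^{\mathbf{l}}_{\mathbf{m}}=\prod_{i=1}^n\phi^{l_i}_{m_i}$ (the $i$-th factor evaluated at the $i$-th variable), $\mathbf{m}\in\mathcal{M}_{\mathbf{l}}$, which are orthonormal for the induced scalar product. For $L\in\mathcal{L}$, $V^{\mathbf{l},L}$ is the space of group-equivariant functions $F\in[V^{\mathbf{l}}]^{|\mathcal{M}_L|}$ for $\rho^L$, i.e. $F(g\cdot R)=\rho^L(g)F(R)$ for all $g\in G$, $R\in\Omega^n$; $[F]_k$, $k\in\mathcal{M}_L$, is the $k$-th component of $F$. In the product of components in the claim, the first factor is a function of the first $N_1$ variables and the second of the last $N_2$ variables. Matrix $M^{(L_1,L_2),L}$: with $\varrho^{l,d}=\frac{d}{dt}|_{t=0}\rho^l(\exp(tX_d))$, it is the vertical stacking over $d=1,\ldots,N_{\rm dim}$ of the matrices $M_d$ with rows and columns indexed by $((k_1,k_2),k)\in(\mathcal{M}_{L_1}\times\mathcal{M}_{L_2})\times\mathcal{M}_L$ and entries $$M_d[((k_1,k_2),k),((k_1',k_2'),k')]=\varrho^{L_1,d}_{k_1',k_1}\delta_{k_2k_2'}\delta_{kk'}+\delta_{k_1k_1'}\varrho^{L_2,d}_{k_2',k_2}\delta_{kk'}-\delta_{k_1k_1'}\delta_{k_2k_2'}\varrho^{L,d}_{k,k'}.$$ Its kernel has dimension $\dim(V^{(L_1,L_2),L})$.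
   Formalization: For K = R it is additionally assumed that every ρ^l has only scalar commuting matrices (absolute irreducibility); without this the claim fails, e.g. for G = SO(2) over R with l = (1,1), L trivial, where the dimensions are 2 and 8. *)

(* Defs.v *)
From HB Require Import structures.
From mathcomp Require Import all_boot all_order all_algebra complex.
From mathcomp Require Import all_classical all_reals all_analysis.

Set Implicit Arguments.
Unset Strict Implicit.
Unset Printing Implicit Defensive.

Import Order.TTheory GRing.Theory Num.Theory.
Import numFieldNormedType.Exports.

Local Open Scope classical_set_scope.
Local Open Scope ring_scope.

Variant field_kind := RealField | ComplexField.

Definition base_field (R : realType) (c : field_kind) : numFieldType :=
  match c with RealField => R | ComplexField => R[i] end.

Definition of_real (R : realType) (c : field_kind) : R -> base_field R c :=
  match c with RealField => fun x => x | ComplexField => fun x => x%:C%C end.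

Definition conj_scalar (R : realType) (c : field_kind) :
    base_field R c -> base_field R c :=
  match c with RealField => fun x => x | ComplexField => fun z => z^*%C end.

Section LinearAlgebra.
Variables (K : fieldType) (E : lmodType K).

Definition linear_subspace (V : set E) : Prop :=
  V 0 /\ forall (a : K) (x y : E), V x -> V y -> V (a *: x + y).

Definition span_of (I : finType) (b : I -> E) : set E :=
  [set x | exists a : I -> K, x = \sum_i a i *: b i].

(* The index type may be infinite, so linear combinations run over finite
   sequences of indices. *)
Definition is_basis (I : eqType) (b : I -> E) (V : set E) : Prop :=
  [/\ forall i, V (b i),
      forall (s : seq I) (a : I -> K), uniq s ->
        \sum_(i <- s) a i *: b i = 0 -> forall i, i \in s -> a i = 0
    & forall x, V x -> exists (s : seq I) (a : I -> K),
        x = \sum_(i <- s) a i *: b i].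

(* Junk value 0 for infinite-dimensional subspaces. *)
Definition fdim (V : set E) : nat :=
  xget 0%N [set n | exists b : 'I_n -> E, is_basis b V].

End LinearAlgebra.

(* [D] is the space of vectors on which the product is defined (for instance
   the continuous functions, or the span of the functions at hand); [sp] is
   irrelevant outside [D]. *)
Record is_scalar_product (R : realType) (c : field_kind)
    (E : lmodType (base_field R c)) (D : set E) (sp : E -> E -> base_field R c) :
    Prop := {
  sp_domain : linear_subspace D;
  sp_linear : forall (a : base_field R c) (x y z : E), D x -> D y -> D z ->
    sp (a *: x + y) z = a * sp x z + sp y z;
  sp_conj : forall x y : E, D x -> D y -> sp y x = conj_scalar (sp x y);
  sp_ge0 : forall x : E, D x -> 0 <= sp x x;
  sp_definite : forall x : E, D x -> sp x x = 0 -> x = 0 }.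

Section LieGroup.
Variables (R : realType) (d : nat).
Implicit Types (G h : set 'M[R]_d) (X Y : 'M[R]_d).

(* Closed subgroups of GL_d(R); complex matrix groups are covered through
   GL_d(C) as a closed subgroup of GL_2d(R). *)
Record is_linear_lie_group G : Prop := {
  lie_group_unit : forall g, G g -> g \in unitmx;
  lie_group_one : G 1%:M;
  lie_group_mul : forall g1 g2, G g1 -> G g2 -> G (g1 *m g2);
  lie_group_inv : forall g, G g -> G (invmx g);
  lie_group_closed : exists2 C : set 'M[R]_d, closed C &
    G = C `&` [set g | g \in unitmx] }.

Definition mxexp X : 'M[R]_d :=
  lim (series (fun k : nat => (k`!%:R)^-1 *: X ^+ k) @ \oo).

Definition lie_algebra G : set 'M[R]_d :=
  [set X | forall t : R, G (mxexp (t *: X))].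

Definition lie_subalgebra h : Prop :=
  linear_subspace h /\
  forall X Y, h X -> h Y -> h (X *m Y - Y *m X).

(* The [X i] generate as a Lie algebra; in particular they may be a basis or
   any spanning family of the Lie algebra. *)
Definition lie_generators G (n : nat) (X : 'I_n -> 'M[R]_d) : Prop :=
  (forall i, lie_algebra G (X i)) /\
  forall h, lie_subalgebra h -> (forall i, h (X i)) -> lie_algebra G `<=` h.

End LieGroup.

Section Representations.
Variables (R : realType) (c : field_kind) (d : nat) (G : set 'M[R]_d).
Local Notation K := (base_field R c).

Record is_representation (n : nat) (rho : 'M[R]_d -> 'M[K]_n) : Prop := {
  rep_one : rho 1%:M = 1%:M;
  rep_mul : forall g1 g2, G g1 -> G g2 -> rho (g1 *m g2) = rho g1 *m rho g2;
  rep_continuous : {within G, continuous rho} }.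

(* A subspace of K^n is the row space of a matrix [U].  Acting on rows from
   the right is what the action of G on span(phi_m) by f |-> f(g . _) looks
   like in coordinates. *)
Definition irreducible_rep (n : nat) (rho : 'M[R]_d -> 'M[K]_n) : Prop :=
  (0 < n)%N /\
  forall U : 'M[K]_n, (forall g, G g -> stablemx U (rho g)) ->
    U = 0 \/ row_full U.

Definition equivalent_rep (m n : nat) (rho : 'M[R]_d -> 'M[K]_m)
    (sigma : 'M[R]_d -> 'M[K]_n) : Prop :=
  exists (P : 'M[K]_(m, n)) (Q : 'M[K]_(n, m)),
    [/\ P *m Q = 1%:M, Q *m P = 1%:M
      & forall g, G g -> rho g *m P = P *m sigma g].

Record complete_irreducible_family (I : eqType) (n : I -> nat)
    (rho : forall l, 'M[R]_d -> 'M[K]_(n l)) : Prop := {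
  family_rep : forall l, is_representation (rho l);
  family_irreducible : forall l, irreducible_rep (rho l);
  family_inequivalent : forall l l', l != l' ->
    ~ equivalent_rep (rho l) (rho l');
  family_complete : forall (k : nat) (sigma : 'M[R]_d -> 'M[K]_k),
    is_representation sigma -> irreducible_rep sigma ->
    exists l, equivalent_rep (rho l) sigma }.

(* Automatic for irreducible representations over C (Schur's lemma); over R it
   singles out the absolutely irreducible ones. *)
Definition scalar_commutant (n : nat) (rho : 'M[R]_d -> 'M[K]_n) : Prop :=
  forall A : 'M[K]_n, (forall g, G g -> A *m rho g = rho g *m A) ->
    is_scalar_mx A.

(* d/dt at t = 0 of rho (exp (t X)), for a real variable t. *)
Definition rep_deriv (n : nat) (rho : 'M[R]_d -> 'M[K]_n) (X : 'M[R]_d) :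
    'M[K]_n :=
  lim ((fun t : R => (of_real c t)^-1 *:
         (rho (mxexp (t *: X)) - rho (mxexp (0 *: X)))) @ 0^').

End Representations.

(* The stacked matrix M^((L1,L2),L) built from the representations
   rho1, rho2, rho of L1, L2, L: its rows are indexed by (i, ((k1,k2),k)), with
   i a generator, and its columns by ((k1,k2),k). *)
Section InvariantKernel.
Variables (R : realType) (c : field_kind) (d Ndim : nat).
Variable X : 'I_Ndim -> 'M[R]_d.
Variables n1 n2 n : nat.
Local Notation K := (base_field R c).
Local Notation cols := ('I_n1 * 'I_n2 * 'I_n)%type.
Variables (rho1 : 'M[R]_d -> 'M[K]_n1) (rho2 : 'M[R]_d -> 'M[K]_n2)
  (rho : 'M[R]_d -> 'M[K]_n).

Definition coupling_mx (row : 'I_Ndim * cols) (col : cols) : K :=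
  let: (i, (k1, k2, k)) := row in
  let: (k1', k2', k') := col in
  rep_deriv rho1 (X i) k1' k1 * (k2 == k2')%:R * (k == k')%:R
  + (k1 == k1')%:R * rep_deriv rho2 (X i) k2' k2 * (k == k')%:R
  - (k1 == k1')%:R * (k2 == k2')%:R * rep_deriv rho (X i) k k'.

Definition coupling_ker : set (cols -> K^o) :=
  [set x | forall row, \sum_col coupling_mx row col * x col = 0].

End InvariantKernel.

Record is_action (R : realType) (d : nat) (G : set 'M[R]_d) (Omega : Type)
    (act : 'M[R]_d -> Omega -> Omega) : Prop := {
  act_one : forall r, act 1%:M r = r;
  act_mul : forall g1 g2 r, G g1 -> G g2 ->
    act (g1 *m g2) r = act g1 (act g2 r) }.

Section Equivariant.
Variables (R : realType) (c : field_kind).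
Local Notation K := (base_field R c).
Variables (d : nat) (G : set 'M[R]_d).
Variables (Omega : Type) (act : 'M[R]_d -> Omega -> Omega).
(* The functions [phi l m] have values in the vector space [F]; products of
   values are formed in a K-algebra [A] into which [F] is mapped by [emb]:
   F = A = K and the identity for scalar functions, the tensor algebra of [F]
   for a general [F]. *)
Variables (F : lmodType K) (A : algType K) (emb : {linear F -> A}).
Variables (I : eqType) (n : I -> nat) (phi : forall l, 'I_(n l) -> Omega -> F).
Variable rho : forall l, 'M[R]_d -> 'M[K]_(n l).

Definition tensor_fun (N : nat) (f : 'I_N -> Omega -> F) : N.-tuple Omega -> A :=
  fun r => \prod_(i < N) emb (f i (tnth r i)).

Definition multi_index (N : nat) (l : N.-tuple I) : finType :=
  {dffun forall i : 'I_N, 'I_(n (tnth l i))}.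

Definition basis_fun (N : nat) (l : N.-tuple I) (m : multi_index l) :
    N.-tuple Omega -> A :=
  tensor_fun (fun i => @phi (tnth l i) (m i)).

Definition tensor_space (N : nat) (l : N.-tuple I) : set (N.-tuple Omega -> A) :=
  span_of (@basis_fun N l).

Definition equivariant_space (N : nat) (l : N.-tuple I) (L : I) :
    set ('I_(n L) -> N.-tuple Omega -> A) :=
  [set f | (forall k, tensor_space l (f k)) /\
    forall g (r : N.-tuple Omega) (k : 'I_(n L)), G g ->
      f k (map_tuple (act g) r) = \sum_k' rho L g k k' *: f k' r].

Definition equivariant_dim (N : nat) (l : N.-tuple I) (L : I) : nat :=
  fdim (@equivariant_space N l L).

(* [sp] is the scalar product on functions of one variable, [spn N] the one
   it induces on functions of N variables. *)
Definition induced_scalar_product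
    (D : set (Omega -> F)) (sp : (Omega -> F) -> (Omega -> F) -> K)
    (Dn : forall N, set (N.-tuple Omega -> A))
    (spn : forall N, (N.-tuple Omega -> A) -> (N.-tuple Omega -> A) -> K) :
    Prop :=
  (forall N, is_scalar_product (Dn N) (@spn N)) /\
  forall N (f h : 'I_N -> Omega -> F),
    (forall i, D (f i)) -> (forall i, D (h i)) ->
    [/\ Dn N (tensor_fun f), Dn N (tensor_fun h)
      & spn N (tensor_fun f) (tensor_fun h) = \prod_(i < N) sp (f i) (h i)].

End Equivariant.

Definition first_vars (T : Type) (N1 N2 : nat) (r : (N1 + N2).-tuple T) :
    N1.-tuple T := [tuple tnth r (lshift N2 i) | i < N1].

Definition last_vars (T : Type) (N1 N2 : nat) (r : (N1 + N2).-tuple T) :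
    N2.-tuple T := [tuple tnth r (rshift N1 i) | i < N2].

Section Coupling.
Variables (R : realType) (c : field_kind).
Local Notation K := (base_field R c).
Variables (Omega : Type) (A : algType K) (I : choiceType) (n : I -> nat).
Variables (N1 N2 : nat) (L : I).
(* dim1 L1 = dim V^(l1,L1), dim2 L2 = dim V^(l2,L2),
   dim12 (L1, L2) = dim V^((L1,L2),L) *)
Variables (dim1 dim2 : I -> nat) (dim12 : I * I -> nat).

Definition coupled_index : choiceType :=
  {p : I * I & ('I_(dim1 p.1) * 'I_(dim2 p.2) * 'I_(dim12 p))%type}.

Definition coupled_fun
    (b1 : forall L1, 'I_(dim1 L1) -> 'I_(n L1) -> N1.-tuple Omega -> A)
    (b2 : forall L2, 'I_(dim2 L2) -> 'I_(n L2) -> N2.-tuple Omega -> A)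
    (cf : forall L1 L2, 'I_(dim12 (L1, L2)) ->
      'I_(n L1) * 'I_(n L2) * 'I_(n L) -> K)
    (x : coupled_index) : 'I_(n L) -> (N1 + N2).-tuple Omega -> A :=
  let: existT (L1, L2) (i1, i2, j) := x in
  fun k r => \sum_(k1 < n L1) \sum_(k2 < n L2)
    cf L1 L2 j (k1, k2, k) *:
      (b1 L1 i1 k1 (first_vars r) * b2 L2 i2 k2 (last_vars r)).

End Coupling.

(* Main.v *)
Require Import Defs.
From HB Require Import structures.
From mathcomp Require Import all_boot all_order all_algebra complex.
From mathcomp Require Import all_classical all_reals all_analysis.
From mathcomp Require Import ring lra.

Set Implicit Arguments.
Unset Strict Implicit.
Unset Printing Implicit Defensive.

Import Order.TTheory GRing.Theory Num.Theory.
Import numFieldNormedType.Exports.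

Local Open Scope classical_set_scope.
Local Open Scope ring_scope.

(** Fix the representations sigma1 and sigma2 of G on the two tensor products
    V^l1 and V^l2.  The product functions are orthonormal, hence independent, so
    everything can be read in coordinates: an element of V^(l1,L1) is a matrix B
    with B sigma1(g) = rho_L1(g) B ([equivariant_funmx]), and an element of V^(l,L)
    is a family of matrices M_k with
      sigma1(g)^T M_k sigma2(g) = sum_k' rho_L(g)_kk' M_k'
    ([equivariant_tensors_fun]).

    Let B_x run through the chosen bases of all spaces V^(l1,L1), and B_y through
    those of all V^(l2,L2).  The rows of the B_x form a basis of all row vectors:
    they are independent by Schur's lemma ([copies_free]), and they span because
    sigma1 is a sum of irreducible representations, each equivalent to some rho_L1
    ([copies_span_full]).  Hence M_k is in a unique way a sum of matrices
    B_x^T Gamma_xy,k B_y, and by uniqueness M is equivariant if and only if every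
    Gamma_xy is an invariant coupling of rho_L1, rho_L2 and rho_L.  Expanding the
    Gamma_xy in bases of the spaces of invariant couplings gives a basis of the
    equivariant tensors ([coupled_mx_basis]), which is the coordinate form of the
    coupled functions; counting its indices gives the dimension formula.

    It remains to identify the invariant couplings with the kernel of the coupling
    matrix ([coupling_kerE]).  They are the vectors fixed by a representation of G
    whose differentials at the generators X_d are stacked in that matrix, so the
    claim is that a vector killed by these differentials is fixed by G
    ([rep_fixedP]).  Continuous one-parameter groups of matrices are exponentials
    ([one_param_mxexp]); therefore the stabiliser H of the vector contains all
    exp(tX_d), and its Lie algebra, being a Lie subalgebra
    ([lie_algebra_subalgebra]), is that of G.  A compact subgroup with the full Lie
    algebra is open in G ([cmg_nbhs1]), and G is connected, so H = G.

    Complete reducibility ([complete_reducibility]) asks for an equivariant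
    projection onto a stable subspace.  In place of averaging over G, it is found
    as a fixed point in the convex set of all projections, by minimising the
    supremum of the Euclidean norm over orbits ([fixed_point]).  Complex matrices
    are replaced by real ones of twice the size for these analytic arguments. *)

(** * Limits of matrices and the exponential *)

Section MatrixLimits.
Context {T : Type} {F : set_system T} {FF : Filter F}.

Lemma cvg_mxP (K : numFieldType) m n (f : T -> 'M[K]_(m, n)) (M : 'M[K]_(m, n)) :
  f @ F --> M <-> forall i j, f x i j @[x --> F] --> M i j.
Proof.
split=> [fM i j|fM].
  exact: (cvg_comp _ _ fM (@coord_continuous K m n i j M)).
move=> A [P MP PA]; apply: (@filterS _ _ _ [set x | forall i j, P i j (f x i j)]).
  by move=> x Px; apply: PA.
by apply: filter_forall => i; apply: filter_forall => j; apply: fM; apply: MP.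
Qed.

Lemma cvg_sumr (K : numFieldType) (I : Type) (r : seq I) (f : I -> T -> K) (a : I -> K) :
  (forall i, f i x @[x --> F] --> a i) ->
  \sum_(i <- r) f i x @[x --> F] --> \sum_(i <- r) a i.
Proof.
move=> fa; elim: r => [|i r IH].
  by rewrite big_nil; under eq_fun do rewrite big_nil; exact: cvg_cst.
by rewrite big_cons; under eq_fun do rewrite big_cons; apply: cvgD.
Qed.

Lemma cvg_mulmx (K : numFieldType) m n p (f : T -> 'M[K]_(m, n))
    (g : T -> 'M[K]_(n, p)) (A : 'M[K]_(m, n)) (B : 'M[K]_(n, p)) :
  f @ F --> A -> g @ F --> B -> f x *m g x @[x --> F] --> A *m B.
Proof.
move=> /cvg_mxP fA /cvg_mxP gB; apply/cvg_mxP => i j; rewrite mxE.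
under eq_fun do rewrite mxE.
by apply: cvg_sumr => k; apply: cvgM.
Qed.

End MatrixLimits.

Lemma mx_cvg_unique (K : numFieldType) (T : Type) (F : set_system T)
    {FF : ProperFilter F} m n (f : T -> 'M[K]_(m, n)) (X Y : 'M[K]_(m, n)) :
  f x @[x --> F] --> X -> f x @[x --> F] --> Y -> X = Y.
Proof. by apply: cvg_unique; exact: norm_hausdorff. Qed.

Section MatrixNorm.
Variable R : realType.

Lemma mx_entry_le m n (A : 'M[R]_(m, n)) i j : `|A i j| <= `|A|.
Proof. by rewrite [leRHS]mx_normrE; apply: (le_bigmax _ _ (i, j)). Qed.

Lemma mx_norm_le m n (A : 'M[R]_(m, n)) (c : R) :
  0 <= c -> (forall i j, `|A i j| <= c) -> `|A| <= c.
Proof.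
by move=> c0 Ac; rewrite [leLHS]mx_normrE; apply/bigmax_leP; split => // -[i j] _.
Qed.

Lemma mx_norm_mulmx m n p (A : 'M[R]_(m, n)) (B : 'M[R]_(n, p)) :
  `|A *m B| <= n%:R * `|A| * `|B|.
Proof.
apply: mx_norm_le => [|i j]; first by rewrite !mulr_ge0.
rewrite mxE (le_trans (ler_norm_sum _ _ _))//.
rewrite -mulrA mulr_natl (_ : _ *+ n = \sum_(k < n) (`|A| * `|B|)).
  by apply: ler_sum => k _; rewrite normrM ler_pM ?mx_entry_le.
by rewrite sumr_const card_ord.
Qed.

Lemma mx_norm1_le n : `|1%:M : 'M[R]_n| <= 1.
Proof. by apply: mx_norm_le => // i j; rewrite mxE; case: eqP => _; rewrite ?normr1 ?normr0. Qed.

Lemma mx_norm_expr d (X : 'M[R]_d) k : `|X ^+ k| <= (d.+1%:R * `|X|) ^+ k.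
Proof.
elim: k => [|k IH]; first by rewrite !expr0; exact: mx_norm1_le.
rewrite exprS (le_trans (mx_norm_mulmx _ _))// exprS.
by rewrite ler_pM ?mulr_ge0// ler_wpM2r// ler_nat.
Qed.

End MatrixNorm.

Section Exponential.
Variables (R : realType) (d : nat).
Implicit Types X Y : 'M[R]_d.

(** Tannery's theorem, i.e. dominated convergence for finite sums whose number of
    terms varies: the dominating series makes the tails uniformly small, and a
    fixed number of terms converges termwise. *)
Lemma tannery (T : Type) (F : set_system T) {FF : ProperFilter F}
    (f : T -> nat -> 'M[R]_d) (N : T -> nat) (g : nat -> 'M[R]_d) (M : nat -> R) :
  (forall k, f x k @[x --> F] --> g k) ->
  (forall x k, (N x <= k)%N -> f x k = 0) ->
  (\forall x \near F, forall k, `|f x k| <= M k) ->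
  cvgn (series M) ->
  cvgn (series g) /\ \sum_(k < N x) f x k @[x --> F] --> limn (series g).
Proof.
move=> fg f0 fM cM.
have gM k : `|g k| <= M k.
  have cf : `|f x k| @[x --> F] --> `|g k| by apply: cvg_norm.
  suff : [set r : R | r <= M k] `|g k| by [].
  apply: (closed_cvg _ _ _ _ cf); first exact: closed_le.
  by apply: filterS fM => x; apply.
have M0 k : 0 <= M k by apply: le_trans (gM k).
have cg : cvgn (series g).
  apply/cauchy_cvgP/cauchy_seriesP => e e0.
  move/cauchy_cvgP/cauchy_seriesP: (cM) => /(_ e e0); apply: filterS => n.
  apply: le_lt_trans; rewrite ger0_norm ?sumr_ge0//.
  by rewrite (le_trans (ler_norm_sum _ _ _))// ler_sum.
split=> //; apply/cvgrPdist_lt => e e0.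
have e3 : 0 < e / 3 by rewrite divr_gt0.
have /filter_ex[J [JM Jg]] : \forall J \near \oo,
    (forall n, (J <= n)%N -> \sum_(J <= k < n) M k < e / 3) /\
    `|limn (series g) - series g J| < e / 3.
  have /cvgrPdist_lt/(_ _ e3) h1 : series M n @[n --> \oo] --> limn (series M) by [].
  have /cvgrPdist_lt/(_ _ e3) h2 : series g n @[n --> \oo] --> limn (series g) by [].
  near=> J; split; last by near: J; exact: h2.
  move=> n Jn; rewrite -sub_series_geq//.
  have h : series M n <= limn (series M).
    by apply: nondecreasing_cvgn_le => //; apply: nondecreasing_series.
  have : `|limn (series M) - series M J| < e / 3 by near: J; exact: h1.
  apply: le_lt_trans; rewrite (le_trans _ (ler_norm _))//.
  by rewrite lerB.
have hs : \sum_(k < J) f x k @[x --> F] --> series g J.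
  rewrite seriesEord; apply/cvg_mxP => a b; rewrite summxE.
  under eq_fun do rewrite summxE.
  by apply: cvg_sumr => k; move: (fg k) => /cvg_mxP.
move/cvgrPdist_lt: hs => /(_ _ e3) hs.
near=> x.
have fMx k : `|f x k| <= M k by move: k; near: x.
have -> : \sum_(k < N x) f x k = \sum_(k < J) f x k + \sum_(J <= k < maxn J (N x)) f x k.
  rewrite -!(big_mkord predT) -big_cat_nat ?leq_maxl//=.
  rewrite [RHS](big_cat_nat (leq0n (N x)))/= ?leq_maxr//.
  by rewrite [X in _ = _ + X]big_nat_cond [X in _ = _ + X]big1 ?addr0// => k /andP[/andP[/f0]].
have h1 : `|limn (series g) - series g J| < e / 3 by [].
have h2 : `|series g J - \sum_(k < J) f x k| < e / 3 by near: x.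
have h3 : `|\sum_(J <= k < maxn J (N x)) f x k| < e / 3.
  apply: le_lt_trans (JM (maxn J (N x)) (leq_maxl _ _)).
  rewrite (le_trans (ler_norm_sum _ _ _))// ler_sum// => k _.
rewrite opprD addrA -[X in `|X - _|](subrKA (series g J)).
rewrite (le_lt_trans (ler_normB _ _))//.
rewrite [ltRHS](_ : e = e / 3 + e / 3 + e / 3); last by field.
by rewrite ltrD// (le_lt_trans (ler_normD _ _))// ltrD.
Unshelve. all: by end_near. Qed.

Lemma mx_exprZ (a : R) X k : (a *: X) ^+ k = a ^+ k *: X ^+ k.
Proof.
elim: k => [|k IH]; first by rewrite !expr0 scale1r.
by rewrite !exprS IH -[LHS]/(_ *m _) -scalemxAl -scalemxAr scalerA.
Qed.

Lemma cvg_mx_expr (T : Type) (F : set_system T) {FF : ProperFilter F}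
    (Y : T -> 'M[R]_d) X k :
  Y x @[x --> F] --> X -> Y x ^+ k @[x --> F] --> X ^+ k.
Proof.
move=> YX; elim: k => [|k IH]; first by under eq_fun do rewrite expr0; exact: cvg_cst.
by under eq_fun do rewrite exprS; rewrite exprS; apply: cvg_mulmx.
Qed.

Lemma ffact_le_expn n k : (n ^_ k <= n ^ k)%N.
Proof.
elim: k => [|k IH]; first by rewrite ffactn0.
by rewrite ffactnSr expnSr leq_mul// leq_subr.
Qed.

Lemma cvg_bin_pow (T : Type) (F : set_system T) {FF : ProperFilter F}
    (e : T -> R) (n : T -> nat) (t : R) k :
  e x @[x --> F] --> 0 -> (n x)%:R * e x @[x --> F] --> t ->
  'C(n x, k)%:R * e x ^+ k @[x --> F] --> t ^+ k / k`!%:R.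
Proof.
move=> e0 nt.
have ffk : (n x ^_ k)%:R * e x ^+ k @[x --> F] --> t ^+ k.
  elim: k => [|k IH]; first by under eq_fun do rewrite ffactn0 mul1r; exact: cvg_cst.
  rewrite exprSr.
  have -> : (fun x => (n x ^_ k.+1)%:R * e x ^+ k.+1) =
      (fun x => (n x ^_ k)%:R * e x ^+ k * ((n x)%:R * e x - k%:R * e x)).
    apply/funext => x; rewrite ffactnSr natrM exprSr.
    have [kn|nk] := leqP k (n x); first by rewrite natrB//; ring.
    by rewrite ffact_small// !mul0r.
  apply: cvgM => //; rewrite -[X in _ --> X]subr0 -[X in _ --> _ - X](mulr0 k%:R).
  by apply: cvgB => //; apply: cvgM => //; exact: cvg_cst.
have k0 : (k`!%:R : R) != 0 by rewrite pnatr_eq0 -lt0n fact_gt0.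
have -> : (fun x => 'C(n x, k)%:R * e x ^+ k) =
    (fun x => (n x ^_ k)%:R * e x ^+ k / k`!%:R).
  by apply/funext => x; rewrite -bin_ffact natrM; field.
by apply: cvgM => //; exact: cvg_cst.
Qed.

(** Euler's limit with a varying matrix, step and exponent.  In the binomial
    expansion the coefficients C(n, k) e^k tend to t^k / k!, and Tannery's theorem
    exchanges limit and sum.  With [Y], [e] and [n] varying along any filter, the
    lemma serves the functional equation of the exponential, tangent directions of
    closed groups and one-parameter groups alike. *)
Lemma pow_cvg_mxexp (T : Type) (F : set_system T) {FF : ProperFilter F}
    (Y : T -> 'M[R]_d) (e : T -> R) (n : T -> nat) X (t : R) :
  Y x @[x --> F] --> X -> e x @[x --> F] --> 0 ->
  (n x)%:R * e x @[x --> F] --> t ->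
  (1%:M + e x *: Y x) ^+ n x @[x --> F] --> mxexp (t *: X).
Proof.
move=> YX e0 nt.
pose c := (`|t| + 1) * (d.+1%:R * (`|X| + 1)).
have := @tannery T F _
  (fun x k => ('C(n x, k)%:R * e x ^+ k) *: Y x ^+ k) (fun x => (n x).+1)
  (fun k => (k`!%:R)^-1 *: (t *: X) ^+ k) (exp_coeff c).
case.
- move=> k; rewrite mx_exprZ scalerA [_^-1 * _]mulrC.
  by apply: cvgZ; [exact: cvg_bin_pow | exact: cvg_mx_expr].
- by move=> x k nk; rewrite bin_small// mul0r scale0r.
- have hY : \forall x \near F, `|Y x| <= `|X| + 1.
    have /cvgrPdist_le/(_ 1 ltr01) := YX; apply: filterS => x h.
    by rewrite -lerBlDl (le_trans _ h)// distrC lerB_dist.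
  have hn : \forall x \near F, (n x)%:R * `|e x| <= `|t| + 1.
    have /cvgrPdist_le/(_ 1 ltr01) := nt; apply: filterS => x h.
    rewrite -[(n x)%:R]ger0_norm// -normrM.
    by rewrite -lerBlDl (le_trans _ h)// distrC lerB_dist.
  near=> x => k.
  rewrite normrZ /exp_coeff /= /c exprMn mulrAC.
  apply: ler_pM => //.
    rewrite normrM normr_nat normrX ler_pdivlMr ?ltr0n ?fact_gt0// mulrAC -natrM.
    rewrite bin_ffact (@le_trans _ _ (((n x)%:R * `|e x|) ^+ k))//.
      by rewrite exprMn ler_wpM2r ?exprn_ge0// -natrX ler_nat ffact_le_expn.
    apply: lerXn2r; rewrite ?nnegrE ?mulr_ge0 ?addr_ge0//.
    by near: x.
  rewrite (le_trans (mx_norm_expr _ _))//.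
  apply: lerXn2r; rewrite ?nnegrE ?mulr_ge0 ?addr_ge0//.
  by rewrite ler_wpM2l//; near: x.
- exact: is_cvg_series_exp_coeff.
move=> _; apply: cvg_trans; apply: near_eq_cvg; near=> x.
rewrite addrC -[1%:M]/(1 : 'M[R]_d) exprD1n; apply: eq_bigr => k _.
by rewrite mx_exprZ -[RHS]scaler_nat scalerA.
Unshelve. all: by end_near. Qed.

Lemma cvg_mxexp X : series (fun k => (k`!%:R)^-1 *: X ^+ k) @ \oo --> mxexp X.
Proof.
have := @tannery nat \oo _ (fun x k => if (k < x)%N then (k`!%:R)^-1 *: X ^+ k else 0) id
  (fun k => (k`!%:R)^-1 *: X ^+ k) (exp_coeff (d.+1%:R * `|X|)).
case=> //.
- move=> k; apply: cvg_near_cst; near=> x; rewrite ifT//; near: x.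
  exact: nbhs_infty_gt.
- by move=> x k xk; rewrite ltnNge xk.
- near=> x => k; case: ifP => _; last by rewrite normr0 exp_coeff_ge0// mulr_ge0.
  rewrite normrZ /exp_coeff/= mulrC normfV normr_nat ler_wpM2r ?invr_ge0//.
  exact: mx_norm_expr.
- exact: is_cvg_series_exp_coeff.
Unshelve. all: by end_near. Qed.

Lemma mxexp0 : mxexp (0 : 'M[R]_d) = 1%:M.
Proof.
have := @pow_cvg_mxexp nat \oo _ (fun=> 0) (fun=> 0) (fun=> 0%N) 0 0.
rewrite scaler0 mul0r => /(_ _ (cvg_cst _) (cvg_cst _) (cvg_cst _)) h.
by apply: mx_cvg_unique h _; exact: cvg_cst.
Qed.

(** The number of steps of length [e x] that fit into [s]: the exponent used with
    [pow_cvg_mxexp] to reach an arbitrary time [s]. *)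
Lemma cvg_truncn_mul (T : Type) (F : set_system T) {FF : ProperFilter F}
    (e : T -> R) (s : R) :
  0 <= s -> (\forall x \near F, 0 < e x) -> e x @[x --> F] --> 0 ->
  (Num.truncn (s / e x))%:R * e x @[x --> F] --> s.
Proof.
move=> s0 egt0 e0; apply/cvgrPdist_le => eps eps0.
move/cvgrPdist_le: e0 => /(_ _ eps0) he.
near=> x.
have ex0 : 0 < e x by near: x.
have ex : e x <= eps.
  by rewrite -[leLHS]gtr0_norm// -normrN -sub0r; near: x.
have /andP[h1 h2] := truncn_itv (divr_ge0 s0 (ltW ex0)).
rewrite ler_pdivlMr// in h1; rewrite ltr_pdivrMr// -natr1 mulrDl mul1r in h2.
rewrite ger0_norm ?subr_ge0// (le_trans _ ex)// lerBlDl; exact: ltW.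
Unshelve. all: by end_near. Qed.

(** Both exponentials are limits of powers of one matrix 1 + e X, so the identity
    is x^(m+n) = x^m x^n in the limit; for this the times must be nonnegative. *)
Lemma mxexpD_ge0 (s t : R) X : 0 <= s -> 0 <= t ->
  mxexp ((s + t) *: X) = mxexp (s *: X) *m mxexp (t *: X).
Proof.
move=> s0 t0.
have e0 : (@harmonic R) k @[k --> \oo] --> 0 by exact: cvg_harmonic.
have egt0 : \forall k \near \oo, 0 < @harmonic R k by near=> k; rewrite /harmonic invr_gt0.
have hX : (fun=> X) k @[k --> \oo] --> X by exact: cvg_cst.
have hs  := @cvg_truncn_mul _ \oo eventually_filter _ _ s0 egt0 e0.
have ht  := @cvg_truncn_mul _ \oo eventually_filter _ _ t0 egt0 e0.
have hs'  := @pow_cvg_mxexp _ \oo eventually_filter _ _ _ _ _ hX e0 hs.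
have ht'  := @pow_cvg_mxexp _ \oo eventually_filter _ _ _ _ _ hX e0 ht.
have hst : (Num.truncn (s / harmonic k) + Num.truncn (t / harmonic k))%:R *
    (@harmonic R k) @[k --> \oo] --> s + t.
  by under eq_fun do rewrite natrD mulrDl; exact: cvgD.
have h  := @pow_cvg_mxexp _ \oo eventually_filter _ _ _ _ _ hX e0 hst.
apply: mx_cvg_unique h _; under eq_fun do rewrite exprD.
exact: (cvg_mulmx hs' ht').
Unshelve. all: by end_near. Qed.

(** (1 - X/k)^k (1 + X/k)^k = (1 + Y/k)^k with Y = - X^2/k tending to 0. *)
Lemma mxexpNK X : mxexp (- X) *m mxexp X = 1%:M.
Proof.
have e0 : (@harmonic R) k @[k --> \oo] --> 0 by exact: cvg_harmonic.
have ne : k.+1%:R * (@harmonic R k) @[k --> \oo] --> (1 : R).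
  by under eq_fun do rewrite /harmonic /= divff ?pnatr_eq0//; exact: cvg_cst.
have h Y : (1%:M + harmonic k *: Y) ^+ k.+1 @[k --> \oo] --> mxexp Y.
  by rewrite -[Y in mxexp Y]scale1r; apply: pow_cvg_mxexp e0 ne; exact: cvg_cst.
have h1  := @cvg_mulmx _ \oo eventually_filter _ _ _ _ _ _ _ _ (h (- X)) (h X).
apply: mx_cvg_unique h1 _.
have hY : - (harmonic k *: (X *m X)) @[k --> \oo] --> (0 : 'M[R]_d).
  rewrite -oppr0 -(scale0r (X *m X)); apply: cvgN; apply: cvgZ => //; exact: cvg_cst.
have := @pow_cvg_mxexp _ \oo eventually_filter _ _ _ _ _ hY e0 ne.
rewrite scaler0 mxexp0.
apply: cvg_trans; apply: near_eq_cvg; near=> k.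
set e := harmonic k.
have cZ : GRing.comm (1 + e *: (- X)) (1 + e *: X).
  rewrite scalerN /GRing.comm !(mulrDl, mulrDr, mul1r, mulr1, mulrN, mulNr).
  by rewrite addrACA.
rewrite -[X in _ = X]/(_ * _) -(exprMn_comm _ cZ); congr (_ ^+ _).
rewrite !scalerN !(mulrDl, mulrDr, mul1r, mulr1, mulNr) -addrA addNKr.
by rewrite -[_ * _]/(_ *m _) -scalemxAl -scalemxAr.
Unshelve. all: by end_near. Qed.

Lemma mxexpKN X : mxexp X *m mxexp (- X) = 1%:M.
Proof. by rewrite -{1}[X]opprK mxexpNK. Qed.

Lemma mxexpD (s t : R) X :
  mxexp ((s + t) *: X) = mxexp (s *: X) *m mxexp (t *: X).
Proof.
have NK (u : R) : mxexp ((- u) *: X) *m mxexp (u *: X) = 1%:M by rewrite scaleNr mxexpNK.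
have KN (u : R) : mxexp (u *: X) *m mxexp ((- u) *: X) = 1%:M by rewrite scaleNr mxexpKN.
have le0 (u v : R) : u <= 0 -> v <= 0 ->
    mxexp ((u + v) *: X) = mxexp (u *: X) *m mxexp (v *: X).
  move=> u0 v0; have := @mxexpD_ge0 (- u) (- v) (- X).
  by rewrite !scalerN -!scaleNr opprD !opprK; apply; rewrite oppr_ge0.
have [s0|/ltW s0] := leP 0 s; have [t0|/ltW t0] := leP 0 t.
- exact: mxexpD_ge0.
- have [st|/ltW st] := leP 0 (s + t).
    rewrite -[s in RHS](addrK t) [in RHS]mxexpD_ge0 ?oppr_ge0//.
    by rewrite -mulmxA (NK t) mulmx1.
  rewrite -[t in RHS](addKr s) [in RHS]le0 ?oppr_le0//.
  by rewrite mulmxA (KN s) mul1mx.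
- have [st|/ltW st] := leP 0 (s + t).
    rewrite -[t in RHS](addKr s) [in RHS]mxexpD_ge0 ?oppr_ge0//.
    by rewrite mulmxA (KN s) mul1mx.
  rewrite -[s in RHS](addrK t) [in RHS]le0 ?oppr_le0//.
  by rewrite -mulmxA (NK t) mulmx1.
- exact: le0.
Qed.

(** The second-order remainder is dominated by t^2 times the exponential series of
    (d+1) |X|, the factor d+1 making the maximum norm submultiplicative. *)
Lemma mxexp_taylor X (t : R) : `|t| <= 1 ->
  `|mxexp (t *: X) - 1%:M - t *: X| <=
    t ^+ 2 * limn (series (exp_coeff (d.+1%:R * `|X|))).
Proof.
move=> t1; set c := d.+1%:R * `|X|.
have c0 : 0 <= c by rewrite mulr_ge0.
have h : `|series (fun k => (k`!%:R)^-1 *: (t *: X) ^+ k) n - 1%:M - t *: X|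
    @[n --> \oo] --> `|mxexp (t *: X) - 1%:M - t *: X|.
  apply: cvg_norm; apply: cvgB; last exact: cvg_cst.
  by apply: cvgB; [exact: cvg_mxexp|exact: cvg_cst].
suff : [set r : R | r <= t ^+ 2 * limn (series (exp_coeff c))]
  `|mxexp (t *: X) - 1%:M - t *: X| by [].
apply: closed_cvg h; first exact: closed_le.
near=> n => /=.
have n2 : (2 <= n)%N by near: n; exact: nbhs_infty_ge.
rewrite /series/= big_ltn ?(ltn_trans _ n2)// big_ltn//.
rewrite expr0 expr1 fact0 factS fact0 muln1 invr1 !scale1r.
have cancel3 (A B C : 'M[R]_d) : A + (B + C) - A - B = C.
  by rewrite [A + _]addrC addrK addrC addKr.
rewrite -[1%:M]/(1 : 'M[R]_d) cancel3.
rewrite (le_trans (ler_norm_sum _ _ _))//.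
apply: (@le_trans _ _ (\sum_(2 <= k < n) t ^+ 2 * exp_coeff c k)).
  rewrite !big_nat; apply: ler_sum => k /andP[k2 _].
  rewrite normrZ mx_exprZ normrZ normrX /exp_coeff /= mulrCA [leRHS]mulrA mulrC.
  rewrite [leRHS]mulrAC normfV normr_nat.
  have -> : t ^+ 2 / k`!%:R * c ^+ k = (k`!%:R)^-1 * c ^+ k * `|t| ^+ 2.
    by rewrite -normrX ger0_norm ?sqr_ge0//; ring.
  rewrite ler_pM ?mulr_ge0 ?invr_ge0//; last exact: ler_wiXn2l.
  by rewrite ler_wpM2l ?invr_ge0// mx_norm_expr.
rewrite -mulr_sumr ler_wpM2l ?sqr_ge0//.
apply: (@le_trans _ _ (series (exp_coeff c) n)).
  rewrite /series/= [leRHS](@big_cat_nat _ _ _ 2)//= lerDr sumr_ge0// => k _.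
  exact: exp_coeff_ge0.
apply: nondecreasing_cvgn_le; last exact: is_cvg_series_exp_coeff.
by apply: nondecreasing_series => k _ _; exact: exp_coeff_ge0.
Unshelve. all: by end_near. Qed.

(** Difference quotient at the identity, read as the direction in which [g] leaves
    the identity at scale [t]. *)
Definition mxquot (t : R) (g : 'M[R]_d) : 'M[R]_d := t^-1 *: (g - 1%:M).

Lemma mxquotK (t : R) g : t != 0 -> 1%:M + t *: mxquot t g = g.
Proof. by move=> t0; rewrite scalerA divff// scale1r addrC subrK. Qed.

Lemma cvg_mxexp_quotient X : mxquot t (mxexp (t *: X)) @[t --> (0 : R)^'] --> X.
Proof.
set M := limn (series (exp_coeff (d.+1%:R * `|X|))).
apply/cvgrPdist_le => e e0.
near=> t.
have t0 : t != 0 by near: t; exact: nbhs_dnbhs_neq.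
have t1 : `|t| <= 1 by near: t; apply: dnbhs0_le.
have te : `|t| <= e / (`|M| + 1).
  by near: t; apply: dnbhs0_le; rewrite divr_gt0// ltr_wpDl.
have -> : X - mxquot t (mxexp (t *: X)) =
    - (t^-1 *: (mxexp (t *: X) - 1%:M - t *: X)).
  by rewrite /mxquot [in RHS]scalerBr scalerA mulVf// scale1r opprB.
rewrite normrN normrZ normfV ler_pdivrMl ?normr_gt0//.
rewrite (le_trans (mxexp_taylor _ t1))//.
rewrite -[t ^+ 2]ger0_norm ?sqr_ge0// normrX expr2 -mulrA ler_wpM2l//.
rewrite (le_trans (ler_wpM2l _ (ler_norm M)))//.
rewrite (@le_trans _ _ (`|t| * (`|M| + 1)))//; first by rewrite ler_wpM2l// lerDl.
by rewrite -ler_pdivlMr// ltr_wpDl.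
Unshelve. all: by end_near. Qed.

End Exponential.

(** * Compact matrix groups and their Lie algebras *)

Section ClosedGroups.
Variables (R : realType) (d : nat).
Implicit Types (H G : set 'M[R]_d) (X Y : 'M[R]_d).

Record compact_matrix_group H : Prop := {
  cmg_unit : forall g, H g -> g \in unitmx;
  cmg_one : H 1%:M;
  cmg_mul : forall g1 g2, H g1 -> H g2 -> H (g1 *m g2);
  cmg_inv : forall g, H g -> H (invmx g);
  cmg_compact : compact H }.

Lemma cmg_closed H : compact_matrix_group H -> closed H.
Proof. by move=> hH; apply: compact_closed (cmg_compact hH); exact: norm_hausdorff. Qed.

Lemma cmg_exp H : compact_matrix_group H -> forall g k, H g -> H (g ^+ k).
Proof.
move=> hH g k Hg; elim: k => [|k IH]; first exact: cmg_one hH.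
by rewrite exprS; apply: cmg_mul.
Qed.

Lemma continuous_dist1 (A B : 'M[R]_d) :
  continuous (fun g : 'M[R]_d => `|A *m g *m B - 1%:M|).
Proof.
move=> g; have FF : Filter (nbhs g) by exact: (@nbhs_filter 'M[R]_d g).
apply: cvg_norm.
have hA : (fun=> A) x @[x --> g] --> A by exact: cvg_cst.
have hB : (fun=> B) x @[x --> g] --> B by exact: cvg_cst.
have h1 : (fun=> 1%:M : 'M[R]_d) x @[x --> g] --> (1%:M : 'M[R]_d) by exact: cvg_cst.
exact: (cvgB (cvg_mulmx (cvg_mulmx hA cvg_id) hB) h1).
Qed.

Lemma continuous_dist1l (A : 'M[R]_d) : continuous (fun g : 'M[R]_d => `|A *m g - 1%:M|).
Proof.
have -> : (fun g : 'M[R]_d => `|A *m g - 1%:M|) = (fun g => `|A *m g *m 1%:M - 1%:M|).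
  by apply/funext => g; rewrite mulmx1.
exact: continuous_dist1.
Qed.

Lemma continuous_dist1r (B : 'M[R]_d) : continuous (fun g : 'M[R]_d => `|g *m B - 1%:M|).
Proof.
have -> : (fun g : 'M[R]_d => `|g *m B - 1%:M|) = (fun g => `|1%:M *m g *m B - 1%:M|).
  by apply/funext => g; rewrite mul1mx.
exact: continuous_dist1.
Qed.

Lemma cvg_mxexp_quotient_comp (T : Type) (F : set_system T) {FF : ProperFilter F}
    (e : T -> R) X : (\forall x \near F, e x != 0) -> e x @[x --> F] --> 0 ->
  mxquot (e x) (mxexp (e x *: X)) @[x --> F] --> X.
Proof.
move=> en0 e0.
have h : e @ F --> (0 : R)^'.
  by move=> A A0; apply: filterS2 en0 (e0 _ A0) => x xn0; apply.
exact: (cvg_comp _ _ h (@cvg_mxexp_quotient _ _ X)).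
Qed.

Lemma cvg_mxexp1 (T : Type) (F : set_system T) {FF : ProperFilter F}
    (e : T -> R) X : (\forall x \near F, e x != 0) -> e x @[x --> F] --> 0 ->
  mxexp (e x *: X) @[x --> F] --> (1%:M : 'M[R]_d).
Proof.
move=> en0 e0.
have h : 1%:M + e x *: mxquot (e x) (mxexp (e x *: X)) @[x --> F] --> (1%:M : 'M[R]_d).
  rewrite -[X in _ --> X]addr0 -(scale0r X).
  apply: cvgD; first exact: cvg_cst.
  by apply: cvgZ => //; exact: cvg_mxexp_quotient_comp.
apply: cvg_trans h; apply: near_eq_cvg; near=> x => /=.
by rewrite mxquotK//; near: x.
Unshelve. all: by end_near. Qed.

(** A direction in which elements of H leave the identity is tangent to H:
    u^m with m about t/e is an element of H close to exp(tX), and H is closed. *)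
Lemma lie_algebra_limit H (T : Type) (F : set_system T) {FF : ProperFilter F}
    (u : T -> 'M[R]_d) (e : T -> R) X :
  compact_matrix_group H -> (\forall x \near F, H (u x)) ->
  (\forall x \near F, 0 < e x) -> e x @[x --> F] --> 0 ->
  mxquot (e x) (u x) @[x --> F] --> X -> lie_algebra H X.
Proof.
move=> hH Hu egt0 e0 uX.
have ge0 (t : R) : 0 <= t -> H (mxexp (t *: X)).
  move=> t0; have h := pow_cvg_mxexp uX e0 (cvg_truncn_mul t0 egt0 e0).
  have {}h := h FF FF.
  apply: closed_cvg h; first exact: cmg_closed.
  near=> x.
  have ex0 : 0 < e x by near: x.
  rewrite mxquotK ?gt_eqF//; apply: cmg_exp => //.
  by near: x.
move=> t; have [t0|/ltW t0] := leP 0 t; first exact: ge0.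
have Ht : H (mxexp ((- t) *: X)) by apply: ge0; rewrite oppr_ge0.
suff -> : mxexp (t *: X) = invmx (mxexp ((- t) *: X)) by exact: cmg_inv.
rewrite scaleNr in Ht *.
rewrite -[RHS]mulmx1 -(mxexpNK (t *: X)) mulKmx//; exact: cmg_unit hH _ Ht.
Unshelve. all: by end_near. Qed.

(** The group commutator of A and B at scale t^2 is the ring commutator of their
    difference quotients at scale t, up to a factor that tends to 1. *)
Lemma mxquot_commutator (t : R) (A B A' B' : 'M[R]_d) :
  A *m A' = 1%:M -> B *m B' = 1%:M ->
  (mxquot t A *m mxquot t B - mxquot t B *m mxquot t A) *m (A' *m B') =
    mxquot (t * t) (A *m B *m (A' *m B')).
Proof.
move=> AK BK.
have comm : (A - 1%:M) *m (B - 1%:M) - (B - 1%:M) *m (A - 1%:M) = A *m B - B *m A.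
  rewrite !mulmxBl !mulmxBr !mul1mx !mulmx1.
  by apply/matrixP => i j; rewrite !mxE; ring.
rewrite -!scalemxAl -!scalemxAr !scalerA -invfM -scalerBr comm -scalemxAl mulmxBl.
by congr (_ *: (_ - _)); rewrite -mulmxA [A *m _]mulmxA AK mul1mx.
Qed.

(** X + Y is the direction of exp(tX) exp(tY) at scale t, and XY - YX is that of
    the commutator of exp(tX) and exp(tY) at scale t^2. *)
Lemma lie_algebra_subalgebra H : compact_matrix_group H -> lie_subalgebra (lie_algebra H).
Proof.
move=> hH.
pose e (t : R) := t.
have egt0 : \forall t \near (0 : R)^'+, 0 < e t by exact: nbhs_right_gt.
have en0 : \forall t \near (0 : R)^'+, e t != 0.
  by apply: filterS egt0 => t; apply: lt0r_neq0.
have e0 : e t @[t --> (0 : R)^'+] --> 0 by apply: cvg_at_right_filter; exact: cvg_id.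
have lim1 X : mxexp (e t *: X) @[t --> (0 : R)^'+] --> (1%:M : 'M[R]_d).
  exact: cvg_mxexp1.
have limX X : mxquot (e t) (mxexp (e t *: X)) @[t --> (0 : R)^'+] --> X.
  exact: cvg_mxexp_quotient_comp.
have lie0 : lie_algebra H 0 by move=> t; rewrite scaler0 mxexp0; exact: cmg_one.
have lieZ a X : lie_algebra H X -> lie_algebra H (a *: X).
  by move=> HX t; rewrite scalerA; exact: HX.
have lieD X Y : lie_algebra H X -> lie_algebra H Y -> lie_algebra H (X + Y).
  move=> HX HY.
  apply: (@lie_algebra_limit H _ (0 : R)^'+ _ (fun t => mxexp (t *: X) *m mxexp (t *: Y)) e) => //.
    by near=> t; apply: cmg_mul => //.
  have h : mxquot t (mxexp (t *: X)) *m mxexp (t *: Y) + mxquot t (mxexp (t *: Y))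
      @[t --> (0 : R)^'+] --> X + Y.
    have -> : X + Y = X *m 1%:M + Y by rewrite mulmx1.
    by apply: cvgD => //; exact: cvg_mulmx.
  apply: cvg_trans h; apply: near_eq_cvg; near=> t.
  by rewrite /= -scalemxAl -scalerDr mulmxBl mul1mx subrKA.
split; first by split=> // a X Y HX HY; apply: lieD HY; exact: lieZ.
move=> X Y HX HY.
pose a (t : R) := mxexp (t *: X); pose b (t : R) := mxexp (t *: Y).
pose a' (t : R) := mxexp (t *: - X); pose b' (t : R) := mxexp (t *: - Y).
apply: (@lie_algebra_limit H _ (0 : R)^'+ _
  (fun t => a t *m b t *m (a' t *m b' t)) (fun t => t * t)) => //.
- near=> t; have hn Z : lie_algebra H Z -> H (mxexp (t *: - Z)).
    by move=> HZ; rewrite scalerN -scaleNr; exact: HZ.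
  by apply: cmg_mul => //; apply: cmg_mul => //; [exact: HX|exact: HY|exact: hn|exact: hn].
- by apply: filterS egt0 => t t0; rewrite mulr_gt0.
- by rewrite -[X in _ --> X](mulr0 0); apply: cvgM.
have h : (mxquot t (a t) *m mxquot t (b t) - mxquot t (b t) *m mxquot t (a t)) *m
    (a' t *m b' t) @[t --> (0 : R)^'+] --> X *m Y - Y *m X.
  have -> : X *m Y - Y *m X = (X *m Y - Y *m X) *m (1%:M *m 1%:M) by rewrite !mulmx1.
  apply: cvg_mulmx; last by apply: cvg_mulmx; exact: lim1.
  by apply: cvgB; apply: cvg_mulmx; exact: limX.
apply: cvg_trans h; apply: near_eq_cvg; near=> t.
rewrite /= mxquot_commutator//; first by rewrite /a /a' scalerN mxexpKN.
by rewrite /b /b' scalerN mxexpKN.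
Unshelve. all: by end_near. Qed.

Lemma fmap_ultra (T T' : Type) (f : T -> T') (U : set_system T) :
  UltraFilter U -> UltraFilter (f @ U).
Proof.
move=> UU; have PU : ProperFilter U by exact: ultra_proper.
split; first exact: fmap_proper_filter.
move=> V PV sUV; apply/seteqP; split => // A VA.
have [//|UA] := in_ultra_setVsetC (f @^-1` A) UU.
have VA' : V (~` A) by exact: sUV.
have := @filterI _ V _ _ _ VA VA'; rewrite setICr.
by move=> V0; case: (@filter_not_empty _ V PV (V0 _)).
Qed.

Lemma mx_ball_compact (c : R) : 0 <= c -> compact [set M : 'M[R]_d | `|M| <= c].
Proof.
move=> c0.
have -> : [set M : 'M[R]_d | `|M| <= c] =
    vec_mx @` [set v : 'rV[R]_(d * d) | forall i, `[- c, c]%classic (v ord0 i)].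
  apply/seteqP; split => [M M1|_ [v v1 <-]].
    exists (mxvec M); last by rewrite mxvecK.
    move=> i /=; rewrite in_itv/= -ler_norml.
    case/mxvec_indexP: i => i j; rewrite mxvecE.
    by apply: le_trans M1; exact: mx_entry_le.
  apply: mx_norm_le => // i j; rewrite mxE.
  by have := v1 (mxvec_index i j); rewrite /= in_itv/= -ler_norml.
apply: (@continuous_compact _ _ (vec_mx : 'rV[R]_(d * d) -> 'M[R]_d)); last first.
  by apply: (@rV_compact R _ (fun=> `[- c, c]%classic)) => _; exact: segment_compact.
apply: continuous_subspaceT => v.
have FF : Filter (nbhs v) by exact: (@nbhs_filter 'rV[R]_(d * d) v).
apply/cvg_mxP => i j.
by under eq_fun do rewrite mxE; rewrite mxE; exact: coord_continuous.
Qed.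

(** Limits along an ultrafilter replace the extraction of subsequences. *)
Lemma ultra_cvg_bounded (T : Type) (U : set_system T) (Y : T -> 'M[R]_d) (c : R) :
  UltraFilter U -> (forall k, `|Y k| <= c) ->
  exists2 X : 'M[R]_d, `|X| <= c & Y @ U --> X.
Proof.
move=> UU Yc; have PU : ProperFilter U by exact: ultra_proper.
have [k _] := @filter_ex _ U PU _ (@filterT _ U _).
have := mx_ball_compact (le_trans (normr_ge0 _) (Yc k)).
rewrite compact_ultra => /(_ (Y @ U)) /=.
case; [exact: fmap_ultra|exact: (@filterE _ U _ _ Yc)|by move=> X [Xc YX]; exists X].
Qed.

(** Near the identity, G is contained in any compact subgroup H with the same Lie
    algebra.  Otherwise take elements of G outside H that tend to 1, and translate
    each by the element of H that brings it closest to 1.  The result u leaves 1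
    in a direction X of the Lie algebra of G, hence of H, and then multiplication
    by exp(- |u - 1| X), an element of H, brings u strictly closer to 1. *)
Lemma cmg_nbhs1 G H : compact_matrix_group G -> compact_matrix_group H ->
  H `<=` G -> lie_algebra G `<=` lie_algebra H ->
  exists2 e : R, 0 < e & forall g, G g -> `|g - 1%:M| < e -> H g.
Proof.
move=> hG hH HG lieGH; apply: contrapT => nH.
have /choice[g0 g0P] : forall k : nat, exists g : 'M[R]_d,
    [/\ G g, ~ H g & `|g - 1%:M| < @harmonic R k].
  move=> k; apply: contrapT => nk; apply: nH; exists (@harmonic R k); first by rewrite invr_gt0.
  move=> g Gg g1; apply: contrapT => nHg; apply: nk; exists g; split=> //.
(* h k is the element of H for which h k * g0 k is closest to 1 *)
have /choice[h hP] : forall k : nat, exists h : 'M[R]_d, H h /\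
    forall h', H h' -> `|h *m g0 k - 1%:M| <= `|h' *m g0 k - 1%:M|.
  move=> k.
  have [||c cH cmin] := @compact_EVT_min _ R (fun h : 'M[R]_d => `|h *m g0 k - 1%:M|) H _ (cmg_compact hH).
  - by exists 1%:M; exact: cmg_one.
  - apply: continuous_subspaceT; exact: continuous_dist1r.
  - by exists c; split=> [|h' Hh']; [rewrite inE in cH|apply: cmin; rewrite inE].
pose u k := h k *m g0 k; pose e k := `|u k - 1%:M|.
have Gu k : G (u k).
  by have [Hh _] := hP k; have [Gg _ _] := g0P k; apply: cmg_mul => //; exact: HG.
have nHu k : ~ H (u k).
  move=> Hu; have [Hh _] := hP k; have [_ nHg _] := g0P k; apply: nHg.
  rewrite -(mulKmx (cmg_unit hH Hh) (g0 k)); apply: cmg_mul => //; exact: cmg_inv.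
have egt0 k : 0 < e k.
  rewrite normr_gt0 subr_eq0; apply/eqP => u1; apply: (nHu k); rewrite u1.
  exact: cmg_one.
have eh k : e k <= @harmonic R k.
  have [_ hmin] := hP k; have [_ _ /ltW] := g0P k; apply: le_trans.
  by have := hmin _ (cmg_one hH); rewrite mul1mx.
have [U [UU sU]] := ultraFilterLemma (eventually_filter : ProperFilter \oo).
have PU : ProperFilter U by exact: ultra_proper.
have e0 : e k @[k --> U] --> 0.
  have : e k @[k --> \oo] --> 0.
    apply: (squeeze_cvgr _ (cvg_cst 0) (@cvg_harmonic R)).
    by near=> k; rewrite eh andbT ltW.
  by apply: cvg_trans => A /=; apply: sU.
pose Y k := mxquot (e k) (u k).
have Y1 k : `|Y k| = 1.
  by rewrite normrZ gtr0_norm ?invr_gt0// mulVf// gt_eqF.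
have [X _ YX] : exists2 X : 'M[R]_d, `|X| <= 1 & Y k @[k --> U] --> X.
  by apply: ultra_cvg_bounded => k; rewrite Y1.
have LX : lie_algebra H X.
  apply: lieGH; apply: (@lie_algebra_limit G _ U _ u e) => //.
  - by near=> k.
  - by near=> k.
have en0 : \forall k \near U, e k != 0 by near=> k; rewrite gt_eqF.
have hm : mxquot (e k) (mxexp (e k *: - X)) @[k --> U] --> - X.
  exact: cvg_mxexp_quotient_comp.
have hu : u k @[k --> U] --> (1%:M : 'M[R]_d).
  have h' : 1%:M + e k *: Y k @[k --> U] --> (1%:M : 'M[R]_d) + 0 *: X.
    by apply: cvgD; [exact: cvg_cst|exact: cvgZ].
  rewrite scale0r addr0 in h'.
  apply: cvg_trans h'; apply: near_eq_cvg; near=> k => /=.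
  by rewrite mxquotK ?gt_eqF.
have h0 : mxquot (e k) (mxexp (e k *: - X)) *m u k + Y k @[k --> U] --> (0 : 'M[R]_d).
  have -> : (0 : 'M[R]_d) = - X *m 1%:M + X by rewrite mulmx1 addNr.
  by apply: cvgD => //; exact: cvg_mulmx.
have /cvgrPdist_lt/(_ 1 ltr01)/filter_ex[k] := h0.
(* |exp(-e X) u - 1| < e = |u - 1| contradicts the choice of h k *)
rewrite sub0r normrN -scalemxAl -scalerDr mulmxBl mul1mx subrKA.
rewrite normrZ gtr0_norm ?invr_gt0// ltr_pdivrMl// mulr1 ltNge => /negP; apply.
have [Hh hmin] := hP k; rewrite mulmxA; apply: hmin; apply: cmg_mul => //.
by rewrite scalerN -scaleNr; exact: LX.
Unshelve. all: by end_near. Qed.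

(** H is closed in G, and open in G by translating [cmg_nbhs1]. *)
Lemma connected_lie_eq G H : compact_matrix_group G -> connected G ->
  compact_matrix_group H -> H `<=` G -> lie_algebra G `<=` lie_algebra H -> H = G.
Proof.
move=> hG cG hH HG lieGH.
have [e e0 He] := cmg_nbhs1 hG hH HG lieGH.
apply: cG; first by exists 1%:M; exact: cmg_one.
- exists (~` closure (G `\` H)); first by apply: closed_openC; exact: closed_closure.
  apply/seteqP; split => [/= h Hh|g [Gg ng]]; last first.
    by apply: contrapT => nHg; apply: ng; apply: subset_closure.
  split; first exact: HG.
  move=> /(_ [set g | `|invmx h *m g - 1%:M| < e]) [].
    have := @continuous_dist1l (invmx h) h; rewrite /continuous_at.
    rewrite mulVmx ?(cmg_unit hH Hh)// subrr normr0 => /cvgrPdist_lt/(_ _ e0).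
    by apply: filterS => g; rewrite sub0r normrN normr_id.
  move=> g [[Gg nHg] ge]; apply: nHg.
  rewrite -(mulKVmx (cmg_unit hH Hh) g); apply: cmg_mul => //; apply: He => //.
  by apply: cmg_mul => //; apply: cmg_inv => //; exact: HG.
- by exists H; [exact: cmg_closed|rewrite setIidr].
Qed.

End ClosedGroups.

(** * One-parameter groups *)

Section OneParameter.
Variables (R : realType) (q : nat) (S : R -> 'M[R]_q).
Hypothesis S0 : S 0 = 1%:M.
Hypothesis SD : forall s t, S (s + t) = S s *m S t.
Hypothesis Scont : S t @[t --> (0 : R)] --> (1%:M : 'M[R]_q).

Lemma one_param_expr t k : S (k%:R * t) = S t ^+ k.
Proof.
elim: k => [|k IH]; first by rewrite mul0r S0 expr0.
by rewrite -natr1 mulrDl mul1r SD IH exprSr.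
Qed.

(** Along t = e/(k+1) the difference quotients of S are bounded.  By telescoping,
    S((k+1)t) - 1 is the sum of (S t - 1) S(jt) over j <= k; since S(jt) is close
    to 1, this differs from (k+1)(S t - 1) by at most half of its norm. *)
Lemma one_param_lipschitz : exists2 e : R, 0 < e & forall k,
  `|mxquot (e * harmonic k) (S (e * harmonic k))| <= 2 / e.
Proof.
(* small enough that |D *m (S (j t) - 1)| <= |D| / 2, by [mx_norm_mulmx] *)
pose c : R := (2 * q.+1%:R)^-1.
have c0 : 0 < c by rewrite invr_gt0 mulr_gt0.
have /cvgrPdist_le/(_ c c0)/nbhs_ballP[e e0 he] := Scont.
have hS t : `|t| < e -> `|S t - 1%:M| <= c.
  by move=> te; rewrite distrC; apply: he; rewrite /ball /= sub0r normrN.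
exists (e / 2); first by rewrite divr_gt0.
move=> k; set t := e / 2 * harmonic k.
have t0 : 0 < t by rewrite /t /harmonic !mulr_gt0// invr_gt0.
have kt : k.+1%:R * t = e / 2 by rewrite /t /harmonic /= mulrCA divff ?mulr1// pnatr_eq0.
have jt j : (j <= k.+1)%N -> `|j%:R * t| < e.
  move=> jk; rewrite ger0_norm; last by apply: mulr_ge0 => //; exact: ltW.
  apply: (@le_lt_trans _ _ (e / 2)); first by rewrite -kt ler_wpM2r ?(ltW t0)// ler_nat.
  by rewrite ltr_pdivrMr// ltr_pMr// ltr1n.
set D := S t - 1%:M.
have tele : \sum_(j < k.+1) D *m S (j%:R * t) = S (k.+1%:R * t) - 1%:M.
  rewrite -S0 -(mul0r t) -(big_mkord predT (fun j => D *m S (j%:R * t))).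
  rewrite -(telescope_sumr (fun j => S (j%:R * t)) (leq0n _)).
  by apply: eq_bigr => j _; rewrite -natr1 mulrDl mul1r [j%:R * t + t]addrC SD mulmxBl mul1mx.
have DE : k.+1%:R *: D = S (k.+1%:R * t) - 1%:M - \sum_(j < k.+1) D *m (S (j%:R * t) - 1%:M).
  rewrite -tele -sumrB scaler_nat -[in LHS](card_ord k.+1) -sumr_const.
  by apply: eq_bigr => j _; rewrite mulmxBr mulmx1 subKr.
have D2 : k.+1%:R * `|D| <= 1 + k.+1%:R * `|D| / 2.
  rewrite -[k.+1%:R in leLHS]ger0_norm// -normrZ DE.
  rewrite (le_trans (ler_normB _ _))// lerD//.
    rewrite (le_trans (hS _ (jt _ _)))// /c invf_le1 ?mulr_gt0//.
    by rewrite -natrM ler1n muln_gt0.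
  rewrite (le_trans (ler_norm_sum _ _ _))//.
  have -> : k.+1%:R * `|D| / 2 = \sum_(j < k.+1) `|D| / 2.
    by rewrite sumr_const card_ord -[RHS]mulr_natl mulrA.
  apply: ler_sum => j _; rewrite (le_trans (mx_norm_mulmx _ _))//.
  rewrite mulrAC mulrC ler_wpM2l//.
  rewrite (le_trans (ler_wpM2l _ (hS _ (jt _ _))))//; first exact/ltnW.
  by rewrite /c invfM mulrCA ger_pMr ?invr_gt0// ler_pdivrMr// mul1r ler_nat.
rewrite /mxquot -/D normrZ gtr0_norm ?invr_gt0//.
rewrite ler_pdivrMl//.
have -> : t * (2 / (e / 2)) = 2 / k.+1%:R.
  have e2 : e / 2 != 0 by rewrite gt_eqF// divr_gt0.
  rewrite /t /harmonic /=; move: (e / 2) (k.+1%:R^-1) e2 => x h x0; by field.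
rewrite ler_pdivlMr// mulrC.
by lra.
Qed.

(** A limit A of the bounded difference quotients, along an ultrafilter, generates
    S: the power S(t)^m with m about s/t tends both to S s, by continuity, and to
    exp(sA).  Differentiability of S is thus a consequence of continuity. *)
Lemma one_param_mxexp : exists A : 'M[R]_q, forall t, S t = mxexp (t *: A).
Proof.
have [e e0 he] := one_param_lipschitz.
have [U [UU sU]] := ultraFilterLemma (eventually_filter : ProperFilter \oo).
have PU : ProperFilter U by exact: ultra_proper.
pose t k : R := e * harmonic k.
have [A _ YA] := ultra_cvg_bounded UU he.
have t_gt0 k : 0 < t k by rewrite /t /harmonic mulr_gt0// invr_gt0.
have t0 : t k @[k --> U] --> 0.
  have : t k @[k --> \oo] --> 0.
    by rewrite -[X in _ --> X](mulr0 e); apply: cvgMr; exact: cvg_harmonic.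
  by apply: cvg_trans => B /=; apply: sU.
have tU : \forall k \near U, 0 < t k by exact: filterE.
have ge0 s : 0 <= s -> S s = mxexp (s *: A).
  move=> s0; have ns := cvg_truncn_mul s0 tU t0.
  have {}ns := ns PU.
  have h1 := pow_cvg_mxexp YA t0 ns.
  have {}h1 := h1 PU.
  apply: mx_cvg_unique h1.
  have -> : (fun k => (1%:M + t k *: mxquot (t k) (S (t k))) ^+ Num.truncn (s / t k)) =
      (fun k => S s *m S ((Num.truncn (s / t k))%:R * t k - s)).
    by apply/funext => k; rewrite mxquotK ?gt_eqF// -one_param_expr -SD subrKC.
  rewrite -[X in _ --> X]mulmx1; apply: cvg_mulmx; first exact: cvg_cst.
  have h2 : (Num.truncn (s / t k))%:R * t k - s @[k --> U] --> 0.
    by rewrite -[X in _ --> X](subrr s); apply: cvgB => //; exact: cvg_cst.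
  exact: (cvg_comp _ _ h2 Scont).
exists A => s; have [s0|/ltW s0] := leP 0 s; first exact: ge0.
rewrite -[S s]mulmx1 -(mxexpNK (s *: A)) mulmxA -scaleNr -ge0 ?oppr_ge0//.
by rewrite -SD subrr S0 mul1mx.
Qed.

End OneParameter.

(** * Real forms of matrices *)

Section Realification.
Variables (R : realType) (c : field_kind).
Local Notation K := (base_field R c).

Definition reK : K -> R :=
  match c return base_field R c -> R with
  | RealField => fun x => x | ComplexField => fun z => complex.Re z end.

Definition imK : K -> R :=
  match c return base_field R c -> R with
  | RealField => fun=> 0 | ComplexField => fun z => complex.Im z end.

Definition mkK : R -> R -> K :=
  match c return R -> R -> base_field R c with
  | RealField => fun x _ => x | ComplexField => fun x y => (x +i* y)%C end.

End Realification.

Section RealificationTheory.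
Variables (R : realType).
Notation reK := (@reK R _). Notation imK := (@imK R _).

Lemma reKD c (x y : base_field R c) : reK (x + y) = reK x + reK y.
Proof. by case: c x y => // -[? ?] [? ?]. Qed.

Lemma imKD c (x y : base_field R c) : imK (x + y) = imK x + imK y.
Proof. by case: c x y => [? ?|[? ?] [? ?]] //=; rewrite addr0. Qed.

Lemma reKM c (x y : base_field R c) : reK (x * y) = reK x * reK y - imK x * imK y.
Proof. by case: c x y => [? ?|[? ?] [? ?]] //=; rewrite mul0r subr0. Qed.

Lemma imKM c (x y : base_field R c) : imK (x * y) = reK x * imK y + imK x * reK y.
Proof. by case: c x y => [? ?|[? ?] [? ?]] //=; rewrite mulr0 mul0r addr0. Qed.

Lemma reK1 c : reK (1 : base_field R c) = 1. Proof. by case: c. Qed.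
Lemma imK1 c : imK (1 : base_field R c) = 0. Proof. by case: c. Qed.
Lemma reK0 c : reK (0 : base_field R c) = 0. Proof. by case: c. Qed.
Lemma imK0 c : imK (0 : base_field R c) = 0. Proof. by case: c. Qed.

Lemma mkK_reim c (x : base_field R c) : mkK c (reK x) (imK x) = x.
Proof. by case: c x => // -[]. Qed.

Lemma mkKD c (a b a' b' : R) : mkK c (a + a') (b + b') = mkK c a b + mkK c a' b'.
Proof. by case: c. Qed.

Lemma mkKM c (x : base_field R c) (a b : R) :
  x * mkK c a b = mkK c (reK x * a - imK x * b) (reK x * b + imK x * a).
Proof. by case: c x => [x|[x y]] //=; rewrite mul0r subr0. Qed.

Lemma of_realV c (t : R) : (of_real c t)^-1 = mkK c t^-1 0.
Proof. by case: c => //=; rewrite -[LHS]fmorphV. Qed.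

Lemma of_real_gt0 c (e : R) : 0 < e -> 0 < of_real c e.
Proof. by case: c => //= e0; rewrite ltcR. Qed.

Lemma reK_gt0 c (e : base_field R c) : 0 < e -> 0 < reK e /\ e = of_real c (reK e).
Proof. by case: c e => //= -[a b]; rewrite ltcE/= => /andP[/eqP-> ->]. Qed.

Lemma reim_dist c (x y : base_field R c) (e : R) : `|x - y| < of_real c e ->
  `|reK x - reK y| < e /\ `|imK x - imK y| < e.
Proof.
case: c x y => /= [x y xy|[a b] [a' b']].
  by rewrite subrr normr0; split=> //; exact: le_lt_trans xy.
rewrite ltcE /= => /andP[_ h].
by split; apply: le_lt_trans h; rewrite -sqrtr_sqr ler_wsqrtr// ?lerDl ?lerDr sqr_ge0.
Qed.

Lemma mkK_dist c (a b a' b' e : R) : `|a - a'| < e / 2 -> `|b - b'| < e / 2 ->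
  `|mkK c a b - mkK c a' b'| < of_real c e.
Proof.
move=> h1 h2; apply: (@le_lt_trans _ _ (of_real c (`|a - a'| + `|b - b'|))).
  case: c => /=; first by rewrite lerDl.
  rewrite lecE /= eqxx/= -[leRHS]ger0_norm ?addr_ge0// -sqrtr_sqr ler_wsqrtr//.
  have sqr_le (x y : R) : x ^+ 2 + y ^+ 2 <= (`|x| + `|y|) ^+ 2.
    by rewrite sqrrD !real_normK ?num_real// lerD2r lerDl mulrn_wge0// mulr_ge0.
  exact: sqr_le.
by case: c => /=; rewrite ?ltcR; lra.
Qed.

Section Limits.
Context (c : field_kind) {T : Type} {F : set_system T} {FF : Filter F}.

Lemma cvg_reK (f : T -> base_field R c) (x : base_field R c) :
  f t @[t --> F] --> x -> reK (f t) @[t --> F] --> reK x.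
Proof.
move=> fx; apply/cvgrPdist_lt => e e0.
have /cvgrPdist_lt/(_ _ (of_real_gt0 c e0)) := fx.
by apply: filterS => t /reim_dist[].
Qed.

Lemma cvg_imK (f : T -> base_field R c) (x : base_field R c) :
  f t @[t --> F] --> x -> imK (f t) @[t --> F] --> imK x.
Proof.
move=> fx; apply/cvgrPdist_lt => e e0.
have /cvgrPdist_lt/(_ _ (of_real_gt0 c e0)) := fx.
by apply: filterS => t /reim_dist[].
Qed.

Lemma cvg_mkK (f g : T -> R) (a b : R) :
  f t @[t --> F] --> a -> g t @[t --> F] --> b ->
  mkK c (f t) (g t) @[t --> F] --> mkK c a b.
Proof.
move=> fa gb; apply/cvgrPdist_lt => e /reK_gt0[e0 ->].
have e20 : 0 < reK e / 2 by rewrite divr_gt0.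
move/cvgrPdist_lt: fa => /(_ _ e20) fa; move/cvgrPdist_lt: gb => /(_ _ e20).
by apply: filterS2 fa => t; exact: mkK_dist.
Qed.

End Limits.

End RealificationTheory.

Section RealMatrices.
Variables (R : realType) (c : field_kind).
Local Notation K := (base_field R c).
Local Notation reK := (@reK R c).
Local Notation imK := (@imK R c).

(** The matrix of the underlying real-linear map on real and imaginary parts.  For
    real K it is two copies of the matrix, so that both fields are treated alike. *)
Definition realmx m n (A : 'M[K]_(m, n)) : 'M[R]_(m + m, n + n) :=
  block_mx (map_mx reK A) (- map_mx imK A) (map_mx imK A) (map_mx reK A).

(** The K-linear part of a real-linear map: a left inverse of [realmx] that
    commutes with multiplication by real forms on either side. *)
Definition unrealmx m n (Q : 'M[R]_(m + m, n + n)) : 'M[K]_(m, n) :=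
  \matrix_(i, j) mkK c ((ulsubmx Q i j + drsubmx Q i j) / 2)
                       ((dlsubmx Q i j - ursubmx Q i j) / 2).

Lemma map_reK_mul m n p (A : 'M[K]_(m, n)) (B : 'M[K]_(n, p)) :
  map_mx reK (A *m B) =
    map_mx reK A *m map_mx reK B - map_mx imK A *m map_mx imK B.
Proof.
apply/matrixP => i j; rewrite !mxE -sumrB (big_morph _ (@reKD R c) (reK0 R c)).
by apply: eq_bigr => k _; rewrite !mxE reKM.
Qed.

Lemma map_imK_mul m n p (A : 'M[K]_(m, n)) (B : 'M[K]_(n, p)) :
  map_mx imK (A *m B) =
    map_mx reK A *m map_mx imK B + map_mx imK A *m map_mx reK B.
Proof.
apply/matrixP => i j; rewrite !mxE -big_split (big_morph _ (@imKD R c) (imK0 R c)).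
by apply: eq_bigr => k _; rewrite !mxE imKM.
Qed.

Lemma realmxM m n p (A : 'M[K]_(m, n)) (B : 'M[K]_(n, p)) :
  realmx (A *m B) = realmx A *m realmx B.
Proof.
rewrite /realmx mulmx_block map_reK_mul map_imK_mul !mulNmx !mulmxN.
by rewrite opprD [X in block_mx _ _ _ X]addrC [X in block_mx _ _ X _]addrC.
Qed.

Lemma realmx1 n : realmx (1%:M : 'M[K]_n) = 1%:M.
Proof.
rewrite /realmx scalar_mx_block; congr block_mx; apply/matrixP => i j; rewrite !mxE;
  by case: eqP => _; rewrite ?reK1 ?reK0 ?imK1 ?imK0 ?oppr0.
Qed.

Lemma realmx0 m n : realmx (0 : 'M[K]_(m, n)) = 0.
Proof.
rewrite /realmx -[RHS](block_mx0 R m m n n); congr block_mx; apply/matrixP => i j; rewrite !mxE;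
  by rewrite ?reK0 ?imK0 ?oppr0.
Qed.

Lemma realmxEul m n (A : 'M[K]_(m, n)) i j :
  realmx A (lshift m i) (lshift n j) = reK (A i j).
Proof. by rewrite [LHS]block_mxEul mxE. Qed.

Lemma realmxEur m n (A : 'M[K]_(m, n)) i j :
  realmx A (lshift m i) (rshift n j) = - imK (A i j).
Proof. by rewrite [LHS]block_mxEur !mxE. Qed.

Lemma realmxEdl m n (A : 'M[K]_(m, n)) i j :
  realmx A (rshift m i) (lshift n j) = imK (A i j).
Proof. by rewrite [LHS]block_mxEdl mxE. Qed.

Lemma realmxEdr m n (A : 'M[K]_(m, n)) i j :
  realmx A (rshift m i) (rshift n j) = reK (A i j).
Proof. by rewrite [LHS]block_mxEdr mxE. Qed.

Lemma unrealmxE m n (Q : 'M[R]_(m + m, n + n)) i j : unrealmx Q i j =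
  mkK c ((ulsubmx Q i j + drsubmx Q i j) / 2) ((dlsubmx Q i j - ursubmx Q i j) / 2).
Proof. by rewrite mxE. Qed.

Lemma realmxK m n : cancel (@realmx m n) (@unrealmx m n).
Proof.
move=> A; apply/matrixP => i j.
rewrite unrealmxE block_mxKul block_mxKdr block_mxKdl block_mxKur !mxE opprK.
have half (x : R) : (x + x) / 2 = x by field.
by rewrite !half mkK_reim.
Qed.

Lemma mkK_sum (I : Type) (r : seq I) (f g : I -> R) :
  mkK c (\sum_(i <- r) f i) (\sum_(i <- r) g i) = \sum_(i <- r) mkK c (f i) (g i).
Proof.
elim: r => [|i r IH]; first by rewrite !big_nil -[RHS](mkK_reim) reK0 imK0.
by rewrite !big_cons mkKD IH.
Qed.

Lemma unrealmx_mull m n p (A : 'M[K]_(m, n)) (Q : 'M[R]_(n + n, p + p)) :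
  unrealmx (realmx A *m Q) = A *m unrealmx Q.
Proof.
rewrite -[Q in LHS]submxK /realmx mulmx_block; apply/matrixP => i j.
rewrite unrealmxE block_mxKul block_mxKdr block_mxKdl block_mxKur !mxE.
rewrite -!big_split /= -sumrB !mulr_suml mkK_sum; apply: eq_bigr => k _.
by rewrite !mxE mkKM; congr mkK; ring.
Qed.

Lemma unrealmx_mulr m n p (Q : 'M[R]_(m + m, n + n)) (A : 'M[K]_(n, p)) :
  unrealmx (Q *m realmx A) = unrealmx Q *m A.
Proof.
rewrite -[Q in LHS]submxK /realmx mulmx_block; apply/matrixP => i j.
rewrite unrealmxE block_mxKul block_mxKdr block_mxKdl block_mxKur !mxE.
rewrite -!big_split /= -sumrB !mulr_suml mkK_sum; apply: eq_bigr => k _.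
by rewrite unrealmxE [RHS]mulrC mkKM !mxE; congr mkK; ring.
Qed.

Section Limits.
Context {T : Type} {F : set_system T} {FF : Filter F}.

Lemma cvg_realmx m n (f : T -> 'M[K]_(m, n)) (A : 'M[K]_(m, n)) :
  f @ F --> A -> realmx (f t) @[t --> F] --> realmx A.
Proof.
move=> /cvg_mxP fA; apply/cvg_mxP => i j.
have fre a b : reK (f t a b) @[t --> F] --> reK (A a b) by apply: cvg_reK.
have fim a b : imK (f t a b) @[t --> F] --> imK (A a b) by apply: cvg_imK.
rewrite -(splitK i) -(splitK j).
case: (fintype.split i) => a; case: (fintype.split j) => b /=.
- by rewrite realmxEul; under eq_fun do rewrite realmxEul; exact: fre.
- by rewrite realmxEur; under eq_fun do rewrite realmxEur; apply: cvgN; exact: fim.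
- by rewrite realmxEdl; under eq_fun do rewrite realmxEdl; exact: fim.
- by rewrite realmxEdr; under eq_fun do rewrite realmxEdr; exact: fre.
Qed.

Lemma cvg_unrealmx m n (f : T -> 'M[R]_(m + m, n + n)) (Q : 'M[R]_(m + m, n + n)) :
  f @ F --> Q -> unrealmx (f t) @[t --> F] --> unrealmx Q.
Proof.
move=> /cvg_mxP fQ; apply/cvg_mxP => i j.
under eq_fun do rewrite !mxE; rewrite !mxE.
by apply: cvg_mkK; apply: cvgM; try (exact: cvg_cst); [apply: cvgD|apply: cvgB].
Qed.

End Limits.
End RealMatrices.

(** * Invariant vectors and the differential of a representation *)

Section RepresentationDerivative.
Variables (R : realType) (c : field_kind) (d : nat) (G : set 'M[R]_d).
Local Notation K := (base_field R c).
Hypothesis hG : compact_matrix_group G.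

Lemma rep_cvg n (rho : 'M[R]_d -> 'M[K]_n) (T : Type) (F : set_system T)
    {FF : Filter F} (u : T -> 'M[R]_d) g :
  is_representation G rho -> G g -> (\forall t \near F, G (u t)) ->
  u t @[t --> F] --> g -> rho (u t) @[t --> F] --> rho g.
Proof.
move=> hrho Gg Gu ug.
have /subspace_continuousP/(_ g Gg) hc := rep_continuous hrho.
have h : u @ F --> within G (nbhs g).
  by move=> B hB; apply: filterS2 Gu (ug _ hB) => t Gt; apply.
exact: (cvg_comp _ _ h hc).
Qed.

Lemma rep_mulV n (rho : 'M[R]_d -> 'M[K]_n) g : is_representation G rho -> G g ->
  rho g *m rho (invmx g) = 1%:M.
Proof.
move=> hrho Gg; rewrite -(rep_mul hrho) ?mulmxV ?(cmg_unit hG)//; first exact: rep_one hrho.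
exact: cmg_inv.
Qed.

Lemma rep_mulVg n (rho : 'M[R]_d -> 'M[K]_n) g : is_representation G rho -> G g ->
  rho (invmx g) *m rho g = 1%:M.
Proof.
move=> hrho Gg; rewrite -(rep_mul hrho) ?mulVmx ?(cmg_unit hG)//; first exact: rep_one hrho.
exact: cmg_inv.
Qed.

Lemma realmxZ m n (t : R) (A : 'M[K]_(m, n)) :
  realmx ((of_real c t)^-1 *: A) = t^-1 *: realmx A.
Proof.
have re_mk (a : R) : reK (mkK c a 0) = a by case: c.
have im_mk (a : R) : imK (mkK c a 0) = 0 by case: c.
rewrite of_realV /realmx scale_block_mx; congr block_mx; apply/matrixP => i j;
  rewrite !mxE ?reKM ?imKM re_mk im_mk mul0r ?subr0 ?addr0 ?mulrN//.
Qed.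

Lemma realmxB m n (A B : 'M[K]_(m, n)) : realmx (A - B) = realmx A - realmx B.
Proof.
have reKN (x : K) : reK (- x) = - reK x.
  by apply/eqP; rewrite -addr_eq0 -reKD addNr reK0.
have imKN (x : K) : imK (- x) = - imK x.
  by apply/eqP; rewrite -addr_eq0 -imKD addNr imK0.
rewrite /realmx opp_block_mx add_block_mx; congr block_mx; apply/matrixP => i j;
  by rewrite !mxE ?reKD ?imKD ?reKN ?imKN ?opprD.
Qed.

Lemma cvg_mxexp1_nbhs (X : 'M[R]_d) :
  mxexp (t *: X) @[t --> (0 : R)] --> (1%:M : 'M[R]_d).
Proof.
have h : mxexp (t *: X) @[t --> (0 : R)^'] --> (1%:M : 'M[R]_d).
  apply: cvg_mxexp1; first exact: nbhs_dnbhs_neq.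
  by apply: cvg_trans (@cvg_id _ (nbhs (0 : R))); exact: cvg_fmap2 (@cvg_within _ _ _ _).
have h' : mxexp (t *: X) @[t --> (0 : R)^'] --> mxexp ((0 : R) *: X).
  by rewrite scale0r mxexp0.
have : mxexp (t *: X) @[t --> (0 : R)] --> mxexp ((0 : R) *: X).
  exact: ((continuous_withinNx _ _).2 h').
by rewrite scale0r mxexp0.
Qed.

(** The limit that defines [rep_deriv] exists because the real form of
    rho (exp(tX)) is a continuous one-parameter group, hence an exponential. *)
Lemma rep_deriv_mxexp n (rho : 'M[R]_d -> 'M[K]_n) X :
  is_representation G rho -> lie_algebra G X ->
  ((of_real c t)^-1 *: (rho (mxexp (t *: X)) - 1%:M) @[t --> (0 : R)^'] --> rep_deriv rho X)
  /\ forall t : R, realmx (rho (mxexp (t *: X))) = mxexp (t *: realmx (rep_deriv rho X)).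
Proof.
move=> hrho GX.
pose S (t : R) := realmx (rho (mxexp (t *: X))).
have [|||A' SA'] := @one_param_mxexp R _ S.
- by rewrite /S scale0r mxexp0 (rep_one hrho) realmx1.
- by move=> s t; rewrite /S mxexpD (rep_mul hrho)// realmxM.
- rewrite -(realmx1 R c n) -(rep_one hrho); apply: cvg_realmx.
  apply: rep_cvg => //; [exact: cmg_one hG|exact: filterE|exact: cvg_mxexp1_nbhs].
pose Q (t : R) : 'M[K]_n := (of_real c t)^-1 *: (rho (mxexp (t *: X)) - 1%:M).
have rQ : realmx (Q t) @[t --> (0 : R)^'] --> A'.
  have -> : (fun t => realmx (Q t)) = (fun t => mxquot t (mxexp (t *: A'))).
    by apply/funext => t; rewrite /Q realmxZ realmxB realmx1 -/(S t) SA'.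
  exact: cvg_mxexp_quotient.
have hQ : Q t @[t --> (0 : R)^'] --> @unrealmx R c n n A'.
  have -> : Q = (fun t => @unrealmx R c n n (realmx (Q t))).
    by apply/funext => t; rewrite realmxK.
  exact: cvg_unrealmx.
have dA : rep_deriv rho X = @unrealmx R c n n A'.
  rewrite /rep_deriv; apply: cvg_lim; first exact: norm_hausdorff.
  by rewrite scale0r mxexp0 (rep_one hrho).
have rA : realmx (rep_deriv rho X) = A'.
  by apply: mx_cvg_unique rQ; rewrite dA; exact: cvg_realmx.
by rewrite rA dA; split.
Qed.

(** [v] is fixed by every 1 + A/(k+1), hence by the limit of their powers. *)
Lemma mxexp_fix q m (v : 'M[R]_(m, q)) (A : 'M[R]_q) : v *m A = 0 -> v *m mxexp A = v.
Proof.
move=> vA; rewrite -[A in mxexp A]scale1r.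
have e0 : (@harmonic R) k @[k --> \oo] --> 0 by exact: cvg_harmonic.
have ne : k.+1%:R * (@harmonic R k) @[k --> \oo] --> (1 : R).
  by under eq_fun do rewrite /harmonic /= divff ?pnatr_eq0//; exact: cvg_cst.
have h : (1%:M + harmonic k *: A) ^+ k.+1 @[k --> \oo] --> mxexp (1 *: A).
  by apply: pow_cvg_mxexp e0 ne; exact: cvg_cst.
have hv : v *m (1%:M + harmonic k *: A) ^+ k.+1 @[k --> \oo] --> v *m mxexp (1 *: A).
  by apply: cvg_mulmx => //; exact: cvg_cst.
have vE e k : v *m (1%:M + e *: A) ^+ k = v.
  elim: k => [|k IH]; first by rewrite expr0 mulmx1.
  by rewrite exprS mulmxA mulmxDr mulmx1 -scalemxAr vA scaler0 addr0.
apply: mx_cvg_unique hv _.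
by under eq_fun do rewrite vE; exact: cvg_cst.
Qed.

Lemma fixer_compact n (rho : 'M[R]_d -> 'M[K]_n) m (v : 'M[K]_(m, n)) :
  is_representation G rho ->
  compact_matrix_group [set g | G g /\ v *m rho g = v].
Proof.
move=> hrho; split.
- by move=> g [/(cmg_unit hG)].
- by split; [exact: cmg_one|rewrite (rep_one hrho) mulmx1].
- move=> g1 g2 [G1 v1] [G2 v2]; split; first exact: cmg_mul.
  by rewrite (rep_mul hrho)// mulmxA v1.
- move=> g [Gg vg]; split; first exact: cmg_inv.
  by rewrite -[in LHS]vg -mulmxA rep_mulV// mulmx1.
rewrite compact_ultra => F UF HF; have PF : ProperFilter F by exact: ultra_proper.
have GF : F G by apply: filterS HF => g [].
have := cmg_compact hG; rewrite compact_ultra => /(_ F UF GF)[g [Gg Fg]].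
exists g; split=> //; split=> //.
have h : rho x @[x --> F] --> rho g by apply: (@rep_cvg _ rho _ F _ id).
have h1 : v *m rho x @[x --> F] --> v *m rho g by apply: cvg_mulmx => //; exact: cvg_cst.
apply: mx_cvg_unique h1 _; apply: (@cvg_trans _ ((fun=> v) @ F)); last exact: cvg_cst.
by apply: near_eq_cvg; apply: filterS HF => x [].
Qed.

(** Infinitesimal invariance suffices.  The subgroup H of the elements of G that
    fix [v] is compact; its Lie algebra is a Lie subalgebra that contains the
    generators, hence all of the Lie algebra of G, and G is connected. *)
Theorem rep_fixedP (Ndim : nat) (X : 'I_Ndim -> 'M[R]_d) n
    (rho : 'M[R]_d -> 'M[K]_n) m (v : 'M[K]_(m, n)) :
  connected G -> lie_generators G X -> is_representation G rho ->
  (forall g, G g -> v *m rho g = v) <-> (forall i, v *m rep_deriv rho (X i) = 0).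
Proof.
move=> cG [GX genX] hrho; split=> [vfix i|v0].
  have [h _] := rep_deriv_mxexp hrho (GX i).
  have hv : v *m ((of_real c t)^-1 *: (rho (mxexp (t *: X i)) - 1%:M)) @[t --> (0 : R)^']
      --> v *m rep_deriv rho (X i).
    by apply: cvg_mulmx => //; exact: cvg_cst.
  apply: mx_cvg_unique hv _.
  have -> : (fun t => v *m ((of_real c t)^-1 *: (rho (mxexp (t *: X i)) - 1%:M))) = fun=> 0.
    by apply/funext => t; rewrite -scalemxAr mulmxBr mulmx1 vfix ?subrr ?scaler0//; exact: GX.
  exact: cvg_cst.
pose H := [set g | G g /\ v *m rho g = v].
have hH : compact_matrix_group H by exact: fixer_compact.
suff HG : H = G by move=> g; rewrite -HG => -[].
apply: connected_lie_eq => //; first by move=> g [].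
apply: genX; first exact: lie_algebra_subalgebra.
move=> i t; split; first exact: GX.
have [_ h] := rep_deriv_mxexp hrho (GX i).
apply: (can_inj (@realmxK R c m n)); rewrite realmxM h.
by apply: mxexp_fix; rewrite -scalemxAr -realmxM v0 realmx0 scaler0.
Qed.

End RepresentationDerivative.

(** * Complete reducibility *)

Section FixedPoint.
Variables (R : realType) (d N : nat) (G : set 'M[R]_d) (S : 'M[R]_d -> 'M[R]_N).
Hypothesis hG : compact_matrix_group G.
Hypothesis S1 : S 1%:M = 1%:M.
Hypothesis SM : forall g h, G g -> G h -> S (g *m h) = S g *m S h.
Variable B : R.
Hypothesis SB : forall g, G g -> `|S g| <= B.

(** Conjugation need not preserve the Euclidean norm; [M] is its invariant substitute. *)
Let twist (g : 'M[R]_d) (P : 'M[R]_N) := S (invmx g) *m P *m S g.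
Let sqn (P : 'M[R]_N) : R := \sum_i \sum_j P i j ^+ 2.
Let M (P : 'M[R]_N) : R := sup [set sqn (twist g P) | g in G].

Lemma twist_comp g h P : G g -> G h -> twist g (twist h P) = twist (h *m g) P.
Proof.
move=> Gg Gh; rewrite /twist SM// !mulmxA -SM; [|exact: cmg_inv..].
congr (S _ *m _ *m _ *m _).
have hu := cmg_unit hG Gh; have gu := cmg_unit hG Gg.
have hgu : h *m g \in unitmx by rewrite unitmx_mul hu.
apply: (can_inj (mulKmx hgu)).
by rewrite mulmxV// -mulmxA [g *m (_ *m _)]mulmxA mulmxV// mul1mx mulmxV.
Qed.

Lemma twist1 P : twist 1%:M P = P.
Proof. by rewrite /twist invmx1 S1 mul1mx mulmx1. Qed.

Lemma twistB g P Q : twist g (P - Q) = twist g P - twist g Q.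
Proof. by rewrite /twist mulmxBr mulmxBl. Qed.

Lemma sqn_ge0 P : 0 <= sqn P.
Proof. by apply: sumr_ge0 => i _; apply: sumr_ge0 => j _; exact: sqr_ge0. Qed.

Lemma sqn_ge P : `|P| ^+ 2 <= sqn P.
Proof.
have h i j : P i j ^+ 2 <= sqn P.
  rewrite /sqn (bigD1 i)//= (bigD1 j)//= -addrA lerDl addr_ge0//.
    by apply: sumr_ge0 => k _; exact: sqr_ge0.
  by apply: sumr_ge0 => k _; apply: sumr_ge0 => l _; exact: sqr_ge0.
have := mx_norm_le (sqrtr_ge0 (sqn P)) => /(_ _ _ P) hs.
rewrite -(sqr_sqrtr (sqn_ge0 P)); apply: lerXn2r; rewrite ?nnegrE ?sqrtr_ge0//.
by apply: hs => i j; rewrite -sqrtr_sqr ler_wsqrtr.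
Qed.

Lemma sqn_le P : sqn P <= (N%:R * N%:R) * `|P| ^+ 2.
Proof.
have -> : N%:R * N%:R * `|P| ^+ 2 = \sum_(i < N) \sum_(j < N) `|P| ^+ 2.
  by rewrite !sumr_const !card_ord -mulrnA -[RHS]mulr_natl natrM.
apply: ler_sum => i _; apply: ler_sum => j _.
by rewrite -[leLHS]ger0_norm ?sqr_ge0// normrX lerXn2r ?nnegrE//; exact: mx_entry_le.
Qed.

Lemma bound_ge0 : 0 <= B.
Proof. by apply: le_trans (SB (cmg_one hG)); exact: normr_ge0. Qed.

(** Conjugation by a bounded group distorts the Euclidean norm by a bounded factor. *)
Lemma sqn_twist : exists2 C : R, 0 < C & forall g P, G g -> sqn (twist g P) <= C * sqn P.
Proof.
pose D := N%:R * (N%:R * B) * B.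
have D0 : 0 <= D by rewrite !mulr_ge0// bound_ge0.
exists (N%:R * N%:R * D ^+ 2 + 1); first by apply: ltr_wpDl => //; apply: mulr_ge0; [exact: mulr_ge0|exact: sqr_ge0].
move=> g P Gg; rewrite (le_trans (sqn_le _))//.
have hn : `|twist g P| <= D * `|P|.
  have -> : D * `|P| = N%:R * (N%:R * B * `|P|) * B by rewrite /D; ring.
  rewrite (le_trans (mx_norm_mulmx _ _))//.
  apply: ler_pM; rewrite ?mulr_ge0//; last exact: SB.
  rewrite ler_wpM2l// (le_trans (mx_norm_mulmx _ _))//.
  by rewrite ler_wpM2r// ler_wpM2l// SB//; exact: cmg_inv.
apply: (@le_trans _ _ (N%:R * N%:R * (D ^+ 2 * sqn P))).
  rewrite ler_wpM2l ?mulr_ge0// (@le_trans _ _ ((D * `|P|) ^+ 2))//.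
    by apply: lerXn2r hn; rewrite nnegrE//; exact: mulr_ge0.
  by rewrite exprMn ler_wpM2l ?sqr_ge0 ?sqn_ge.
by rewrite mulrDl mul1r mulrA lerDl sqn_ge0.
Qed.

Lemma sqn_parallelogram P Q :
  sqn (2^-1 *: (P + Q)) = (sqn P + sqn Q) / 2 - sqn (P - Q) / 4.
Proof.
rewrite /sqn !(mulr_suml, =^~ sumrB, =^~ big_split) /=; apply: eq_bigr => i _.
rewrite !(mulr_suml, =^~ sumrB, =^~ big_split) /=; apply: eq_bigr => j _.
by rewrite !mxE; field.
Qed.

Variable A : set 'M[R]_N.
Hypothesis A_nonempty : A !=set0.
Hypothesis A_lim : forall (F : set_system nat) (P : nat -> 'M[R]_N) Q,
  ProperFilter F -> (forall k, A (P k)) -> P @ F --> Q -> A Q.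
Hypothesis A_mid : forall P Q, A P -> A Q -> A (2^-1 *: (P + Q)).
Hypothesis A_act : forall g P, G g -> A P -> A (S (invmx g) *m P *m S g).

(** A conjugation-stable closed set [A] that contains midpoints has a fixed point.
    The function [M] is invariant, and by the parallelogram law it drops at a
    midpoint by a multiple of the squared distance.  For P nearly minimal, P and
    its conjugates, which have the same value of [M], are therefore close to each
    other, and a limit of minimising P is fixed. *)
Theorem fixed_point : exists2 P, A P & forall g, G g -> S (invmx g) *m P *m S g = P.
Proof.
have [C C0 hC] := sqn_twist.
have Msup P : has_sup [set sqn (twist g P) | g in G].
  split; first by exists (sqn (twist 1%:M P)), 1%:M => //; exact: cmg_one.
  by exists (C * sqn P) => _ [g Gg <-]; exact: hC.
have leM g P : G g -> sqn (twist g P) <= M P.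
  by move=> Gg; apply: sup_upper_bound => //; exists g.
have Mtwist h P : G h -> M (twist h P) <= M P.
  move=> Gh; apply: ge_sup; first by have [] := Msup (twist h P).
  by move=> _ [g Gg <-]; rewrite twist_comp//; apply: leM; exact: cmg_mul.
have Mmid P Q : M (2^-1 *: (P + Q)) <= (M P + M Q) / 2 - sqn (P - Q) / (4 * C).
  apply: ge_sup; first by have [] := Msup (2^-1 *: (P + Q)).
  move=> _ [g Gg <-].
  have -> : twist g (2^-1 *: (P + Q)) = 2^-1 *: (twist g P + twist g Q).
    by rewrite /twist -scalemxAr mulmxDr -scalemxAl mulmxDl.
  rewrite sqn_parallelogram lerB//; first by rewrite ler_pM2r// lerD ?leM.
  have h : sqn (P - Q) <= C * sqn (twist g (P - Q)).
    rewrite -[X in sqn X <= _]twist1 -(mulmxV (cmg_unit hG Gg)) -twist_comp//; last exact: cmg_inv.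
    by apply: hC; exact: cmg_inv.
  rewrite -twistB ler_pdivrMr ?mulr_gt0//.
  have -> : sqn (twist g (P - Q)) / 4 * (4 * C) = C * sqn (twist g (P - Q)) by field.
  exact: h.
pose mu := inf [set M P | P in A].
have mu_inf : has_inf [set M P | P in A].
  split; first by have [P AP] := A_nonempty; exists (M P), P.
  exists 0 => _ [P AP <-]; apply: le_trans (leM _ _ (cmg_one hG)); exact: sqn_ge0.
(* points of A where M is close to its infimum are close to each other *)
have hsq P Q : A P -> A Q -> sqn (P - Q) <= 2 * C * (M P + M Q - 2 * mu).
  move=> AP AQ.
  have h : mu <= M (2^-1 *: (P + Q)).
    by apply: inf_lbound; [case: mu_inf|exists (2^-1 *: (P + Q)) => //; exact: A_mid].
  have := le_trans h (Mmid P Q); rewrite lerBrDr -lerBrDl ler_pdivrMr ?mulr_gt0//.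
  by move=> /le_trans; apply; rewrite le_eqVlt; apply/orP; left; apply/eqP; field.
have /choice[P hP] : forall k : nat, exists P, A P /\ M P < mu + @harmonic R k.
  move=> k; have hk : 0 < @harmonic R k by rewrite /harmonic invr_gt0.
  by have [_ [P AP <-] hlt] := inf_adherent hk mu_inf; exists P.
have Pbound k : `|P k| <= `|P 0%N| + (4 * C + 1).
  have [Ak Mk] := hP k; have [A0 M0] := hP 0%N.
  rewrite -[P k](subrKC (P 0%N)) (le_trans (ler_normD _ _))// lerD2l.
  have h1 : `|P k - P 0%N| ^+ 2 <= 4 * C.
    rewrite (le_trans (sqn_ge _))// (le_trans (hsq _ _ Ak A0))//.
    have hk : @harmonic R k <= 1 by rewrite /harmonic invf_le1// ler1n.
    have h0 : @harmonic R 0 = 1 by rewrite /harmonic /= invr1.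
    have -> : 4 * C = 2 * C * 2 by ring.
    by rewrite ler_wpM2l ?mulr_ge0 ?(ltW C0)//; rewrite h0 in M0; lra.
  have C0' := ltW C0.
  have [le1|gt1] := leP `|P k - P 0%N| 1; first by rewrite (le_trans le1)// lerDr mulr_ge0.
  apply: (@le_trans _ _ (`|P k - P 0%N| ^+ 2)); first by rewrite expr2 ler_peMr// ltW.
  by rewrite (le_trans h1)// lerDl.
have [U [UU sU]] := ultraFilterLemma (eventually_filter : ProperFilter \oo).
have PU : ProperFilter U by exact: ultra_proper.
have [Q _ PQ] := ultra_cvg_bounded UU Pbound.
exists Q; first by apply: A_lim PQ => k; have [] := hP k.
move=> g Gg; rewrite -/(twist g Q); apply/eqP; rewrite -subr_eq0 -normr_eq0 -sqrf_eq0.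
apply/eqP/le_anti; rewrite sqr_ge0 andbT.
have lhs : `|twist g (P k) - P k| ^+ 2 @[k --> U] --> `|twist g Q - Q| ^+ 2.
  have h : `|twist g (P k) - P k| @[k --> U] --> `|twist g Q - Q|.
    apply: cvg_norm; apply: cvgB => //.
    by apply: cvg_mulmx; [apply: cvg_mulmx|]; try exact: cvg_cst.
  by under eq_fun do rewrite expr2; rewrite expr2; exact: cvgM.
have rhs : 4 * C * @harmonic R k @[k --> U] --> 0.
  have : 4 * C * @harmonic R k @[k --> \oo] --> 0.
    by rewrite -[X in _ --> X](mulr0 (4 * C)); apply: cvgMr; exact: cvg_harmonic.
  by apply: cvg_trans => V /=; apply: sU.
apply: (ler_cvg_to lhs rhs); apply: filterE => k.
have [Ak Mk] := hP k.
rewrite (le_trans (sqn_ge _))// (le_trans (hsq _ _ (A_act Gg Ak) Ak))//.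
have := Mtwist g (P k) Gg; rewrite -/(twist g (P k)) => h.
have -> : 4 * C * harmonic k = 2 * C * (2 * harmonic k) by ring.
by rewrite ler_wpM2l ?mulr_ge0 ?(ltW C0)//; lra.
Qed.

End FixedPoint.

Section CompleteReducibility.
Variables (R : realType) (c : field_kind) (d : nat) (G : set 'M[R]_d).
Local Notation K := (base_field R c).
Hypothesis hG : compact_matrix_group G.

Lemma rep_bounded n (rho : 'M[R]_d -> 'M[K]_n) : is_representation G rho ->
  exists B : R, forall g, G g -> `|realmx (rho g)| <= B.
Proof.
move=> hrho.
have hc : {within G, continuous (fun g => realmx (rho g))}.
  apply/subspace_continuousP => g Gg.
  have FF : Filter (nbhs g) by exact: (@nbhs_filter 'M[R]_d g).
  have FW : Filter (within G (nbhs g)) by exact: within_filter.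
  have /subspace_continuousP/(_ g Gg) hg := rep_continuous hrho.
  exact: (cvg_realmx hg).
have /compact_bounded[B [_ hB]] := continuous_compact hc (cmg_compact hG).
by exists (B + 1) => g Gg; apply: hB; [rewrite ltrDl|exists g].
Qed.

(** Maschke's theorem for compact groups.  The projections onto [U] form a convex
    set stable under conjugation by the group; a conjugation-invariant one among
    their real counterparts has an equivariant K-linear part. *)
Theorem complete_reducibility n (rho : 'M[R]_d -> 'M[K]_n) (U : 'M[K]_n) :
  is_representation G rho -> (forall g, G g -> stablemx U (rho g)) ->
  exists P : 'M[K]_n, [/\ (P <= U)%MS, U *m P = U
    & forall g, G g -> P *m rho g = rho g *m P].
Proof.
move=> hrho stU.
pose P0 := proj_mx <<U>>%MS (<<U>>^C)%MS.
have UC0 : (<<U>> :&: <<U>>^C = 0)%MS by exact: capmx_compl.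
have P0U : (P0 <= U)%MS by rewrite -[P0]mul1mx -(genmxE U) proj_mx_sub.
have UP0 m (v : 'M[K]_(m, n)) : (v <= U)%MS -> v *m P0 = v.
  by move=> vU; apply: proj_mx_id; rewrite // genmxE.
have [B SB] := rep_bounded hrho.
pose A := [set Q : 'M[R]_(n + n) | Q *m realmx P0 = Q /\ realmx P0 *m Q = realmx P0].
have [||||||Q [QP0 P0Q] Qfix] := @fixed_point R d (n + n) G (fun g => realmx (rho g)) hG _ _ B SB A.
- by rewrite (rep_one hrho) realmx1.
- by move=> g h Gg Gh; rewrite (rep_mul hrho)// realmxM.
- by exists (realmx P0); split; rewrite -realmxM UP0.
- move=> F P Q PF AP PQ; split.
    apply: (@mx_cvg_unique _ _ F _ _ _ (fun k => P k *m realmx P0)).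
      by apply: cvg_mulmx => //; exact: cvg_cst.
    by have -> : (fun k => P k *m realmx P0) = P by apply/funext => k; case: (AP k).
  apply: (@mx_cvg_unique _ _ F _ _ _ (fun k => realmx P0 *m P k)).
    by apply: cvg_mulmx => //; exact: cvg_cst.
  have -> : (fun k => realmx P0 *m P k) = fun=> realmx P0 by apply/funext => k; case: (AP k).
  exact: cvg_cst.
- move=> P Q [P1 P2] [Q1 Q2]; split.
    by rewrite -scalemxAl mulmxDl P1 Q1.
  rewrite -scalemxAr mulmxDr P2 Q2; move: (realmx P0) => Z.
  by apply/matrixP => i j; rewrite !mxE; field.
- move=> g P Gg [P1 P2]; have Ggi := cmg_inv hG Gg; split.
    have PE : P *m realmx (rho g) = P *m realmx (P0 *m rho g) by rewrite realmxM mulmxA P1.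
    rewrite -!mulmxA; congr (_ *m _); rewrite mulmxA PE -mulmxA -realmxM UP0//.
    exact: submx_trans (submxMr _ P0U) (stU g Gg).
  rewrite !mulmxA -realmxM.
  have -> : P0 *m rho (invmx g) = P0 *m rho (invmx g) *m P0.
    by rewrite UP0//; exact: submx_trans (submxMr _ P0U) (stU _ Ggi).
  rewrite realmxM -[_ *m _ *m P]mulmxA P2 -!realmxM UP0.
    by rewrite -mulmxA (rep_mulVg hG)// mulmx1.
  exact: submx_trans (submxMr _ P0U) (stU _ Ggi).
exists (unrealmx c Q); split.
- have <- : unrealmx c (Q *m realmx P0) = unrealmx c Q by rewrite QP0.
  by rewrite unrealmx_mulr; apply: submx_trans P0U; exact: submxMl.
- rewrite -unrealmx_mull.
  have -> : realmx U *m Q = realmx U.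
    by rewrite -[U in LHS](UP0 _ U (submx_refl _)) realmxM -mulmxA P0Q -realmxM UP0.
  exact: realmxK.
move=> g Gg; rewrite -unrealmx_mulr -unrealmx_mull; congr (unrealmx c _).
rewrite -[in RHS](Qfix g Gg) !mulmxA -realmxM (rep_mulV hG)// realmx1 mul1mx //.
Qed.
End CompleteReducibility.

(** * Schur's lemma and the irreducible copies in a representation *)

Section Intertwiners.
Variables (R : realType) (c : field_kind) (d : nat) (G : set 'M[R]_d).
Local Notation K := (base_field R c).

Definition intertwiners m s (sigma : 'M[R]_d -> 'M[K]_s) (rho : 'M[R]_d -> 'M[K]_m) :
    set 'M[K]_(m, s) :=
  [set B | forall g, G g -> B *m sigma g = rho g *m B].

(** Kernel and row space of an intertwiner are stable, hence trivial or full. *)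
Lemma schur_zero m n (rho : 'M[R]_d -> 'M[K]_m) (rho' : 'M[R]_d -> 'M[K]_n)
    (T : 'M[K]_(m, n)) :
  irreducible_rep G rho -> irreducible_rep G rho' -> ~ equivalent_rep G rho rho' ->
  intertwiners rho' rho T -> T = 0.
Proof.
move=> [m0 irr] [n0 irr'] neq hT.
have [|U0|Ufull] := irr (kermx T).
- move=> g Gg; apply/sub_kermxP.
  by rewrite -mulmxA -hT// mulmxA mulmx_ker mul0mx.
- have Tfree : row_free T by rewrite -kermx_eq0 U0.
  have [|T0|Tfull] := irr' <<T>>%MS.
  + move=> g Gg; rewrite (eqmxMr _ (genmxE T)) genmxE hT//.
    exact: submxMl.
  + by apply/eqP; rewrite -submx0 -T0 genmxE.
  + case: neq; exists T, (pinvmx T); split.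
    * exact: mulmxVp.
    * by apply: mulVpmx; rewrite /row_full -mxrank_gen.
    * by move=> g Gg; rewrite hT.
by move: Ufull; rewrite -sub1mx => /sub_kermxP; rewrite mul1mx.
Qed.

(** Over C, a commuting matrix has an eigenvalue and its eigenspace is stable. *)
Lemma schur_scalar n (rho : 'M[R]_d -> 'M[K]_n) :
  irreducible_rep G rho -> (c = RealField -> scalar_commutant G rho) ->
  scalar_commutant G rho.
Proof.
move=> irr hreal; case: (c) (rho) irr hreal => [rho' _ /(_ erefl)//|{}rho [n0 irr] _ A hA].
have [a ha] : exists a : R[i], eigenvalue (A : 'M[R[i]]_n) a.
  have : size (char_poly (A : 'M[R[i]]_n)) != 1%N by rewrite size_char_poly eqSS -lt0n.
  by case/closed_rootP => a; rewrite -eigenvalue_root_char; exists a.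
have [g Gg|E0|] := irr (eigenspace (A : 'M[R[i]]_n) a).
- by apply: comm_mx_stable_eigenspace; exact: hA.
- by move: ha; rewrite /eigenvalue E0 eqxx.
rewrite -sub1mx => /eigenspaceP; rewrite mul1mx => ->.
by apply/is_scalar_mxP; exists a; rewrite scalemx1.
Qed.

End Intertwiners.

Section IrreducibleSub.
Variables (R : realType) (c : field_kind) (d : nat) (G : set 'M[R]_d).
Local Notation K := (base_field R c).

(** A nonzero stable subspace of [V] of least dimension is irreducible; [B] is a
    basis of it, and [tau] the representation in that basis. *)
Lemma irreducible_subrep s (sigma : 'M[R]_d -> 'M[K]_s) (V : 'M[K]_s) :
  is_representation G sigma -> (forall g, G g -> stablemx V (sigma g)) -> V != 0 ->
  exists (k : nat) (B : 'M[K]_(k, s)) (tau : 'M[R]_d -> 'M[K]_k),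
    [/\ (B <= V)%MS, B != 0, is_representation G tau, irreducible_rep G tau
      & intertwiners G sigma tau B].
Proof.
move=> hs stV V0.
pose Q (k : nat) := exists U : 'M[K]_s, [/\ (U <= V)%MS, U != 0,
  forall g, G g -> stablemx U (sigma g) & \rank U = k].
have [k [[U [UV U0 stU rU]] kmin]] : exists k, Q k /\ forall j, Q j -> (k <= j)%N.
  have ex : exists k, `[< Q k >] by exists (\rank V); apply/asboolP; exists V.
  case: (ex_minnP ex) => k /asboolP Qk kmin; exists k; split=> // j Qj.
  by apply: kmin; apply/asboolP.
pose B := row_base U.
have BU : (B :=: U)%MS := eq_row_base U.
have Bfree : row_free B := row_base_free U.
have Bst g : G g -> (B *m sigma g <= B)%MS.
  by move=> Gg; rewrite (eqmxMr _ BU) BU; exact: stU.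
pose tau g := B *m sigma g *m pinvmx B.
have tauE g : G g -> B *m sigma g = tau g *m B by move=> Gg; rewrite mulmxKpV// Bst.
exists (\rank U), B, tau; split => //.
- by rewrite BU.
- by rewrite -mxrank_eq0 BU mxrank_eq0.
- split.
  + by rewrite /tau (rep_one hs) mulmx1 mulmxVp.
  + by move=> g1 g2 G1 G2; rewrite [LHS]/tau (rep_mul hs)// [B *m (_ *m _)]mulmxA (tauE g1 G1) -!(mulmxA (tau g1)).
  + apply/subspace_continuousP => g Gg.
    have FF : Filter (nbhs g) by exact: (@nbhs_filter 'M[R]_d g).
    have FW : Filter (within G (nbhs g)) by exact: within_filter.
    have /subspace_continuousP/(_ g Gg) hg := rep_continuous hs.
    apply: cvg_mulmx; last exact: cvg_cst.
    by apply: cvg_mulmx; [exact: cvg_cst|exact: hg].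
- split; first by rewrite lt0n mxrank_eq0.
  move=> W stW; have [->|W0] := eqVneq W 0; [by left|right].
  have WB : <<W *m B>>%MS != 0.
    by rewrite -mxrank_eq0 genmxE mxrankMfree// mxrank_eq0.
  rewrite /row_full eqn_leq rank_leq_col/= -[X in (_ <= X)%N](mxrankMfree _ Bfree).
  rewrite {1}rU; apply: kmin; exists <<W *m B>>%MS; split => //.
  + by rewrite genmxE (submx_trans (submxMl _ _))// BU.
  + move=> g Gg; rewrite (eqmxMr _ (genmxE _)) genmxE -mulmxA tauE// mulmxA.
    by rewrite submxMr//; exact: stW.
  + by rewrite genmxE.
Qed.

End IrreducibleSub.

Section Isotypic.
Variables (R : realType) (c : field_kind) (d : nat) (G : set 'M[R]_d).
Local Notation K := (base_field R c).
Hypothesis hG : compact_matrix_group G.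
Variables (I : choiceType) (n : I -> nat) (rho : forall l, 'M[R]_d -> 'M[K]_(n l)).
Hypothesis hrho : complete_irreducible_family G rho.
Hypothesis hsc : forall l, scalar_commutant G (rho l).
Variables (s : nat) (sigma : 'M[R]_d -> 'M[K]_s).
Hypothesis hs : is_representation G sigma.
Variables (dim : I -> nat) (b : forall L, 'I_(dim L) -> 'M[K]_(n L, s)).
Hypothesis hb : forall L, is_basis (@b L) (intertwiners G sigma (rho L)).

(** A copy is a basis intertwiner from sigma to some rho L; the rows of its matrix
    span a copy of rho L in the representation sigma on row vectors. *)
Local Notation copy := {L : I & 'I_(dim L)}.
Definition copy_mx (x : copy) : 'M[K]_(n (tag x), s) := b (tagged x).

Lemma copy_mxP (x : copy) g : G g -> copy_mx x *m sigma g = rho (tag x) g *m copy_mx x.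
Proof. by have [bin _ _] := hb (tag x); exact: bin. Qed.

Definition copies_span (p : seq copy) : 'M[K]_s := (\sum_(x <- p) <<copy_mx x>>)%MS.

Lemma sub_copies_spanP (p : seq copy) m (A : 'M[K]_(m, s)) : uniq p ->
  (A <= copies_span p)%MS <->
  exists T : forall x : copy, 'M[K]_(m, n (tag x)), A = \sum_(x <- p) T x *m copy_mx x.
Proof.
rewrite /copies_span; elim: p A => [|x p IH] A /=.
  move=> _; rewrite big_nil submx0; split => [/eqP->|[T ->]]; last by rewrite big_nil.
  by exists (fun=> 0); rewrite big_nil.
move=> /andP[xp up]; rewrite big_cons; split=> [/sub_addsmxP[[u v] /= ->]|[T ->]].
  have /submxP[D ->] : (u *m <<copy_mx x>>%MS <= copy_mx x)%MS.
    by rewrite (submx_trans (submxMl _ _))// genmxE.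
  have [T ->] := (IH (v *m (\sum_(x <- p) <<copy_mx x>>)%MS) up).1 (submxMl _ _).
  exists (eqtype.dfwith T D); rewrite big_cons eqtype.dfwith_in; congr (_ + _).
  apply: eq_big_seq => y yp; rewrite eqtype.dfwith_out//.
  by apply: contraNneq xp => ->.
rewrite big_cons; apply: addmx_sub.
  by apply: submx_trans (addsmxSl _ _); rewrite genmxE submxMl.
by apply: submx_trans (addsmxSr _ _); apply/(IH _ up); exists T.
Qed.

Lemma copies_span_stable p g : uniq p -> G g -> stablemx (copies_span p) (sigma g).
Proof.
move=> up Gg.
have [T TE] := (sub_copies_spanP _ up).1 (submx_refl (copies_span p)).
apply/(sub_copies_spanP _ up); exists (fun x => T x *m rho (tag x) g).
rewrite {1}TE mulmx_suml; apply: eq_bigr => x _.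
by rewrite -!mulmxA copy_mxP.
Qed.

(** By Schur's lemma [T] is zero or scalar, so composing it with a copy gives a
    multiple of that copy, which does not involve the basis vector [i0]. *)
Lemma intertwiner_on_copy (y : copy) L (i0 : 'I_(dim L)) (T : 'M[K]_(n L, n (tag y))) :
  intertwiners G (rho (tag y)) (rho L) T -> y <> existT _ L i0 ->
  exists t : 'I_(dim L) -> K, T *m copy_mx y = \sum_i t i *: b i /\ t i0 = 0.
Proof.
case: y T => L' i T; rewrite /copy_mx /=; have [eL|neL] := eqVneq L L'; last first.
  move=> hT _; exists (fun=> 0); split => //.
  rewrite (schur_zero _ _ _ hT) ?mul0mx; [|exact: family_irreducible hrho _..|].
    by rewrite big1// => j _; rewrite scale0r.
  exact: family_inequivalent hrho _ _ neL.
subst L' => hT yi; have /is_scalar_mxP[a ->] := hsc hT.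
exists (fun j => if j == i then a else 0); split.
  rewrite mul_scalar_mx (bigD1 i)//= eqxx big1 ?addr0// => j /negPf->.
  by rewrite scale0r.
by case: eqP => // ii; case: yi; rewrite ii.
Qed.

(** The rows of distinct copies are jointly independent.  By induction, let x0 be
    a further copy.  The coefficient vectors v for which v B_x0 is dependent on the
    other copies form a stable subspace U, so U is 0 or everything.  If U = 0 the
    coefficient of x0 vanishes.  Otherwise B_x0 is a sum of T_x B_x, in which each
    T_x intertwines by the induction hypothesis, and [intertwiner_on_copy] turns
    this into a linear relation between the basis intertwiners to rho (tag x0). *)
Lemma copies_free (p : seq copy) : uniq p ->
  forall m (A : forall x : copy, 'M[K]_(m, n (tag x))),
  \sum_(x <- p) A x *m copy_mx x = 0 -> forall x, x \in p -> A x = 0.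
Proof.
elim: p => [//|x0 p IH] /= /andP[xp up] m A; rewrite big_cons => A0.
pose W := copies_span p; pose U := kermx (copy_mx x0 *m cokermx W).
have UP k (v : 'M[K]_(k, n (tag x0))) : (v <= U)%MS = (v *m copy_mx x0 <= W)%MS.
  by rewrite [RHS]submxE -mulmxA; apply/sub_kermxP/eqP.
have [_ irr] := family_irreducible hrho (tag x0).
have [g Gg|U0|Ufull] := irr U.
- rewrite UP -mulmxA -copy_mxP// mulmxA.
  apply: submx_trans (copies_span_stable up Gg).
  by rewrite submxMr// -UP.
- have Ax0 : A x0 = 0.
    apply/eqP; rewrite -submx0 -U0 UP; apply/(sub_copies_spanP _ up).
    exists (fun x => - A x); move/eqP: A0; rewrite addr_eq0 => /eqP->.
    by rewrite -sumrN; apply: eq_bigr => x _; rewrite mulNmx.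
  rewrite Ax0 mul0mx add0r in A0.
  by move=> x; rewrite inE => /predU1P[->//|]; apply: IH.
have [T TE] : exists T : forall x : copy, 'M[K]_(n (tag x0), n (tag x)),
    copy_mx x0 = \sum_(x <- p) T x *m copy_mx x.
  apply/(sub_copies_spanP _ up); rewrite -/W -[copy_mx x0]mul1mx -UP.
  by rewrite sub1mx.
have hT x : x \in p -> intertwiners G (rho (tag x)) (rho (tag x0)) (T x).
  move=> xinp g Gg; apply/eqP; rewrite -subr_eq0; apply/eqP; move: x xinp.
  apply: (IH up _ (fun x => T x *m rho (tag x) g - rho (tag x0) g *m T x)).
  transitivity (\sum_(x <- p) (T x *m copy_mx x *m sigma g - rho (tag x0) g *m (T x *m copy_mx x))).
    by apply: eq_bigr => x _; rewrite mulmxBl -!mulmxA copy_mxP.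
  by rewrite sumrB -mulmx_suml -mulmx_sumr -TE copy_mxP// subrr.
have /choice[t ht] : forall x, exists t : 'I_(dim (tag x0)) -> K, x \in p ->
    T x *m copy_mx x = \sum_i t i *: b i /\ t (tagged x0) = 0.
  move=> x; have [xinp|_] := boolP (x \in p); last by exists (fun=> 0).
  have [|t tP] := @intertwiner_on_copy x (tag x0) (tagged x0) (T x) (hT x xinp).
    by rewrite -[existT _ _ _]/(Tagged _ (tagged x0)) taggedK => xx0; rewrite -xx0 xinp in xp.
  by exists t.
have [_ bfree _] := hb (tag x0).
have := bfree (index_enum _) (fun i => (i == tagged x0)%:R - \sum_(x <- p) t x i).
have -> : \sum_i ((i == tagged x0)%:R - \sum_(x <- p) t x i) *: b i = 0.
  under eq_bigr do rewrite scalerBl; rewrite sumrB; apply/eqP; rewrite subr_eq0; apply/eqP.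
  rewrite (bigD1 (tagged x0))//= eqxx scale1r big1 ?addr0; last first.
    by move=> i /negPf->; rewrite scale0r.
  rewrite -/(copy_mx x0) TE; under [RHS]eq_bigr do rewrite scaler_suml.
  rewrite exchange_big /=; apply: eq_big_seq => x xinp.
  by have [-> _] := ht x xinp.
move=> /(_ (index_enum_uniq _) erefl (tagged x0) (mem_index_enum _)).
rewrite eqxx big_seq big1 => [/eqP|x xinp]; first by rewrite subr0 oner_eq0.
by have [_ ->] := ht x xinp.
Qed.

(** Take copies of maximal joint rank.  If they did not span, a stable complement
    would contain an irreducible subrepresentation, equivalent to some rho L by
    completeness; expanding the resulting intertwiner in the basis yields a copy
    outside the span. *)
Lemma copies_span_full : exists2 p : seq copy, uniq p & row_full (copies_span p).
Proof.
pose Q (k : nat) := exists2 p : seq copy, uniq p & \rank (copies_span p) = k.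
have [k [[p up rp] kmax]] : exists k, Q k /\ forall j, Q j -> (j <= k)%N.
  have ex : exists k, `[< Q k >] by exists (\rank (copies_span [::])); apply/asboolP; exists [::].
  have bnd k : `[< Q k >] -> (k <= s)%N by move=> /asboolP[p _ <-]; exact: rank_leq_col.
  case: (ex_maxnP ex bnd) => k /asboolP Qk kmax; exists k; split=> // j Qj.
  by apply: kmax; apply/asboolP.
exists p => //; set W := copies_span p in rp *.
apply: contrapT => Wnfull.
have [P [PW WP Pcomm]] := complete_reducibility hG hs (fun g => @copies_span_stable p g up).
have PP : P *m P = P.
  by have /submxP[D PE] := PW; rewrite {1}PE -mulmxA WP -PE.
have stV g : G g -> stablemx (1%:M - P) (sigma g).
  move=> Gg; rewrite mulmxBl mul1mx Pcomm// -{1}[sigma g]mulmx1 -mulmxBr.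
  exact: submxMl.
have V0 : 1%:M - P != 0.
  apply/eqP => /eqP; rewrite subr_eq0 => /eqP P1; apply: Wnfull.
  by rewrite -sub1mx P1.
have [k' [B [tau [BV B0 htau irrtau hB]]]] := irreducible_subrep hs stV V0.
have [L [P1 [Q1 [PQ QP hPQ]]]] := family_complete hrho htau irrtau.
have hPB : intertwiners G sigma (rho L) (P1 *m B).
  by move=> g Gg; rewrite -mulmxA hB// !mulmxA hPQ.
have [_ _ bspan] := hb L.
have [q [a PBE]] := bspan _ hPB.
have [i bi] : exists i : 'I_(dim L), ~ (b i <= W)%MS.
  apply: contrapT => /forallNP nb.
  have PBW : (P1 *m B <= W)%MS.
    rewrite PBE; elim/big_ind: _ => [|u v|i _]; [exact: sub0mx|exact: addmx_sub|].
    by apply: scalemx_sub; apply: contrapT; exact: nb.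
  have BW : (B <= W)%MS.
    by rewrite -[B]mul1mx -QP -mulmxA (submx_trans (submxMl _ _)).
  have BP : B *m P = B by have /submxP[D ->] := BW; rewrite -mulmxA WP.
  have BP0 : B *m P = 0.
    by have /submxP[D ->] := BV; rewrite -mulmxA mulmxBl mul1mx PP subrr mulmx0.
  by move: B0; rewrite -BP BP0 eqxx.
pose x : copy := existT _ L i.
have xp : x \notin p.
  apply/negP => xp; apply: bi; apply/(sub_copies_spanP _ up).
  pose f0 (y : copy) : 'M[K]_(n (tag x), n (tag y)) := 0.
  exists (eqtype.dfwith f0 (1%:M : 'M[K]_(n (tag x)))).
  rewrite (bigD1_seq x)//= eqtype.dfwith_in mul1mx big1 ?addr0// => y yx.
  by rewrite eqtype.dfwith_out 1?eq_sym// mul0mx.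
have := kmax (\rank (copies_span (x :: p))) (ex_intro2 _ _ (x :: p) _ erefl).
rewrite /= xp up -rp => /(_ isT) hr.
apply: bi; rewrite /W.
have WW : (W <= copies_span (x :: p))%MS by rewrite /copies_span big_cons addsmxSr.
have /eqmxP/eqmx_sym e : (W == copies_span (x :: p))%MS.
  by rewrite -(geq_leqif (mxrank_leqif_eq WW)).
rewrite -e /copies_span big_cons; apply: submx_trans (addsmxSl _ _).
by rewrite genmxE.
Qed.

(** The spanning copies are all the copies there are, since any further one would
    be dependent on them.  In particular only finitely many L occur in sigma. *)
Theorem copies_partition_of_unity : exists (p : seq copy)
    (D : forall x : copy, 'M[K]_(s, n (tag x))),
  [/\ uniq p, forall x, x \in p & 1%:M = \sum_(x <- p) D x *m copy_mx x].
Proof.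
have [p up] := copies_span_full; rewrite -sub1mx => pfull.
have [D DE] := (sub_copies_spanP _ up).1 pfull.
exists p, D; split => // x; apply: contrapT => /negP xp.
have [n0 _] := family_irreducible hrho (tag x).
have := @copies_free (x :: p) _ _ (eqtype.dfwith (fun y => - (copy_mx x *m D y)) (1%:M : 'M[K]_(n (tag x)))).
rewrite /= xp up big_cons eqtype.dfwith_in mul1mx => /(_ isT) h.
have : (1%:M : 'M[K]_(n (tag x))) = 0.
  transitivity (eqtype.dfwith (fun y => - (copy_mx x *m D y)) (1%:M : 'M[K]_(n (tag x))) x).
    by rewrite eqtype.dfwith_in.
  apply: h; last by rewrite inE eqxx.
  apply/eqP; rewrite addr_eq0; apply/eqP.
  rewrite -[LHS]mulmx1 DE mulmx_sumr -sumrN; apply: eq_big_seq => y yp.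
  rewrite eqtype.dfwith_out; first by rewrite mulNmx opprK mulmxA.
  by apply: contraNneq xp => ->.
move=> /matrixP/(_ (Ordinal n0) (Ordinal n0)); rewrite !mxE eqxx => /eqP.
by rewrite oner_eq0.
Qed.

End Isotypic.

(** * The kernel of the coupling matrix *)

Section FiniteIndex.
Variables (R : realType) (c : field_kind) (d : nat) (G : set 'M[R]_d).
Local Notation K := (base_field R c).
Hypothesis hG : compact_matrix_group G.

Definition fmx (T : finType) (f : T -> T -> K) : 'M[K]_#|T| :=
  \matrix_(i, j) f (enum_val i) (enum_val j).

Lemma sum_enum_val (V : nmodType) (T : finType) (f : T -> V) :
  \sum_(i < #|T|) f (enum_val i) = \sum_x f x.
Proof. by rewrite [RHS](reindex _ (onW_bij _ (enum_val_bij T))). Qed.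

Lemma sum_triple (V : nmodType) (T1 T2 T3 : finType) (f : T1 * T2 * T3 -> V) :
  \sum_z f z = \sum_z3 \sum_z2 \sum_z1 f (z1, z2, z3).
Proof.
transitivity (\sum_(p : (T1 * T2) * T3) f (p.1, p.2)); first by apply: eq_bigr => -[].
rewrite -(pair_bigA _ (fun p z3 => f (p, z3))) exchange_big /=; apply: eq_bigr => z3 _.
transitivity (\sum_(p : T1 * T2) f (p.1, p.2, z3)); first by apply: eq_bigr => -[].
by rewrite -(pair_bigA _ (fun z1 z2 => f (z1, z2, z3))) exchange_big.
Qed.

Lemma fmx_representation (T : finType) (f : 'M[R]_d -> T -> T -> K) :
  (forall x y, f 1%:M x y = (x == y)%:R) ->
  (forall g h x y, G g -> G h -> f (g *m h) x y = \sum_z f g x z * f h z y) ->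
  (forall g x y, G g -> f h x y @[h --> within G (nbhs g)] --> f g x y) ->
  is_representation G (fun g => fmx (f g)).
Proof.
move=> f1 fM fc; split.
- by apply/matrixP => i j; rewrite !mxE f1 (inj_eq enum_val_inj).
- move=> g h Gg Gh; apply/matrixP => i j; rewrite !mxE fM// -sum_enum_val.
  by apply: eq_bigr => k _; rewrite !mxE.
- apply/subspace_continuousP => g Gg.
  have FF : Filter (nbhs g) by exact: (@nbhs_filter 'M[R]_d g).
  have FW : Filter (within G (nbhs g)) by exact: within_filter.
  apply/cvg_mxP => i j; rewrite mxE.
  have -> : (fun h => fmx (f h) i j) = (fun h => f h (enum_val i) (enum_val j)).
    by apply/funext => h; rewrite mxE.
  exact: fc.
Qed.

Lemma rep_entry_cvg n (rho : 'M[R]_d -> 'M[K]_n) g i j :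
  is_representation G rho -> G g ->
  rho h i j @[h --> within G (nbhs g)] --> rho g i j.
Proof.
move=> hrho Gg.
have FF : Filter (nbhs g) by exact: (@nbhs_filter 'M[R]_d g).
have FW : Filter (within G (nbhs g)) by exact: within_filter.
have /subspace_continuousP/(_ g Gg)/cvg_mxP := rep_continuous hrho.
exact.
Qed.

Lemma cmg_inv_cvg g : G g -> invmx h @[h --> within G (nbhs g)] --> invmx g.
Proof.
move=> Gg.
have FF : ProperFilter (nbhs g) by exact: (@nbhs_pfilter 'M[R]_d g).
have FW : Filter (within G (nbhs g)) by exact: within_filter.
have /compact_bounded[B0 [_ hB0]] := cmg_compact hG.
pose B := `|B0| + 1.
have hB h : G h -> `|h| <= B.
  by move=> Gh; apply: (hB0 _ _ h Gh); rewrite ltr_pwDr// ler_norm.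
have B_gt0 : 0 < B by rewrite ltr_wpDl.
pose C := d%:R * (d%:R * B) * B + 1.
have C0 : 0 < C by rewrite /C ltr_wpDl// !mulr_ge0// ltW.
apply/cvgrPdist_le => e e0.
have eC : 0 < e / C by rewrite divr_gt0.
have /cvgrPdist_le/(_ _ eC) hg : id h @[h --> nbhs g] --> g by exact: cvg_id.
apply: filterS hg => h hg Gh.
have -> : invmx g - invmx h = invmx h *m (h - g) *m invmx g.
  rewrite mulmxBr mulmxBl mulVmx ?(cmg_unit hG)// mul1mx -mulmxA mulmxV ?(cmg_unit hG)//.
  by rewrite mulmx1.
have hd : `|h - g| <= e / C by rewrite distrC.
rewrite (le_trans (mx_norm_mulmx _ _))//.
apply: (@le_trans _ _ (d%:R * (d%:R * B * (e / C)) * B)).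
  apply: ler_pM; rewrite ?mulr_ge0//; last by apply: hB; exact: cmg_inv.
  rewrite ler_wpM2l// (le_trans (mx_norm_mulmx _ _))//.
  apply: ler_pM; rewrite ?mulr_ge0// ler_wpM2l//; apply: hB; exact: cmg_inv.
have -> : d%:R * (d%:R * B * (e / C)) * B = (e / C) * (C - 1) by rewrite /C; ring.
by rewrite -[leRHS](divfK (lt0r_neq0 C0)) ler_wpM2l ?(ltW eC)// lerBlDr lerDl.
Qed.

End FiniteIndex.

Section CouplingKernel.
Variables (R : realType) (c : field_kind) (d : nat) (G : set 'M[R]_d).
Local Notation K := (base_field R c).
Hypothesis hG : compact_matrix_group G.
Variables n1 n2 n : nat.
Local Notation cols := ('I_n1 * 'I_n2 * 'I_n)%type.
Variables (rho1 : 'M[R]_d -> 'M[K]_n1) (rho2 : 'M[R]_d -> 'M[K]_n2)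
  (rho : 'M[R]_d -> 'M[K]_n).
Hypotheses (hrho1 : is_representation G rho1) (hrho2 : is_representation G rho2)
  (hrho : is_representation G rho).

Definition slice (x : cols -> K) (k : 'I_n) : 'M[K]_(n1, n2) :=
  \matrix_(k1, k2) x (k1, k2, k).

(** The [x] for which (u, v) |-> (u^T (slice x k) v)_k is an equivariant bilinear
    map from rho1 x rho2 to rho. *)
Definition invariant_couplings : set (cols -> K^o) :=
  [set x | forall g, G g -> forall k,
    (rho1 g)^T *m slice x k *m rho2 g = \sum_k' rho g k k' *: slice x k'].

(** Entries of the tensor product of rho1, rho2 and the dual of rho. *)
Definition coupling_coef (g : 'M[R]_d) (x y : cols) : K :=
  rho1 g x.1.1 y.1.1 * rho2 g x.1.2 y.1.2 * rho (invmx g) y.2 x.2.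

Let coupling_rep g : 'M[K]_#|{: cols}| := fmx (coupling_coef g).

Lemma coupling_rep_representation : is_representation G coupling_rep.
Proof.
apply: fmx_representation.
- move=> [[k1 k2] k] [[k1' k2'] k']; rewrite /coupling_coef /= invmx1.
  rewrite (rep_one hrho1) (rep_one hrho2) (rep_one hrho) !mxE -!natrM !mulnb.
  by rewrite -!pair_eqE /= [k' == k]eq_sym.
- move=> g h [[k1 k2] k] [[k1' k2'] k'] Gg Gh; rewrite /coupling_coef /=.
  have -> : invmx (g *m h) = invmx h *m invmx g.
    have gu := cmg_unit hG Gg; have hu := cmg_unit hG Gh.
    have ghu : g *m h \in unitmx by rewrite unitmx_mul gu.
    apply: (can_inj (mulKmx ghu)).
    by rewrite mulmxV// -mulmxA [h *m (_ *m _)]mulmxA mulmxV// mul1mx mulmxV.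
  rewrite (rep_mul hrho1)// (rep_mul hrho2)// (rep_mul hrho); [|exact: cmg_inv..].
  rewrite !mxE -(pair_bigA _ (fun z k0 => rho1 g k1 z.1 * rho2 g k2 z.2 * rho (invmx g) k0 k *
    (rho1 h z.1 k1' * rho2 h z.2 k2' * rho (invmx h) k' k0))) /=.
  rewrite -(pair_bigA _ (fun z1 z2 => \sum_k0 (rho1 g k1 z1 * rho2 g k2 z2 * rho (invmx g) k0 k *
    (rho1 h z1 k1' * rho2 h z2 k2' * rho (invmx h) k' k0)))) /=.
  rewrite -mulrA mulr_suml; apply: eq_bigr => z1 _.
  rewrite mulr_suml mulr_sumr; apply: eq_bigr => z2 _.
  by rewrite !mulr_sumr; apply: eq_bigr => z3 _; ring.
- move=> g [[k1 k2] k] [[k1' k2'] k'] Gg; rewrite /coupling_coef /=.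
  have FF : Filter (nbhs g) by exact: (@nbhs_filter 'M[R]_d g).
  have FW : Filter (within G (nbhs g)) by exact: within_filter.
  apply: cvgM; first by apply: cvgM; exact: rep_entry_cvg.
  have h : rho (invmx h) @[h --> within G (nbhs g)] --> rho (invmx g).
    have Ginv : \forall h \near within G (nbhs g), G (invmx h).
      by apply: (@filterE _ (nbhs g)) => h /= Gh; exact: cmg_inv.
    exact: (rep_cvg hrho (cmg_inv hG Gg) Ginv (cmg_inv_cvg hG Gg)).
  by move/cvg_mxP: h; exact.
Qed.

Lemma invmx_mxexp (X : 'M[R]_d) : invmx (mxexp X) = mxexp (- X).
Proof.
have [u _] := mulmx1_unit (mxexpKN X).
by rewrite -[RHS](mulKmx u) mxexpKN mulmx1.
Qed.

(** The product rule: the difference quotient of a product of three entries splits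
    into three, and the other factors tend to entries of the identity. *)
Lemma coupling_rep_deriv X x y : lie_algebra G X ->
  rep_deriv coupling_rep X (enum_rank x) (enum_rank y) =
    rep_deriv rho1 X x.1.1 y.1.1 * (x.1.2 == y.1.2)%:R * (x.2 == y.2)%:R
    + (x.1.1 == y.1.1)%:R * rep_deriv rho2 X x.1.2 y.1.2 * (x.2 == y.2)%:R
    - (x.1.1 == y.1.1)%:R * (x.1.2 == y.1.2)%:R * rep_deriv rho X y.2 x.2.
Proof.
move=> GX; pose F := (0 : R)^'.
have cst (a : K) : a @[_ --> F] --> a by exact: cvg_cst.
have cvg1 m (r : 'M[R]_d -> 'M[K]_m) Y : is_representation G r -> lie_algebra G Y ->
    r (mxexp (t *: Y)) @[t --> F] --> (1%:M : 'M[K]_m).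
  move=> hr GY; rewrite -(rep_one hr); apply: (rep_cvg hr) => //; first exact: cmg_one.
    exact: filterE.
  by apply: cvg_mxexp1; [exact: nbhs_dnbhs_neq|exact: nbhs_dnbhs].
have GN : lie_algebra G (- X) by move=> t; rewrite scalerN -scaleNr; exact: GX.
have [q1 _] := rep_deriv_mxexp hG hrho1 GX.
have [q2 _] := rep_deriv_mxexp hG hrho2 GX.
have [q3 _] := rep_deriv_mxexp hG hrho GX.
have q3N : (of_real c t)^-1 *: (rho (mxexp (t *: - X)) - 1%:M) @[t --> F] --> - rep_deriv rho X.
  have h : - (rho (mxexp (t *: - X)) *m ((of_real c t)^-1 *: (rho (mxexp (t *: X)) - 1%:M)))
      @[t --> F] --> - (1%:M *m rep_deriv rho X).
    by apply: cvgN; apply: cvg_mulmx => //; exact: cvg1.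
  rewrite mul1mx in h; apply: cvg_trans h; apply: near_eq_cvg; apply: nearW => t /=.
  rewrite -scalemxAr -scalerN; congr (_ *: _).
  rewrite mulmxBr -(rep_mul hrho) ?mulmx1 ?opprB; [|exact: GN|exact: GX].
  by rewrite scalerN mxexpNK (rep_one hrho).
have [qS _] := rep_deriv_mxexp hG coupling_rep_representation GX.
have e1 := (cvg_mxP _ _).1 (cvg1 _ _ _ hrho1 GX).
have e2 := (cvg_mxP _ _).1 (cvg1 _ _ _ hrho2 GX).
have e3 := (cvg_mxP _ _).1 (cvg1 _ _ _ hrho GN).
have {}q1 := (cvg_mxP _ _).1 q1.
have {}q2 := (cvg_mxP _ _).1 q2.
have {}q3N := (cvg_mxP _ _).1 q3N.
have {qS}/cvg_mxP/(_ (enum_rank x) (enum_rank y)) qS := qS.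
case: x y qS => [[x1 x2] x3] [[y1 y2] y3] /= qS.
pose D1 : K := (x1 == y1)%:R; pose D2 : K := (x2 == y2)%:R.
(* telescopic form of the difference quotient of the product of three factors *)
have lim : ((of_real c t)^-1 *: (rho1 (mxexp (t *: X)) - 1%:M)) x1 y1
        * rho2 (mxexp (t *: X)) x2 y2 * rho (mxexp (t *: - X)) y3 x3
      + D1 * ((of_real c t)^-1 *: (rho2 (mxexp (t *: X)) - 1%:M)) x2 y2
        * rho (mxexp (t *: - X)) y3 x3
      + D1 * D2 * ((of_real c t)^-1 *: (rho (mxexp (t *: - X)) - 1%:M)) y3 x3
    @[t --> F] -->
    rep_deriv rho1 X x1 y1 * (1%:M : 'M[K]_n2) x2 y2 * (1%:M : 'M[K]_n) y3 x3
    + D1 * rep_deriv rho2 X x2 y2 * (1%:M : 'M[K]_n) y3 x3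
    + D1 * D2 * (- rep_deriv rho X) y3 x3.
  apply: cvgD; first apply: cvgD.
  - by apply: cvgM; [apply: cvgM; [exact: q1|exact: e2]|exact: e3].
  - by apply: cvgM; [apply: cvgM; [exact: cst|exact: q2]|exact: e3].
  - by apply: cvgM; [exact: cst|exact: q3N].
transitivity (rep_deriv rho1 X x1 y1 * (1%:M : 'M[K]_n2) x2 y2 * (1%:M : 'M[K]_n) y3 x3
    + D1 * rep_deriv rho2 X x2 y2 * (1%:M : 'M[K]_n) y3 x3
    + D1 * D2 * (- rep_deriv rho X) y3 x3); last first.
  by rewrite !mxE mulrN [y3 == x3]eq_sym.
apply: (@cvg_unique _ (@norm_hausdorff K K^o) _ _ _ _ qS).
apply: cvg_trans lim; apply: near_eq_cvg; apply: nearW => t /=.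
rewrite !mxE !enum_rankK /coupling_coef /= invmx_mxexp -scalerN.
rewrite (inj_eq enum_rank_inj) -!pair_eqE /= [y3 == x3]eq_sym -!mulnb !natrM -/D1 -/D2.
ring.
Qed.

(** The coupling matrix stacks the differentials of the representation
    [coupling_rep] at the generators, so its kernel consists of the vectors fixed
    by G, and these are the invariant couplings once rho is moved to the other
    side of the equation. *)
Theorem coupling_kerE (Ndim : nat) (X : 'I_Ndim -> 'M[R]_d) :
  connected G -> lie_generators G X ->
  coupling_ker X rho1 rho2 rho = invariant_couplings.
Proof.
move=> cG hX; apply/seteqP.
suff eqv (x : cols -> K^o) : coupling_ker X rho1 rho2 rho x <-> invariant_couplings x.
  by split=> x /eqv.
pose v : 'rV[K]_#|{: cols}| := \row_i x (enum_val i).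
have vS g : v *m coupling_rep g = v <-> forall k, slice x k =
    \sum_k' rho (invmx g) k k' *: ((rho1 g)^T *m slice x k' *m rho2 g).
  have E y : (v *m coupling_rep g) 0 (enum_rank y) =
      (\sum_k' rho (invmx g) y.2 k' *: ((rho1 g)^T *m slice x k' *m rho2 g)) y.1.1 y.1.2.
    rewrite mxE; under eq_bigr do rewrite !mxE enum_rankK.
    rewrite (sum_enum_val (fun z => x z * coupling_coef g z y)).
    case: y => [[y1 y2] y3]; rewrite /coupling_coef /= summxE.
    rewrite sum_triple; apply: eq_bigr => z3 _; rewrite !mxE mulr_sumr.
    apply: eq_bigr => z2 _; rewrite mxE mulr_suml mulr_sumr.
    by apply: eq_bigr => z1 _; rewrite !mxE; ring.
  split=> [vE k|sE].
    apply/matrixP => k1 k2; rewrite -(E (k1, k2, k)) vE !mxE enum_rankK.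
    by [].
  apply/rowP => i; rewrite -(enum_valK i) (E (enum_val i)) -sE !mxE enum_valK.
  by rewrite -!surjective_pairing.
have inv_eq g : G g -> (forall k, slice x k =
    \sum_k' rho (invmx g) k k' *: ((rho1 g)^T *m slice x k' *m rho2 g)) <->
    forall k, (rho1 g)^T *m slice x k *m rho2 g = \sum_k' rho g k k' *: slice x k'.
  move=> Gg.
  have twist (r r' : 'M[K]_n) (u w : 'I_n -> 'M[K]_(n1, n2)) : r *m r' = 1%:M ->
      (forall k, u k = \sum_k' r' k k' *: w k') -> forall k, w k = \sum_k' r k k' *: u k'.
    move=> rr' uw k; under eq_bigr do rewrite uw scaler_sumr.
    rewrite exchange_big /=; transitivity (\sum_k' (1%:M : 'M[K]_n) k k' *: w k').
      by rewrite (bigD1 k)//= mxE eqxx scale1r big1 ?addr0// => j; rewrite mxE eq_sym => /negPf->; rewrite scale0r.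
    apply: eq_bigr => j _; rewrite -rr' mxE scaler_suml.
    by apply: eq_bigr => i _; rewrite scalerA.
  split; apply: twist; [exact: (rep_mulV hG hrho Gg)|exact: (rep_mulVg hG hrho Gg)].
have [GX genX] := hX.
have fixP := rep_fixedP hG v cG hX coupling_rep_representation.
split=> [kx g Gg|xinv].
  apply/(inv_eq g Gg)/vS; apply: fixP.2 => // i.
  apply/rowP => j; rewrite -(enum_valK j) !mxE -[RHS](kx (i, enum_val j)).
  rewrite -[RHS]sum_enum_val; apply: eq_bigr => z _.
  rewrite mxE -[X in rep_deriv _ _ X](enum_valK z) coupling_rep_deriv//.
  case: (enum_val z) => [[z1 z2] z3]; case: (enum_val j) => [[j1 j2] j3] /=.
  by rewrite mulrC [j1 == _]eq_sym [j2 == _]eq_sym [j3 == _]eq_sym.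
move=> [i y].
have /rowP/(_ (enum_rank y)) := fixP.1 (fun g Gg => (vS g).2 ((inv_eq g Gg).2 (xinv g Gg))) i.
rewrite !mxE; apply: etrans; rewrite -[LHS]sum_enum_val; apply: eq_bigr => z _.
rewrite mxE -[X in rep_deriv _ _ X](enum_valK z) coupling_rep_deriv//.
case: (enum_val z) => [[z1 z2] z3]; case: y => [[j1 j2] j3] /=.
by rewrite mulrC [j1 == _]eq_sym [j2 == _]eq_sym [j3 == _]eq_sym.
Qed.

End CouplingKernel.

(** * Bases and dimensions *)

Section Bases.
Variables (K : fieldType) (E : lmodType K).

Lemma basis_fin_span (V : set E) m (b : 'I_m -> E) x : is_basis b V -> V x ->
  exists t : 'I_m -> K, x = \sum_i t i *: b i.
Proof.
move=> [_ _ bspan] /bspan[s [a ->]]; elim: s => [|i s [t IH]].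
  by exists (fun=> 0); rewrite big_nil big1// => i _; rewrite scale0r.
exists (fun j => (if j == i then a i else 0) + t j).
under [RHS]eq_bigr do rewrite scalerDl; rewrite big_split /= big_cons IH; congr (_ + _).
by rewrite (bigD1 i)//= eqxx big1 ?addr0// => j /negPf->; rewrite scale0r.
Qed.

Lemma basis_fin_free (V : set E) m (b : 'I_m -> E) (t : 'I_m -> K) : is_basis b V ->
  \sum_i t i *: b i = 0 -> forall i, t i = 0.
Proof.
move=> [_ bfree _] t0 i.
by apply: (bfree (index_enum _) t) => //; [exact: index_enum_uniq|exact: mem_index_enum].
Qed.

Lemma is_basis_seq (V : set E) (J : eqType) (b : J -> E) (q : seq J) :
  uniq q -> (forall j, j \in q) -> (forall j, V (b j)) ->
  (forall a : J -> K, \sum_(j <- q) a j *: b j = 0 -> forall j, a j = 0) ->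
  (forall x, V x -> exists a : J -> K, x = \sum_(j <- q) a j *: b j) ->
  is_basis b V.
Proof.
move=> uq qall bV bfree bspan; split=> //; last by move=> x /bspan[a ->]; exists q, a.
move=> s a us sa0 j js.
have := bfree (fun j => if j \in s then a j else 0) _ j; rewrite js; apply.
rewrite -[RHS]sa0.
transitivity (\sum_(j <- q | j \in s) a j *: b j).
  by rewrite [RHS]big_mkcond; apply: eq_bigr => i _; case: ifP => // _; rewrite scale0r.
rewrite -big_filter; apply: perm_big; apply: uniq_perm => // [|i].
  exact: filter_uniq.
by rewrite mem_filter qall andbT.
Qed.

(** The product of the two change-of-basis matrices is the identity. *)
Lemma basis_card_le (V : set E) m n (b : 'I_m -> E) (b' : 'I_n -> E) :
  is_basis b V -> is_basis b' V -> (m <= n)%N.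
Proof.
move=> hb hb'.
have [bV _ _] := hb; have [bV' _ _] := hb'.
have /choice[P hP] i := basis_fin_span hb' (bV i).
have /choice[Q hQ] j := basis_fin_span hb (bV' j).
pose MP : 'M[K]_(m, n) := \matrix_(i, j) P i j.
pose MQ : 'M[K]_(n, m) := \matrix_(i, j) Q i j.
apply: (@mulmx1_min _ _ _ MP MQ); apply/matrixP => i k; rewrite !mxE.
apply/eqP; rewrite -subr_eq0; apply/eqP; move: k.
apply: (basis_fin_free (t := fun k => \sum_j MP i j * MQ j k - (i == k)%:R) hb).
under eq_bigr do rewrite scalerBl; rewrite sumrB.
rewrite [X in _ - X](bigD1 i)//= eqxx scale1r [X in _ - (_ + X)]big1 ?addr0; last first.
  by move=> k /negPf ki; rewrite eq_sym ki scale0r.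
apply/eqP; rewrite subr_eq0; apply/eqP; rewrite [RHS]hP.
under eq_bigr do rewrite scaler_suml; rewrite exchange_big /=.
apply: eq_bigr => j _; rewrite hQ scaler_sumr; apply: eq_bigr => k _.
by rewrite scalerA !mxE.
Qed.

Lemma fdim_basis (V : set E) (J : eqType) (b : J -> E) (q : seq J) :
  is_basis b V -> uniq q -> (forall j, j \in q) -> fdim V = size q.
Proof.
move=> [bV bfree bspan] uq qall.
pose b' (i : 'I_(size q)) := b (tnth (in_tuple q) i).
have sumE (a : J -> K) : \sum_i a (tnth (in_tuple q) i) *: b' i = \sum_(j <- q) a j *: b j.
  by rewrite [RHS]big_tnth.
have hb' : is_basis b' V.
  apply: (is_basis_seq (q := index_enum _)).
  - exact: index_enum_uniq.
  - exact: mem_index_enum.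
  - by move=> i; exact: bV.
  - move=> a a0 i.
    pose a' j := if insub (index j q) is Some k then a k else 0.
    have a'E k : a' (tnth (in_tuple q) k) = a k.
      rewrite /a' (tnth_nth (tnth (in_tuple q) k)) /= index_uniq// insubT//= => lt.
      by congr a; apply: val_inj.
    have := bfree q a' uq; rewrite -sumE; under eq_bigr do rewrite a'E.
    by move=> /(_ a0 (tnth (in_tuple q) i) (qall _)); rewrite a'E.
  - move=> x /bspan[s [a ->]].
    exists (fun i => a (tnth (in_tuple q) i) * (count_mem (tnth (in_tuple q) i) s)%:R).
    rewrite (sumE (fun j => a j * (count_mem j s)%:R)).
    elim: s => [|j s IH]; first by rewrite big_nil big1// => j _; rewrite mulr0 scale0r.
    rewrite big_cons IH /=; under [RHS]eq_bigr do rewrite natrD mulrDr scalerDl.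
    rewrite big_split /=; congr (_ + _).
    rewrite (bigD1_seq j)//= eqxx mulr1 big1 ?addr0// => i /negPf ij.
    by rewrite eq_sym ij mulr0 scale0r.
rewrite /fdim; case: xgetP => [k -> [b'' hb'']|/(_ (size q))[]]; last by exists b'.
by apply/eqP; rewrite eqn_leq (basis_card_le hb'' hb') (basis_card_le hb' hb'').
Qed.

(** Bases correspond under a linear isomorphism of [V] onto [V'] that is induced by
    an injection of the ambient spaces. *)
Lemma is_basis_transfer (E' : lmodType K) (J : eqType) (Phi : E -> E') (b : J -> E)
    (V : set E) (V' : set E') :
  linear Phi -> injective Phi -> (forall x, V' (Phi x) <-> V x) ->
  (forall y, V' y -> exists x, y = Phi x) ->
  is_basis (fun j => Phi (b j)) V' <-> is_basis b V.
Proof.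
move=> lPhi iPhi VV' sPhi.
have Phi0 : Phi 0 = 0.
  have := lPhi 1 0 0; rewrite !scale1r addr0 => /eqP.
  by rewrite -subr_eq subrr eq_sym => /eqP.
have PhiS (s : seq J) (a : J -> K) :
    Phi (\sum_(j <- s) a j *: b j) = \sum_(j <- s) a j *: Phi (b j).
  by elim: s => [|j s IH]; rewrite ?big_nil// !big_cons lPhi IH.
split=> [[bV bfree bspan]|[bV bfree bspan]]; split.
- by move=> j; apply/VV'.
- by move=> s a us a0; apply: bfree => //; rewrite -PhiS a0.
- by move=> x /VV'/bspan[s [a xE]]; exists s, a; apply: iPhi; rewrite PhiS.
- by move=> j; apply/VV'.
- by move=> s a us a0; apply: bfree => //; apply: iPhi; rewrite PhiS a0.
- by move=> y Vy; have [x yx] := sPhi y Vy; move: Vy; rewrite yx => /VV'/bspan[s [a ->]];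
    exists s, a; rewrite PhiS.
Qed.

End Bases.

(** * Equivariant tensors of two representations *)

Section CoupledBasis.
Variables (R : realType) (c : field_kind) (d : nat) (G : set 'M[R]_d).
Local Notation K := (base_field R c).
Hypothesis hG : compact_matrix_group G.
Variables (I : choiceType) (n : I -> nat) (rho : forall l, 'M[R]_d -> 'M[K]_(n l)).
Hypothesis hrho : complete_irreducible_family G rho.
Hypothesis hsc : forall l, scalar_commutant G (rho l).
Variables (s1 s2 : nat) (sigma1 : 'M[R]_d -> 'M[K]_s1) (sigma2 : 'M[R]_d -> 'M[K]_s2).
Hypotheses (hs1 : is_representation G sigma1) (hs2 : is_representation G sigma2).
Variables (L : I) (dim1 dim2 : I -> nat) (dim12 : I * I -> nat).
Variable B1 : forall L1, 'I_(dim1 L1) -> 'M[K]_(n L1, s1).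
Variable B2 : forall L2, 'I_(dim2 L2) -> 'M[K]_(n L2, s2).
Hypothesis hB1 : forall L1, is_basis (@B1 L1) (intertwiners G sigma1 (rho L1)).
Hypothesis hB2 : forall L2, is_basis (@B2 L2) (intertwiners G sigma2 (rho L2)).
Variable cf : forall L1 L2, 'I_(dim12 (L1, L2)) -> 'I_(n L1) * 'I_(n L2) * 'I_(n L) -> K^o.
Hypothesis hcf : forall L1 L2,
  is_basis (@cf L1 L2) (invariant_couplings G (rho L1) (rho L2) (rho L)).

Local Notation copy1 := {L : I & 'I_(dim1 L)}.
Local Notation copy2 := {L : I & 'I_(dim2 L)}.
Local Notation index := (coupled_index dim1 dim2 dim12).

(** Coordinates of the equivariant functions for rho L in a tensor product: [M k]
    is the k-th component, with rows and columns indexed by the two factors. *)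
Definition equivariant_tensors : set ('I_(n L) -> 'M[K]_(s1, s2)) :=
  [set M | forall g, G g -> forall k,
    (sigma1 g)^T *m M k *m sigma2 g = \sum_k' rho L g k k' *: M k'].

Definition coupled_mx (z : index) : 'I_(n L) -> 'M[K]_(s1, s2) :=
  let: existT (L1, L2) (i1, i2, j) := z in
  fun k => (B1 i1)^T *m slice (cf j) k *m B2 i2.

(* An index of the coupled basis is a copy in sigma1, a copy in sigma2 and a basis
   coupling between their types; [uncouple] recovers these from the index. *)
Definition couple (x : copy1) (y : copy2) (j : 'I_(dim12 (tag x, tag y))) : index :=
  existT _ (tag x, tag y) (tagged x, tagged y, j).

Definition uncouple (z : index) : {xy : copy1 * copy2 & 'I_(dim12 (tag xy.1, tag xy.2))} :=
  let: existT (L1, L2) (i1, i2, j) := z in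
  existT (fun xy : copy1 * copy2 => 'I_(dim12 (tag xy.1, tag xy.2)))
    (existT _ L1 i1, existT _ L2 i2) j.

Lemma coupleP (z : index) : exists x y j, z = @couple x y j.
Proof. by case: z => -[L1 L2] [[i1 i2] j]; exists (existT _ L1 i1), (existT _ L2 i2), j. Qed.

Definition couplings (p1 : seq copy1) (p2 : seq copy2) : seq index :=
  [seq couple j | xy <- [seq (x, y) | x <- p1, y <- p2],
                  j <- enum 'I_(dim12 (tag xy.1, tag xy.2))].

Lemma uniq_couplings p1 p2 : uniq p1 -> uniq p2 -> uniq (couplings p1 p2).
Proof.
move=> u1 u2; apply: allpairs_uniq_dep.
- by apply: allpairs_uniq => // -[? ?] [? ?].
- by move=> xy _; exact: enum_uniq.
- by move=> [[[L1 i1] [L2 i2]] j] [[[L1' i1'] [L2' i2']] j'] _ _ /(congr1 uncouple).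
Qed.

Lemma mem_couplings p1 p2 : (forall x, x \in p1) -> (forall y, y \in p2) ->
  forall z, z \in couplings p1 p2.
Proof.
move=> p1all p2all z; have [x [y [j ->]]] := coupleP z.
apply/allpairsPdep; exists (x, y), j; split=> //; last by rewrite mem_enum.
by apply/allpairsP; exists (x, y).
Qed.

Lemma sum_couplings (V : nmodType) p1 p2 (f : index -> V) :
  \sum_(z <- couplings p1 p2) f z =
    \sum_(x <- p1) \sum_(y <- p2) \sum_(j < dim12 (tag x, tag y)) f (couple j).
Proof.
rewrite big_allpairs_dep big_allpairs /=.
by apply: eq_bigr => x _; apply: eq_bigr => y _; rewrite big_enum.
Qed.

Lemma coupled_mx_couple x y (j : 'I_(dim12 (tag x, tag y))) k :
  coupled_mx (couple j) k = (copy_mx B1 x)^T *m slice (cf j) k *m copy_mx B2 y.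
Proof. by []. Qed.

(** Apply the independence of copies to the right factors, then to the left ones. *)
Lemma copies_pair_free p1 p2 (D : forall (x : copy1) (y : copy2), 'M[K]_(n (tag x), n (tag y))) :
  uniq p1 -> uniq p2 ->
  \sum_(x <- p1) \sum_(y <- p2) (copy_mx B1 x)^T *m D x y *m copy_mx B2 y = 0 ->
  forall x y, x \in p1 -> y \in p2 -> D x y = 0.
Proof.
move=> u1 u2 D0 x y xp yp.
have free1 := copies_free hrho hsc hB1 u1.
have free2 := copies_free hrho hsc hB2 u2.
apply: (free2 _ (D x) _ y yp).
apply/eqP; rewrite -trmx_eq0; apply/eqP.
apply: (free1 _ (fun x => (\sum_(y <- p2) D x y *m copy_mx B2 y)^T) _ x xp).
rewrite -[RHS]trmx0 -D0 linear_sum; apply: eq_bigr => {x xp}x _ /=.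
by rewrite -[copy_mx B1 x in LHS]trmxK -trmx_mul mulmx_sumr; congr trmx;
  apply: eq_bigr => z _; rewrite mulmxA.
Qed.

(** Partitions of unity on both sides write every tensor M_k uniquely as the sum of
    B_x^T Gamma_xy,k B_y over pairs of copies.  By uniqueness M is equivariant if
    and only if each Gamma_xy is an invariant coupling, that is, a unique linear
    combination of the basis couplings [cf]. *)
Theorem coupled_mx_basis : exists q : seq index,
  [/\ uniq q, forall z, z \in q & is_basis coupled_mx equivariant_tensors].
Proof.
have [p1 [D1 [u1 p1all one1]]] := copies_partition_of_unity hG hrho hsc hs1 hB1.
have [p2 [D2 [u2 p2all one2]]] := copies_partition_of_unity hG hrho hsc hs2 hB2.
have uq := uniq_couplings u1 u2; have qall := mem_couplings p1all p2all.
exists (couplings p1 p2); split=> //; apply: (is_basis_seq uq qall).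
- move=> z g Gg k; have [x [y [j ->]]] := coupleP z.
  have [cV _ _] := hcf (tag x) (tag y).
  have := cV j g Gg k; rewrite !coupled_mx_couple => cE.
  transitivity ((copy_mx B1 x)^T *m ((rho (tag x) g)^T *m slice (cf j) k *m rho (tag y) g)
      *m copy_mx B2 y).
    rewrite !mulmxA -trmx_mul (copy_mxP hB1)// trmx_mul.
    by rewrite -!mulmxA (copy_mxP hB2).
  rewrite cE mulmx_sumr mulmx_suml; apply: eq_bigr => k' _.
  by rewrite coupled_mx_couple -scalemxAr -scalemxAl.
- move=> a a0 z; have [x [y [j ->]]] := coupleP z; move: j.
  apply: (basis_fin_free (t := fun j => a (couple j)) (hcf (tag x) (tag y))).
  apply/funext => -[[k1 k2] k].
  have := @copies_pair_free p1 p2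
    (fun x y => \sum_(j < dim12 (tag x, tag y)) a (couple j) *: slice (cf j) k) u1 u2.
  move=> h.
  have : \sum_(j < dim12 (tag x, tag y)) a (couple j) *: slice (cf j) k = 0.
    apply: (h _ x y (p1all x) (p2all y)); have /(congr1 (fun M => M k)) := a0.
    rewrite sum_couplings !fct_sumE => a0k; rewrite -[RHS]a0k.
    apply: eq_bigr => x' _; rewrite !fct_sumE; apply: eq_bigr => y' _.
    rewrite fct_sumE mulmx_sumr mulmx_suml; apply: eq_bigr => j _.
    by rewrite -scalemxAr -scalemxAl.
  rewrite fct_sumE; move=> /matrixP/(_ k1 k2); rewrite summxE mxE => {}h; rewrite -[RHS]h.
  by apply: eq_bigr => j _; rewrite !mxE.
- move=> M MV.
  pose Gam x y k : 'M[K]_(n (tag x), n (tag y)) := (D1 x)^T *m M k *m D2 y.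
  pose v x y : 'I_(n (tag x)) * 'I_(n (tag y)) * 'I_(n L) -> K^o :=
    fun z => Gam x y z.2 z.1.1 z.1.2.
  have sv x y k : slice (v x y) k = Gam x y k by apply/matrixP => i j; rewrite mxE.
  have ME k : M k = \sum_(x <- p1) \sum_(y <- p2)
      (copy_mx B1 x)^T *m Gam x y k *m copy_mx B2 y.
    rewrite -[LHS]mul1mx -[LHS]mulmx1 -[X in X *m _ *m _]trmx1 one1 {1}one2.
    rewrite [(\sum_(x <- p1) _)^T]raddf_sum /= !mulmx_suml; apply: eq_bigr => x _.
    rewrite mulmx_sumr; apply: eq_bigr => y _.
    by rewrite trmx_mul /Gam !mulmxA.
  have vinv x y : invariant_couplings G (rho (tag x)) (rho (tag y)) (rho L) (v x y).
    move=> g Gg k; apply/eqP; rewrite -subr_eq0; apply/eqP.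
    move: x y (p1all x) (p2all y); apply: (@copies_pair_free p1 p2
      (fun x y => (rho (tag x) g)^T *m slice (v x y) k *m rho (tag y) g -
         \sum_k' rho L g k k' *: slice (v x y) k') u1 u2).
    transitivity ((sigma1 g)^T *m M k *m sigma2 g - \sum_k' rho L g k k' *: M k'); last first.
      by rewrite MV// subrr.
    rewrite ME mulmx_sumr mulmx_suml.
    have -> : \sum_k' rho L g k k' *: M k' = \sum_(x <- p1) \sum_(y <- p2)
        (copy_mx B1 x)^T *m (\sum_k' rho L g k k' *: slice (v x y) k') *m copy_mx B2 y.
      under eq_bigr do rewrite ME scaler_sumr; rewrite exchange_big /=.
      apply: eq_bigr => x _; under eq_bigr do rewrite scaler_sumr.
      rewrite exchange_big /=; apply: eq_bigr => y _.
      rewrite mulmx_sumr mulmx_suml; apply: eq_bigr => k' _.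
      by rewrite sv -scalemxAr -scalemxAl.
    rewrite -sumrB; apply: eq_bigr => x _; rewrite mulmx_sumr mulmx_suml -sumrB.
    apply: eq_bigr => y _; rewrite mulmxBr mulmxBl; congr (_ - _).
    rewrite !mulmxA -trmx_mul -(copy_mxP hB1)// trmx_mul sv.
    by rewrite -!mulmxA -(copy_mxP hB2).
  pose t x y := projT1 (cid (basis_fin_span (hcf (tag x) (tag y)) (vinv x y))).
  have tE x y : v x y = \sum_j t x y j *: cf j.
    exact: projT2 (cid (basis_fin_span (hcf (tag x) (tag y)) (vinv x y))).
  pose a (z : index) : K := let: existT (L1, L2) (i1, i2, j) := z in
    t (existT _ L1 i1) (existT _ L2 i2) j.
  exists a; apply/funext => k; rewrite ME sum_couplings fct_sumE.
  apply: eq_bigr => x _; rewrite fct_sumE; apply: eq_bigr => y _.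
  rewrite fct_sumE -sv.
  have -> : slice (v x y) k = \sum_j t x y j *: slice (cf j) k.
    by apply/matrixP => i j; rewrite tE summxE mxE fct_sumE; apply: eq_bigr => z _; rewrite !mxE.
  rewrite mulmx_sumr mulmx_suml; apply: eq_bigr => j _.
  rewrite -scalemxAr -scalemxAl scalrfctE coupled_mx_couple; congr (_ *: _).
  by case: x y j => [L1 i1] [L2 i2] j.
Qed.

End CoupledBasis.

Section CountIndices.
Variables (I : choiceType) (dim1 dim2 : I -> nat) (dim12 : I * I -> nat).
Local Notation index := (coupled_index dim1 dim2 dim12).
Let term (p : I * I) := (dim12 p * dim1 p.1 * dim2 p.2)%N.

Lemma sum_count_tag (r : seq (I * I)) (q : seq index) : uniq r ->
  all (fun z => tag z \in r) q -> size q = (\sum_(p <- r) count (fun z => tag z == p) q)%N.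
Proof.
move=> ur; elim: q => [|z q IH] /=; first by rewrite big1.
move=> /andP[zr /IH IHq]; rewrite big_split /= -IHq.
rewrite (bigD1_seq (tag z))//= eqxx big1 ?addn0 ?add1n// => p /negPf.
by rewrite eq_sym => ->.
Qed.

(** Sort the indices by their pair (L1, L2).  That all of them fit into a list shows
    that almost all terms of the sum vanish. *)
Lemma size_coupled_index (q : seq index) : uniq q -> (forall z, z \in q) ->
  finite_set [set p | term p != 0%N] /\
  size q = \big[addn/0%N]_(p \in [set: I * I]) term p.
Proof.
move=> uq qall.
pose r := undup [seq tag z | z <- q].
have count_term p : count (fun z => tag z == p) q = term p.
  have : perm_eq [seq z <- q | tag z == p]
      [seq existT _ p t | t <- enum {: 'I_(dim1 p.1) * 'I_(dim2 p.2) * 'I_(dim12 p)}].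
    apply: uniq_perm.
    - exact: filter_uniq.
    - rewrite map_inj_uniq ?enum_uniq// => t t' /eqP.
      by rewrite -[_ == _]/(_ == _) eq_Tagged => /eqP.
    - move=> z; rewrite mem_filter qall andbT; apply/eqP/mapP => [<-|[t _ ->]//].
      by case: z => p' t; exists t; rewrite ?mem_enum.
  move/perm_size; rewrite size_filter size_map -cardE !card_prod !card_ord => ->.
  by rewrite /term mulnC mulnA.
have rP p : term p != 0%N -> p \in r.
  rewrite -count_term -lt0n -has_count => /hasP[z zq /eqP<-].
  by rewrite mem_undup map_f.
split.
  apply: (@sub_finite_set _ _ [set` r]) => [p /= /rP//|]; exact: finite_seq.
rewrite -(fsbig_widen [set` r] [set: I * I])//; last first.
  by move=> p [_ /= pr]; apply/eqP; apply: contraPT pr => /rP /negP; rewrite /= => + h; apply.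
rewrite -(@fsbig_seq _ _ _ _ r) ?undup_uniq//.
under eq_bigr do rewrite -count_term.
apply: sum_count_tag; first exact: undup_uniq.
by apply/allP => z zq; rewrite mem_undup map_f.
Qed.

End CountIndices.

(** * Linear combinations and tensor products *)

Lemma linear_at0 (K : fieldType) (E E' : lmodType K) (f : E' -> E) : linear f -> f 0 = 0.
Proof.
move=> lf; have := lf 1 0 0; rewrite !scale1r addr0 => /eqP.
by rewrite -subr_eq subrr eq_sym => /eqP.
Qed.

Lemma linear_injective (K : fieldType) (E E' : lmodType K) (f : E' -> E) :
  linear f -> (forall x, f x = 0 -> x = 0) -> injective f.
Proof.
move=> lf f0 x y xy; apply/eqP; rewrite -subr_eq0; apply/eqP; apply: f0.
by rewrite addrC -scaleN1r lf xy scaleN1r addNr.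
Qed.

Section LinearCombinations.
Variables (K : fieldType) (E : lmodType K).

Lemma span_sub (T : finType) (u : T -> E) (V : set E) :
  linear_subspace V -> (forall t, V (u t)) -> span_of u `<=` V.
Proof.
move=> [V0 VD] uV _ [a ->]; elim: (index_enum T) => [|t s IH]; first by rewrite big_nil.
by rewrite big_cons; apply: VD.
Qed.

Lemma span_of_subspace (T : finType) (u : T -> E) : linear_subspace (span_of u).
Proof.
split; first by exists (fun=> 0); rewrite big1// => t _; rewrite scale0r.
move=> a x y [f ->] [h ->]; exists (fun t => a * f t + h t).
by rewrite scaler_sumr -big_split; apply: eq_bigr => t _; rewrite scalerDl scalerA.
Qed.

Lemma span_of_gen (T : finType) (u : T -> E) t : span_of u (u t).
Proof.
exists (fun t' => (t' == t)%:R); rewrite (bigD1 t)//= eqxx scale1r big1 ?addr0//.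
by move=> t' /negPf->; rewrite scale0r.
Qed.

(** The row [k] of [C] holds the coordinates of the k-th vector on [u]. *)
Definition funmx m (T : finType) (u : T -> E) (C : 'M[K]_(m, #|T|)) : 'I_m -> E :=
  fun k => \sum_i C k i *: u (enum_val i).

Lemma funmxE m (T : finType) (u : T -> E) (C : 'M[K]_(m, #|T|)) k :
  funmx u C k = \sum_t C k (enum_rank t) *: u t.
Proof. by rewrite -sum_enum_val; apply: eq_bigr => i _; rewrite enum_valK. Qed.

Lemma funmx_linear m (T : finType) (u : T -> E) : linear (@funmx m T u).
Proof.
move=> a C C'; apply/funext => k.
rewrite -[RHS]/(a *: funmx u C k + funmx u C' k) /funmx scaler_sumr -big_split.
by apply: eq_bigr => i _; rewrite !mxE scalerDl scalerA.
Qed.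

Definition pairmx (T1 T2 : finType) (w : T1 * T2 -> E) (M : 'M[K]_(#|T1|, #|T2|)) : E :=
  \sum_i \sum_j M i j *: w (enum_val i, enum_val j).

Lemma pairmxE (T1 T2 : finType) (w : T1 * T2 -> E) (M : 'M[K]_(#|T1|, #|T2|)) :
  pairmx w M = \sum_t M (enum_rank t.1) (enum_rank t.2) *: w t.
Proof.
transitivity (\sum_t M (enum_rank t.1) (enum_rank t.2) *: w (t.1, t.2)); last first.
  by apply: eq_bigr => -[].
rewrite -(pair_bigA _ (fun i j => M (enum_rank i) (enum_rank j) *: w (i, j))) /=.
rewrite -[RHS]sum_enum_val; apply: eq_bigr => i _.
by rewrite -[RHS]sum_enum_val; apply: eq_bigr => j _; rewrite !enum_valK.
Qed.

Lemma pairmx_linear (T1 T2 : finType) (w : T1 * T2 -> E) : linear (pairmx w).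
Proof.
move=> a M M'; rewrite /pairmx scaler_sumr -big_split; apply: eq_bigr => i _ /=.
rewrite scaler_sumr -big_split; apply: eq_bigr => j _ /=.
by rewrite !mxE scalerDl scalerA.
Qed.

Definition lin_free (T : finType) (u : T -> E) :=
  forall a : T -> K, \sum_t a t *: u t = 0 -> forall t, a t = 0.

Lemma funmx_inj m (T : finType) (u : T -> E) : lin_free u -> injective (@funmx m T u).
Proof.
move=> fu; apply: linear_injective; first exact: (@funmx_linear m T u).
move=> C C0; apply/matrixP => k i; rewrite mxE -(enum_valK i).
apply: (fu (fun t => C k (enum_rank t))).
by rewrite -funmxE -[RHS](congr1 (fun f => f k) C0).
Qed.

Lemma pairmx_inj (T1 T2 : finType) (w : T1 * T2 -> E) : lin_free w -> injective (pairmx w).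
Proof.
move=> fw; apply: linear_injective; first exact: pairmx_linear.
move=> M M0; apply/matrixP => i j; rewrite mxE -(enum_valK i) -(enum_valK j).
apply: (fw (fun t => M (enum_rank t.1) (enum_rank t.2)) _ (enum_val i, enum_val j)).
by rewrite -pairmxE.
Qed.

End LinearCombinations.

Lemma orthonormal_free (R : realType) (c : field_kind) (E : lmodType (base_field R c))
    (D : set E) (sp : E -> E -> base_field R c) (T : finType) (u : T -> E) :
  is_scalar_product D sp -> (forall t, D (u t)) ->
  (forall t t', sp (u t) (u t') = (t == t')%:R) -> lin_free u.
Proof.
move=> hsp uD uu a a0 t.
have [D0 DD] := sp_domain hsp.
have sp0 z : D z -> sp 0 z = 0.
  move=> Dz; have := sp_linear hsp 1 D0 D0 Dz; rewrite scale1r addr0 mul1r => /eqP.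
  by rewrite -subr_eq subrr eq_sym => /eqP.
have [_] : D (\sum_t a t *: u t) /\
    sp (\sum_t a t *: u t) (u t) = \sum_t' a t' * (t' == t)%:R.
  elim: (index_enum T) => [|t' s [Ds IH]]; first by rewrite !big_nil sp0.
  by rewrite !big_cons; split; [exact: DD|rewrite (sp_linear hsp)// IH uu].
rewrite a0 sp0// (bigD1 t)//= eqxx mulr1 big1 ?addr0// => t' /negPf->.
by rewrite mulr0.
Qed.

(** Distributivity, in a noncommutative ring and with a summation range that depends
    on the factor.  The ranges are gathered in their disjoint union, over which
    distributivity for non-dependent functions applies. *)
Lemma prod_sum_dffun (B : nzRingType) (N : nat) (T : 'I_N -> finType)
    (x : forall a, T a -> B) :
  \prod_a \sum_(j : T a) x a j = \sum_(m : {dffun forall a, T a}) \prod_a x a (m a).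
Proof.
under eq_bigr => a _ do rewrite (big_tag x a).
rewrite bigA_distr_big_dep (reindex _ (onW_bij _ (dffun_of_fprod_bij T))) /=.
transitivity (\sum_(t : fprod T) \prod_(i in 'I_N) [ffun j => x i j] (t i)).
  rewrite big_fprod; apply: eq_bigr => g _; apply: eq_bigr => i _.
  congr (untag _ _ _); apply/funext => j; by rewrite ffunE.
by apply: eq_bigr => t _; apply: eq_bigr => i _; rewrite !ffunE.
Qed.

Lemma prod_eq_dffun (B : nzRingType) (N : nat) (T : 'I_N -> finType)
    (x y : {dffun forall a, T a}) :
  \prod_a ((x a == y a)%:R : B) = (x == y)%:R.
Proof.
have [->|xy] := eqVneq x y; first by rewrite big1// => a _; rewrite eqxx.
have [a /negPf xya] : exists a, x a != y a.
  apply/existsP; apply: contraNT xy => /existsPn h; apply/eqP/ffunP => a.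
  by apply/eqP; move: (h a); rewrite negbK.
rewrite -natr_prod; apply/eqP; rewrite -[X in _ == X](mulr0n 1); apply/eqP; congr (_%:R).
by rewrite (bigD1 a)//= xya mul0n.
Qed.

Section TensorRepresentation.
Variables (R : realType) (c : field_kind) (d : nat) (G : set 'M[R]_d).
Local Notation K := (base_field R c).
Variables (I : eqType) (n : I -> nat) (rho : forall l, 'M[R]_d -> 'M[K]_(n l)).
Hypothesis hrho : forall l, is_representation G (rho l).
Variables (N : nat) (l : N.-tuple I).

(** Entries of the tensor product of the representations rho (tnth l a). *)
Definition tensor_coef (g : 'M[R]_d) (m m' : multi_index n l) : K :=
  \prod_a rho (tnth l a) g (m a) (m' a).

Definition tensor_rep (g : 'M[R]_d) : 'M[K]_#|multi_index n l| := fmx (tensor_coef g).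

Lemma tensor_rep_representation : is_representation G tensor_rep.
Proof.
apply: fmx_representation.
- move=> x y; rewrite /tensor_coef -prod_eq_dffun; apply: eq_bigr => a _.
  by rewrite (rep_one (hrho _)) mxE.
- move=> g h x y Gg Gh; rewrite /tensor_coef.
  under eq_bigr do rewrite (rep_mul (hrho _))// mxE.
  by rewrite prod_sum_dffun; apply: eq_bigr => z _; rewrite big_split.
- move=> g x y Gg; rewrite /tensor_coef.
  have FF : Filter (nbhs g) by exact: (@nbhs_filter 'M[R]_d g).
  have FW : Filter (within G (nbhs g)) by exact: within_filter.
  elim: (index_enum _) => [|a s IH].
    rewrite big_nil; under eq_fun do rewrite big_nil.
    exact: cvg_cst.
  rewrite big_cons; under eq_fun do rewrite big_cons.
  by apply: cvgM => //; exact: rep_entry_cvg.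
Qed.

End TensorRepresentation.

(** * Spaces of equivariant functions *)

Lemma first_vars_map (T T' : Type) N1 N2 (f : T -> T') (r : (N1 + N2).-tuple T) :
  first_vars (map_tuple f r) = map_tuple f (first_vars r).
Proof. by apply: eq_from_tnth => i; rewrite !(tnth_map, tnth_mktuple). Qed.

Lemma last_vars_map (T T' : Type) N1 N2 (f : T -> T') (r : (N1 + N2).-tuple T) :
  last_vars (map_tuple f r) = map_tuple f (last_vars r).
Proof. by apply: eq_from_tnth => i; rewrite !(tnth_map, tnth_mktuple). Qed.

Section FunctionSpaces.
Variables (R : realType) (c : field_kind) (d : nat) (G : set 'M[R]_d).
Local Notation K := (base_field R c).
Variables (Omega : Type) (act : 'M[R]_d -> Omega -> Omega).
Variables (F : lmodType K) (A : algType K) (emb : {linear F -> A}).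
Variables (I : choiceType) (n : I -> nat) (phi : forall l, 'I_(n l) -> Omega -> F).
Variable rho : forall l, 'M[R]_d -> 'M[K]_(n l).
Hypothesis hphi : forall (l : I) (m : 'I_(n l)) (g : 'M[R]_d) (r : Omega), G g ->
  phi m (act g r) = \sum_m' rho l g m m' *: phi m' r.
Variables (D : set (Omega -> F)) (sp : (Omega -> F) -> (Omega -> F) -> K).
Hypothesis hDphi : forall (l : I) (m : 'I_(n l)), D (phi m).
Hypothesis horth : forall (l l' : I) (m : 'I_(n l)) (m' : 'I_(n l')),
  sp (phi m) (phi m') = ((l == l') && (m == m' :> nat))%:R.
Variables (Dn : forall N : nat, set (N.-tuple Omega -> A))
  (spn : forall N : nat, (N.-tuple Omega -> A) -> (N.-tuple Omega -> A) -> K).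
Hypothesis hspn : induced_scalar_product emb D sp Dn spn.

Local Notation bf := (basis_fun emb phi).
Local Notation basis_funs l := (@basis_fun _ _ _ _ _ emb _ _ phi _ l).

(** Distribute the product of the transformation laws of the factors. *)
Lemma basis_fun_act N (l : N.-tuple I) (m : multi_index n l) g r : G g ->
  bf m (map_tuple (act g) r) = \sum_m' tensor_coef rho g m m' *: bf m' r.
Proof.
move=> Gg; rewrite /basis_fun /tensor_fun.
transitivity (\prod_(a < N) \sum_m' (rho (tnth l a) g (m a) m' *: emb (phi m' (tnth r a)))).
  apply: eq_bigr => a _; rewrite tnth_map hphi// linear_sum.
  by apply: eq_bigr => m' _; rewrite linearZ.
by rewrite prod_sum_dffun; apply: eq_bigr => m' _; rewrite scaler_prod.
Qed.

Lemma basis_fun_act_mx N (l : N.-tuple I) (i : 'I_#|multi_index n l|) g r : G g ->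
  bf (enum_val i) (map_tuple (act g) r) =
    \sum_j tensor_rep rho l g i j *: bf (enum_val j) r.
Proof.
move=> Gg; rewrite basis_fun_act// -sum_enum_val.
by apply: eq_bigr => j _; rewrite mxE.
Qed.

Lemma funmx_act N (l : N.-tuple I) s (C : 'M[K]_(s, #|multi_index n l|)) k g r : G g ->
  funmx (basis_funs l) C k (map_tuple (act g) r) =
    funmx (basis_funs l) (C *m tensor_rep rho l g) k r.
Proof.
move=> Gg; rewrite /funmx !fct_sumE.
transitivity (\sum_i C k i *: \sum_j tensor_rep rho l g i j *: bf (enum_val j) r).
  by apply: eq_bigr => i _; rewrite -basis_fun_act_mx.
under eq_bigr do rewrite scaler_sumr; rewrite exchange_big /=; apply: eq_bigr => j _.
rewrite mxE -[RHS]/(_ *: bf (enum_val j) r) scaler_suml.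
by apply: eq_bigr => i _; rewrite scalerA.
Qed.

Lemma basis_fun_free N (l : N.-tuple I) : lin_free (basis_funs l).
Proof.
have [hN hspT] := hspn.
have spE (x y : multi_index n l) := hspT N (fun a => phi (x a)) (fun a => phi (y a))
  (fun a => hDphi (x a)) (fun a => hDphi (y a)).
apply: (orthonormal_free (hN N)) => [x|x y]; first by have [] := spE x x.
have [_ _ ->] := spE x y; rewrite -prod_eq_dffun; apply: eq_bigr => a _.
by rewrite horth eqxx.
Qed.

(** In coordinates, equivariant functions are intertwiners from the tensor product
    to rho L. *)
Lemma equivariant_funmx N (l : N.-tuple I) (L : I) (C : 'M[K]_(n L, #|multi_index n l|)) :
  equivariant_space G act emb phi rho l (L := L)
    (funmx (basis_funs l) C) <->
  intertwiners G (tensor_rep rho l) (rho L) C.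
Proof.
have mulE g k r : funmx (basis_funs l) (rho L g *m C) k r =
    \sum_k' rho L g k k' *: funmx (basis_funs l) C k' r.
  rewrite /funmx fct_sumE; under [RHS]eq_bigr do rewrite fct_sumE scaler_sumr.
  rewrite exchange_big /=; apply: eq_bigr => i _.
  rewrite mxE -[LHS]/(_ *: bf (enum_val i) r) scaler_suml.
  by apply: eq_bigr => k' _; rewrite -scalerA.
split=> [[_ Ceq] g Gg|Cint].
  apply: (funmx_inj (@basis_fun_free N l)); apply/funext => k; apply/funext => r.
  by rewrite -funmx_act// Ceq// mulE.
split=> [k|g r k Gg]; last by rewrite funmx_act// Cint// mulE.
exists (fun t => C k (enum_rank t)); exact: funmxE.
Qed.

Lemma span_funmx N (l : N.-tuple I) s (f : 'I_s -> N.-tuple Omega -> A) :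
  (forall k, tensor_space emb phi l (f k)) ->
  exists C, f = funmx (basis_funs l) C.
Proof.
move=> /choice[a fE].
exists (\matrix_(k, i) a k (enum_val i)); apply/funext => k; rewrite fE funmxE.
by apply: eq_bigr => t _; rewrite mxE enum_rankK.
Qed.

Lemma equivariant_basis_mx N (l : N.-tuple I) (L : I) (J : eqType)
    (b : J -> 'I_(n L) -> N.-tuple Omega -> A) :
  is_basis b (equivariant_space G act emb phi rho l (L := L)) ->
  exists B, b = (fun j => funmx (basis_funs l) (B j)) /\
    is_basis B (intertwiners G (tensor_rep rho l) (rho L)).
Proof.
move=> hb; have [bV _ _] := hb.
have /choice[B BE] j := span_funmx (bV j).1.
have bE : b = (fun j => funmx (basis_funs l) (B j)) by apply/funext.
exists B; split=> //; move: hb; rewrite bE => hb.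
have tr := @is_basis_transfer K _ _ J (@funmx K _ (n L) _ (basis_funs l)) B
  (intertwiners G (tensor_rep rho l) (rho L)) _ (@funmx_linear _ _ _ _ _)
  (funmx_inj (@basis_fun_free N l)) (@equivariant_funmx N l L).
by apply: (tr _).1 hb => f [/span_funmx].
Qed.

Section Concatenation.
Variables (N1 N2 : nat).

Definition cat_vars (T : Type) (f : 'I_N1 -> T) (h : 'I_N2 -> T) (a : 'I_(N1 + N2)) : T :=
  match fintype.split a with inl i => f i | inr j => h j end.

Lemma cat_varsl T (f : 'I_N1 -> T) h i : cat_vars f h (lshift N2 i) = f i.
Proof. by rewrite /cat_vars -[lshift _ _]/(unsplit (inl i)) unsplitK. Qed.

Lemma cat_varsr T f (h : 'I_N2 -> T) j : cat_vars f h (rshift N1 j) = h j.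
Proof. by rewrite /cat_vars -[rshift _ _]/(unsplit (inr j)) unsplitK. Qed.

Lemma tensor_fun_cat (f : 'I_(N1 + N2) -> Omega -> F) r :
  tensor_fun emb f r = tensor_fun emb (fun i => f (lshift N2 i)) (first_vars r) *
    tensor_fun emb (fun j => f (rshift N1 j)) (last_vars r).
Proof.
rewrite /tensor_fun big_split_ord; congr (_ * _); apply: eq_bigr => i _;
  by rewrite tnth_mktuple.
Qed.

Variables (l1 : N1.-tuple I) (l2 : N2.-tuple I).
Local Notation m1 := (multi_index n l1).
Local Notation m2 := (multi_index n l2).

Definition pair_fun (t : m1 * m2) : (N1 + N2).-tuple Omega -> A :=
  fun r => bf t.1 (first_vars r) * bf t.2 (last_vars r).

Lemma pair_fun_cat t : pair_fun t =
  tensor_fun emb (cat_vars (fun i => phi (t.1 i)) (fun j => phi (t.2 j))).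
Proof.
apply/funext => r; rewrite tensor_fun_cat /pair_fun; congr (_ * _);
  by congr (tensor_fun emb _ _); apply/funext => i; rewrite (cat_varsl, cat_varsr).
Qed.

(** Products of two basis functions are again orthonormal, since the scalar product
    of N1 + N2 variables is multiplicative. *)
Lemma pair_fun_free : lin_free pair_fun.
Proof.
have [hN hspT] := hspn.
pose f (t : m1 * m2) := cat_vars (fun i => phi (t.1 i)) (fun j => phi (t.2 j)).
have Df t a : D (f t a) by rewrite /f /cat_vars; case: (fintype.split a).
have spE t t' := hspT _ (f t) (f t') (Df t) (Df t').
apply: (orthonormal_free (hN (N1 + N2)%N)) => [t|t t'].
  by rewrite pair_fun_cat; have [] := spE t t.
rewrite !pair_fun_cat; have [_ _ ->] := spE t t'.
rewrite big_split_ord -pair_eqE /= -mulnb natrM -!prod_eq_dffun; congr (_ * _);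
  by apply: eq_bigr => i _; rewrite /f ?cat_varsl ?cat_varsr horth eqxx.
Qed.

(** The label of a factor of the concatenated tuple equals the original label only
    propositionally; stating equality of the functions avoids casts of indices. *)
Lemma phi_cast (L L' : I) (m : 'I_(n L)) : L = L' -> exists m' : 'I_(n L'), phi m' = phi m.
Proof. by move=> <-; exists m. Qed.

Lemma tensor_space_cat : tensor_space emb phi (cat_tuple l1 l2) = span_of pair_fun.
Proof.
apply/seteqP; split; apply: span_sub; try exact: span_of_subspace.
  move=> m.
  have /fin_all_exists[x xE] i := phi_cast (m (lshift N2 i)) (tnth_lshift l1 l2 i).
  have /fin_all_exists[y yE] j := phi_cast (m (rshift N1 j)) (tnth_rshift l1 l2 j).
  have -> : bf m = pair_fun ([ffun i => x i], [ffun j => y j]).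
    apply/funext => r; rewrite /basis_fun tensor_fun_cat /pair_fun; congr (_ * _);
    by congr (tensor_fun emb _ _); apply/funext => i; rewrite ffunE (xE, yE).
  exact: span_of_gen.
move=> t.
have hm a : exists m : 'I_(n (tnth (cat_tuple l1 l2) a)),
    phi m = cat_vars (fun i => phi (t.1 i)) (fun j => phi (t.2 j)) a.
  rewrite -(splitK a); case: (fintype.split a) => [i|j] /=.
    by rewrite cat_varsl; apply: phi_cast; rewrite tnth_lshift.
  by rewrite cat_varsr; apply: phi_cast; rewrite tnth_rshift.
have [m mE] := fin_all_exists hm.
have -> : pair_fun t = bf ([ffun a => m a] : multi_index n (cat_tuple l1 l2)).
  rewrite pair_fun_cat /basis_fun; congr tensor_fun; apply/funext => a.
  by rewrite ffunE mE.
exact: span_of_gen.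
Qed.

(** Used with the matrices of the group action, for the transformation law, and with
    bases of intertwiners, for the formula that defines the coupled functions. *)
Lemma pairmx_mul s1 s2 (B1 : 'M[K]_(s1, #|{: m1}|)) (B2 : 'M[K]_(s2, #|{: m2}|))
    (M : 'M[K]_(s1, s2)) r :
  pairmx pair_fun (B1^T *m M *m B2) r = \sum_k1 \sum_k2 M k1 k2 *:
    (funmx (basis_funs l1) B1 k1 (first_vars r) * funmx (basis_funs l2) B2 k2 (last_vars r)).
Proof.
pose u (i : 'I_#|{: m1}|) : A := bf (enum_val i) (first_vars r).
pose v (j : 'I_#|{: m2}|) : A := bf (enum_val j) (last_vars r).
have -> : pairmx pair_fun (B1^T *m M *m B2) r =
    \sum_i \sum_j (B1^T *m M *m B2) i j *: (u i * v j).
  by rewrite /pairmx fct_sumE; apply: eq_bigr => i _; rewrite fct_sumE.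
transitivity (\sum_i \sum_j \sum_k1 \sum_k2 (B1 k1 i * M k1 k2 * B2 k2 j) *: (u i * v j)).
  apply: eq_bigr => i _; apply: eq_bigr => j _.
  under eq_bigr do rewrite -scaler_suml; rewrite -scaler_suml; congr (_ *: _).
  rewrite mxE; under eq_bigr do rewrite mxE mulr_suml; rewrite exchange_big /=.
  by apply: eq_bigr => k1 _; apply: eq_bigr => k2 _; rewrite [_^T _ _]mxE.
under eq_bigr do rewrite exchange_big /=.
rewrite exchange_big /=; apply: eq_bigr => k1 _.
under eq_bigr do rewrite exchange_big /=.
rewrite exchange_big /=; apply: eq_bigr => k2 _.
rewrite /funmx !fct_sumE mulr_suml scaler_sumr; apply: eq_bigr => i _.
rewrite mulr_sumr scaler_sumr; apply: eq_bigr => j _.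
rewrite -[RHS]/(M k1 k2 *: ((B1 k1 i *: u i) * (B2 k2 j *: v j))).
by rewrite -[_ *: u i * _]scalerAl -[u i * (_ *: _)]scalerAr !scalerA [M k1 k2 * _]mulrC.
Qed.

Lemma pairmx_act (M : 'M[K]_(#|{: m1}|, #|{: m2}|)) g r : G g ->
  pairmx pair_fun M (map_tuple (act g) r) =
    pairmx pair_fun ((tensor_rep rho l1 g)^T *m M *m tensor_rep rho l2 g) r.
Proof.
move=> Gg; rewrite pairmx_mul /pairmx fct_sumE; apply: eq_bigr => i _.
rewrite fct_sumE; apply: eq_bigr => j _.
rewrite -[LHS]/(_ *: pair_fun _ _) /pair_fun first_vars_map last_vars_map.
by rewrite !basis_fun_act_mx// /funmx !fct_sumE.
Qed.

Variable L : I.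

Definition tensors_fun (M : 'I_(n L) -> 'M[K]_(#|{: m1}|, #|{: m2}|)) :
    'I_(n L) -> (N1 + N2).-tuple Omega -> A := fun k => pairmx pair_fun (M k).

Lemma tensors_fun_linear : linear tensors_fun.
Proof. by move=> a M M'; apply/funext => k; rewrite /tensors_fun pairmx_linear. Qed.

Lemma tensors_fun_inj : injective tensors_fun.
Proof.
move=> M M' /(congr1 (fun f => f _)) MM'; apply/funext => k.
exact: (pairmx_inj pair_fun_free (MM' k)).
Qed.

Lemma span_tensors_fun (f : 'I_(n L) -> (N1 + N2).-tuple Omega -> A) :
  (forall k, tensor_space emb phi (cat_tuple l1 l2) (f k)) -> exists M, f = tensors_fun M.
Proof.
rewrite tensor_space_cat => /choice[a fE].
exists (fun k => \matrix_(i, j) a k (enum_val i, enum_val j)); apply/funext => k.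
rewrite fE /tensors_fun pairmxE; apply: eq_bigr => -[x y] _.
by rewrite mxE !enum_rankK.
Qed.

(** A product function is equivariant if and only if its coordinate matrices are,
    because the products of basis functions are independent. *)
Lemma equivariant_tensors_fun M :
  equivariant_space G act emb phi rho (cat_tuple l1 l2) (L := L) (tensors_fun M) <->
  equivariant_tensors G rho (tensor_rep rho l1) (tensor_rep rho l2) (L := L) M.
Proof.
have mulE g k r : pairmx pair_fun (\sum_k' rho L g k k' *: M k') r =
    \sum_k' rho L g k k' *: tensors_fun M k' r.
  rewrite -[LHS]/((fun x => pairmx pair_fun x r) _).
  elim/big_rec2: _ => [|k' y x _ <-]; last by rewrite pairmx_linear.
  by rewrite (linear_at0 (pairmx_linear pair_fun)).
split=> [[_ Meq] g Gg k|Mint].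
  apply: (pairmx_inj pair_fun_free); apply/funext => r.
  by rewrite -pairmx_act// mulE -Meq.
split=> [k|g r k Gg]; last by rewrite /tensors_fun pairmx_act// Mint// mulE.
rewrite tensor_space_cat; exists (fun t => M k (enum_rank t.1) (enum_rank t.2)).
exact: pairmxE.
Qed.

End Concatenation.
End FunctionSpaces.

(** * The coupled basis *)

Lemma lie_compact_group (R : realType) (d : nat) (G : set 'M[R]_d) :
  is_linear_lie_group G -> compact G -> compact_matrix_group G.
Proof. by move=> [? ? ? ? _] ?; split. Qed.

Theorem proposition2p15
  (R : realType) (c : field_kind)
  (d : nat) (G : set 'M[R]_d)
  (hG : is_linear_lie_group G) (Gcompact : compact G) (Gconnected : connected G)
  (Ndim : nat) (X : 'I_Ndim -> 'M[R]_d) (hX : lie_generators G X)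
  (Omega : Type) (act : 'M[R]_d -> Omega -> Omega) (hact : is_action G act)
  (F : lmodType (base_field R c)) (A : algType (base_field R c)) (emb : {linear F -> A})
  (I : choiceType) (n : I -> nat)
  (phi : forall l : I, 'I_(n l) -> Omega -> F)
  (rho : forall l : I, 'M[R]_d -> 'M[base_field R c]_(n l))
  (hphi : forall (l : I) (m : 'I_(n l)) (g : 'M[R]_d) (r : Omega), G g ->
    phi l m (act g r) = \sum_m' rho l g m m' *: phi l m' r)
  (hrho : complete_irreducible_family G rho)
  (hreal : c = RealField -> forall l : I, scalar_commutant G (rho l))
  (D : set (Omega -> F)) (sp : (Omega -> F) -> (Omega -> F) -> base_field R c)
  (hsp : is_scalar_product D sp)
  (hDphi : forall (l : I) (m : 'I_(n l)), D (phi l m))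
  (horth : forall (l l' : I) (m : 'I_(n l)) (m' : 'I_(n l')),
    sp (phi l m) (phi l' m') = ((l == l') && (m == m' :> nat))%:R)
  (Dn : forall N : nat, set (N.-tuple Omega -> A))
  (spn : forall N : nat,
    (N.-tuple Omega -> A) -> (N.-tuple Omega -> A) -> base_field R c)
  (hspn : induced_scalar_product emb D sp Dn spn)
  (N1 N2 : nat) (hN1 : (0 < N1)%N) (hN2 : (0 < N2)%N)
  (l : (N1 + N2).-tuple I) (l1 : N1.-tuple I) (l2 : N2.-tuple I) (L : I)
  (hl : l = cat_tuple l1 l2)
  (b1 : forall L1 : I, 'I_(equivariant_dim G act emb phi rho l1 L1) ->
    'I_(n L1) -> N1.-tuple Omega -> A)
  (hb1 : forall L1 : I,
    is_basis (b1 L1) (equivariant_space G act emb phi rho l1 (L := L1)))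
  (b2 : forall L2 : I, 'I_(equivariant_dim G act emb phi rho l2 L2) ->
    'I_(n L2) -> N2.-tuple Omega -> A)
  (hb2 : forall L2 : I,
    is_basis (b2 L2) (equivariant_space G act emb phi rho l2 (L := L2)))
  (cf : forall L1 L2 : I,
    'I_(equivariant_dim G act emb phi rho [tuple L1; L2] L) ->
    'I_(n L1) * 'I_(n L2) * 'I_(n L) -> (base_field R c)^o)
  (hcf : forall L1 L2 : I,
    is_basis (cf L1 L2) (coupling_ker X (rho L1) (rho L2) (rho L))) :
  let dim1 := fun L1 : I => equivariant_dim G act emb phi rho l1 L1 in
  let dim2 := fun L2 : I => equivariant_dim G act emb phi rho l2 L2 in
  let dim12 := fun p : I * I =>
    equivariant_dim G act emb phi rho [tuple p.1; p.2] L in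
  let term := fun p : I * I => (dim12 p * dim1 p.1 * dim2 p.2)%N in
  is_basis
    (coupled_fun (dim1 := dim1) (dim2 := dim2) (dim12 := dim12) b1 b2 cf)
    (equivariant_space G act emb phi rho l (L := L)) /\
  (* finite_set makes the possibly infinite sum a genuine one *)
  (finite_set [set p : I * I | term p != 0%N] /\
   equivariant_dim G act emb phi rho l L =
     \big[addn/0%N]_(p \in [set: I * I]) term p).
Proof.
move=> dim1 dim2 dim12 term; rewrite {l}hl.
have hGc := lie_compact_group hG Gcompact.
have hrep := family_rep hrho.
have hsc l := schur_scalar (family_irreducible hrho l) (fun cR => hreal cR l).
have hcf' L1 L2 : is_basis (cf L1 L2) (invariant_couplings G (rho L1) (rho L2) (rho L)).
  by rewrite -(coupling_kerE hGc (hrep L1) (hrep L2) (hrep L) Gconnected hX).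
have hB1 L1 := cid (equivariant_basis_mx hphi hDphi horth hspn (hb1 L1)).
have hB2 L2 := cid (equivariant_basis_mx hphi hDphi horth hspn (hb2 L2)).
pose B1 L1 := projT1 (hB1 L1); pose B2 L2 := projT1 (hB2 L2).
have [B1E B1b] : (forall L1, b1 L1 = fun i => funmx (@basis_fun _ _ _ _ _ emb _ _ phi _ l1) (B1 L1 i))
    /\ (forall L1, is_basis (B1 L1) (intertwiners G (tensor_rep rho l1) (rho L1))).
  by split=> L1; case: (projT2 (hB1 L1)).
have [B2E B2b] : (forall L2, b2 L2 = fun i => funmx (@basis_fun _ _ _ _ _ emb _ _ phi _ l2) (B2 L2 i))
    /\ (forall L2, is_basis (B2 L2) (intertwiners G (tensor_rep rho l2) (rho L2))).
  by split=> L2; case: (projT2 (hB2 L2)).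
have [q [uq qall hq]] := coupled_mx_basis (dim12 := dim12) hGc hrho hsc
  (tensor_rep_representation hrep l1) (tensor_rep_representation hrep l2) B1b B2b hcf'.
have cE : coupled_fun (dim1 := dim1) (dim2 := dim2) (dim12 := dim12) b1 b2 cf =
    (fun z => tensors_fun emb phi (coupled_mx B1 B2 cf z)).
  apply/funext => -[[L1 L2] [[i1 i2] j]]; apply/funext => k; apply/funext => r.
  rewrite /coupled_fun /tensors_fun /= pairmx_mul B1E B2E.
  by apply: eq_bigr => k1 _; apply: eq_bigr => k2 _; rewrite mxE.
have hbasis : is_basis (coupled_fun (dim1 := dim1) (dim2 := dim2) (dim12 := dim12) b1 b2 cf)
    (equivariant_space G act emb phi rho (cat_tuple l1 l2) (L := L)).
  rewrite cE.
  have tr := is_basis_transfer (coupled_mx (dim12 := dim12) B1 B2 cf)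
    (tensors_fun_linear (n := n) emb phi (l1 := l1) (l2 := l2) (L := L))
    (tensors_fun_inj hDphi horth hspn (l1 := l1) (l2 := l2) (L := L))
    (equivariant_tensors_fun hphi hDphi horth hspn (l1 := l1) (l2 := l2) (L := L)).
  by apply: (tr _).2 hq => f [/span_tensors_fun].
split=> //; have [fin qE] := size_coupled_index uq qall.
split=> //; rewrite -qE; exact: (fdim_basis hbasis uq qall).
Qed.
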